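(* Let $k\ge 3$. Then the sequence $$\mathcal P_1 \xrightarrow{\ \subset\ } U_h \xrightarrow{\operatorname{grad}\operatorname{grad}} \boldsymbol\Sigma_h \xrightarrow{\operatorname{curl}} \boldsymbol\Xi_h \xrightarrow{\operatorname{div}} \boldsymbol Q_h \longrightarrow 0$$ is an exact complex; that is, each operator maps its space into the next one, the kernel of $\operatorname{grad}\operatorname{grad}$ on $U_h$ is $\mathcal P_1$, $\ker(\operatorname{curl}|_{\boldsymbol\Sigma_h})=\operatorname{grad}\operatorname{grad}U_h$, $\ker(\operatorname{div}|_{\boldsymbol\Xi_h})=\operatorname{curl}\boldsymbol\Sigma_h$, and $\operatorname{div}\boldsymbol\Xi_h=\boldsymbol Q_h$.
   Context: Notation. Coordinates are $(x_1,x_2,x_3)=(x,y,z)$, $\partial_i=\partial/\partial x_i$. Whenever indices $i,j,l$ occur together they are pairwise distinct, i.e. $\{i,j,l\}=\{1,2,3\}$. $\mathcal Q(i{:}a,j{:}b,l{:}c)$ is the space of polynomials of degree at most $a$ in $x_i$, at most $b$ in $x_j$ and at most $c$ in $x_l$ (separately); similarly with fewer variables on faces and edges; it is the zero space if some bound is negative. $\mathcal Q_{a,b,c}=\mathcal Q(1{:}a,2{:}b,3{:}c)$. $\mathbb S$, $\mathbb T$ are the symmetric, respectively traceless, real $3\times3$ matrices. $\operatorname{curl}$ and $\operatorname{div}$ act row-wise on matrix fields. $\mathcal P_1$ is the space of polynomials of total degree $\le1$. Mesh. $\Omega\subset\mathbb R^3$ is a contractible domain with Lipschitz boundary, partitioned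 by a (face-to-face) mesh $\mathcal T_h$ of axis-parallel cuboids. $e_i$ denotes an edge parallel to the $x_i$-axis; $F_{ij}=F_{ji}$ denotes a face parallel to the $x_i$- and $x_j$-axes (normal to the $x_l$-direction). A finite element space given by a shape function space on each cell $T$ and degrees of freedom (DOFs) on $T$ consists of all piecewise polynomial fields whose restriction to each cell is in the shape function space and such that each DOF attached to a vertex, edge or face has the same value from all cells containing that vertex, edge or face. ''Moments of $f$ on $G$ against $P$'' means the functionals $\int_G f\,p$ for all $p\in P$. $U_h$ (scalar): shape functions $\mathcal Q_{k,k,k}$; DOFs: (1) $\partial_1^{\alpha_1}\partial_2^{\alpha_2}\partial_3^{\alpha_3}u$, $\alpha\in\{0,1\}^3$, at each vertex; (2) moments of $u,\partial_ju,\partial_lu,\partial_j\partial_lu$ on each edge $e_i$ against $\mathcal Q(i{:}k-4)$; (3) moments of $u,\partial_lu$ on each face $F_{ij}$ against $\mathcal Q(i{:}k-4,j{:}k-4)$; (4) moments of $u$ on $T$ against $\mathcal Q_{k-4,k-4,k-4}$. $\boldsymbol\Sigma_h$ (values in $\mathbb S$): shape functions: symmetric $\boldsymbol\sigma$ with $\sigma_{ii}\in\mathcal Q(i{:}k-2,j{:}k,l{:}k)$ and, for $i\neq j$, $\sigma_{ij}=\sigma_{ji}\in\mathcal Q(i{:}k-1,j{:}k-1,l{:}k)$. DOFs of $\sigma_{ii}$ ($i=1,2,3$): moments of $\sigma_{ii},\partial_j\sigma_{ii},\partial_l\sigma_{ii},\partial_j\partial_l\sigma_{ii}$ on each $e_i$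 against $\mathcal Q(i{:}k-2)$; for each $j\ne i$, moments of $\sigma_{ii},\partial_l\sigma_{ii}$ on each $F_{ij}$ against $\mathcal Q(i{:}k-2,j{:}k-4)$; moments of $\sigma_{ii}$ on $T$ against $\mathcal Q(i{:}k-2,j{:}k-4,l{:}k-4)$. DOFs of $\sigma_{ij}$ ($i<j$): $\sigma_{ij},\partial_l\sigma_{ij}$ at each vertex; moments of $\sigma_{ij},\partial_l\sigma_{ij}$ on each $e_i$ against $\mathcal Q(i{:}k-3)$ and on each $e_j$ against $\mathcal Q(j{:}k-3)$; moments of $\sigma_{ij}$ on each $e_l$ against $\mathcal Q(l{:}k-4)$; moments of $\sigma_{ij},\partial_l\sigma_{ij}$ on each $F_{ij}$ against $\mathcal Q(i{:}k-3,j{:}k-3)$; moments of $\sigma_{ij}$ on each $F_{il}$ against $\mathcal Q(i{:}k-3,l{:}k-4)$ and on each $F_{jl}$ against $\mathcal Q(j{:}k-3,l{:}k-4)$; moments of $\sigma_{ij}$ on $T$ against $\mathcal Q(i{:}k-3,j{:}k-3,l{:}k-4)$. $\boldsymbol\Xi_h$ (values in $\mathbb T$): shape functions: traceless $\boldsymbol\tau$ with $\tau_{ii}\in\mathcal Q_{k-1,k-1,k-1}$ and, for $i\ne j$, $\tau_{ij}\in\mathcal Q(i{:}k-2,j{:}k,l{:}k-1)$. DOFs of each $\tau_{ii}$ (given for only two of the three diagonal entries, the third being determined by tracelessness): values at vertices; moments on each edge against polynomials of degree $\le k-3$; moments on each face against polynomials of degree $\le k-3$ in each of the two face variables; moments on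 $T$ against $\mathcal Q_{k-3,k-3,k-3}$. DOFs of $\tau_{ij}$ (all $i\neq j$): moments of $\tau_{ij},\partial_j\tau_{ij}$ on each $e_i$ against $\mathcal Q(i{:}k-2)$; moments of $\tau_{ij}$ on each $F_{ij}$ against $\mathcal Q(i{:}k-2,j{:}k-4)$; moments of $\tau_{ij},\partial_j\tau_{ij}$ on each $F_{il}$ against $\mathcal Q(i{:}k-2,l{:}k-3)$; moments of $\tau_{ij}$ on $T$ against $\mathcal Q(i{:}k-2,j{:}k-4,l{:}k-3)$. $\boldsymbol Q_h$ (values in $\mathbb R^3$): shape functions $q_i\in\mathcal Q(i{:}k-2,j{:}k-1,l{:}k-1)$. DOFs of $q_i$: moments on each $e_i$ against $\mathcal Q(i{:}k-2)$; for each $j\ne i$, moments on each $F_{ij}$ against $\mathcal Q(i{:}k-2,j{:}k-3)$; moments on $T$ against $\mathcal Q(i{:}k-2,j{:}k-3,l{:}k-3)$. *)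

(* Defs.v *)
From HB Require Import structures.
From mathcomp Require Import all_boot all_order all_algebra.
(* The notations of mpoly clash with those of mathcomp-analysis. *)
From mathcomp Require Import -(notations) mpoly.
From mathcomp Require Import all_classical all_reals all_analysis.

Set Implicit Arguments.
Unset Strict Implicit.
Unset Printing Implicit Defensive.

Import Order.TTheory GRing.Theory Num.Theory.
Import numFieldNormedType.Exports.

Local Open Scope classical_set_scope.
Local Open Scope ring_scope.

(* The coordinates x, y, z are numbered 0, 1, 2.  Since 'I_3 is the ring Z/3Z,
   i + 1 and i - 1 are the cyclic successor and predecessor of i : 'I_3. *)
Notation axis := 'I_3.

Notation poly3 R := (mpoly 3 R).

Definition partial (R : realType) (i : axis) (p : poly3 R) : poly3 R :=
  mderiv i p.

Definition distinct_axes (i j l : axis) : Prop := uniq [:: i; j; l].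

Definition contractible (X : topologicalType) (R : realType) (A : set X) : Prop :=
  exists (x0 : X) (H : R * X -> X),
    [/\ A x0,
        {within `[0, 1]%classic `*` A, continuous H},
        forall t x, `[0, 1]%classic t -> A x -> A (H (t, x)),
        forall x, A x -> H (0, x) = x
      & forall x, A x -> H (1, x) = x0].

(* Near every boundary point, and after an orthogonal change of coordinates
   y = x M, the set Omega is the strict epigraph y_2 > gamma (y_0, y_1) of a
   Lipschitz function. *)
Definition has_lipschitz_boundary (R : realType) (Omega : set 'rV[R]_3) : Prop :=
  forall x, (closure Omega `\` Omega°) x ->
    exists (M : 'M[R]_3) (gamma : R * R -> R) (L : R),
      [/\ M *m M^T = 1%:M,
          L.-lipschitz gamma
        & \forall p \near x,
            let y := p *m M in
            Omega p <-> gamma (y 0 0, y 0 1) < y 0 (2%:R : axis)].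

Definition lipschitz_domain (R : realType) (Omega : set 'rV[R]_3) : Prop :=
  [/\ open Omega, connected Omega & has_lipschitz_boundary Omega].

(* The product of the intervals [lo i, hi i].  Degenerate intervals are
   allowed, so that vertices, edges, faces and cells are all boxes. *)
Record box (R : realType) := Box { lo : 'rV[R]_3; hi : 'rV[R]_3 }.

Definition box_set (R : realType) (E : box R) : set 'rV[R]_3 :=
  [set x | forall i : axis, lo E 0 i <= x 0 i <= hi E 0 i].

Definition free_axes (R : realType) (E : box R) : {set axis} :=
  [set i : axis | lo E 0 i < hi E 0 i]%SET.

Definition is_vertex (R : realType) (E : box R) : Prop := free_axes E = finset.set0.
Definition is_edge (R : realType) (i : axis) (E : box R) : Prop :=
  free_axes E = [set i]%SET.
Definition is_face (R : realType) (i j : axis) (E : box R) : Prop :=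
  i != j /\ free_axes E = [set i; j]%SET.
Definition is_cell (R : realType) (E : box R) : Prop := free_axes E = [set: axis]%SET.

(* E is a vertex, an edge or a face of T, or T itself. *)
Definition subentity (R : realType) (E T : box R) : Prop :=
  forall i : axis,
    [\/ lo E 0 i = lo T 0 i /\ hi E 0 i = hi T 0 i,
        lo E 0 i = lo T 0 i /\ hi E 0 i = lo T 0 i
      | lo E 0 i = hi T 0 i /\ hi E 0 i = hi T 0 i].

(* Since E is required to be a proper subentity, distinct cells have disjoint
   interiors and cell is injective. *)
Definition face_to_face (R : realType) (I : finType) (cell : I -> box R) : Prop :=
  forall T T' : I, T != T' ->
    box_set (cell T) `&` box_set (cell T') = set0 \/
    exists E, [/\ ~ is_cell E, subentity E (cell T), subentity E (cell T')
                & box_set (cell T) `&` box_set (cell T') = box_set E].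

Definition cuboid_mesh (R : realType) (Omega : set 'rV[R]_3)
    (I : finType) (cell : I -> box R) : Prop :=
  [/\ forall T, is_cell (cell T),
      closure Omega = \bigcup_(T in [set: I]) box_set (cell T)
    & face_to_face cell].

(* Qspace [:: (i, a); (j, b); (l, c)] is Q(i:a, j:b, l:c).  Polynomials on an
   edge or a face are polynomials in which the axes not listed do not occur.
   The bounds are integers: the space is zero as soon as one of them is
   negative, which a truncated subtraction in nat would not give. *)
Fixpoint degree_bound (s : seq (axis * int)) (x : axis) : int :=
  if s is (i, a) :: s' then if x == i then a else degree_bound s' x else 0.

Definition Qspace (R : realType) (s : seq (axis * int)) (p : poly3 R) : Prop :=
  forall m, m \in msupp p -> forall x : axis, (m x)%:Z <= degree_bound s x.

(* Integral over a box for the Lebesgue measure of its own dimension (number of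
   free axes), as an iterated integral; in the degenerate directions the
   coordinate is the constant lo E = hi E. *)
Definition integrate_axis (R : realType) (E : box R) (i : axis)
    (g : (axis -> R) -> R) (x : axis -> R) : R :=
  if i \in free_axes E then
    \int[lebesgue_measure]_(t in `[lo E 0 i, hi E 0 i])
      g (fun j => if j == i then t else x j)
  else g x.

Definition box_integral (R : realType) (E : box R) (g : (axis -> R) -> R) : R :=
  foldr (integrate_axis E) g (enum 'I_3) (lo E 0).

Definition moment (R : realType) (E : box R) (f p : poly3 R) : R :=
  box_integral E (fun x => meval x f * meval x p).

Definition vertex_value (R : realType) (E : box R) (f : poly3 R) : R :=
  meval (lo E 0) f.

(* A field assigns to each cell T : I a local polynomial field in V, the
   restriction of the field to T.  dof E is the set of the degrees of freedom
   attached to the vertex, edge, face or cell E. *)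
Definition fe_space (R : realType) (I : finType) (cell : I -> box R) (V : Type)
    (shape : V -> Prop) (dof : box R -> (V -> R) -> Prop) : set (I -> V) :=
  [set v | (forall T, shape (v T)) /\
     forall (E : box R) (T T' : I),
       subentity E (cell T) -> subentity E (cell T') ->
       forall phi, dof E phi -> phi (v T) = phi (v T')].

Definition U_shape (R : realType) (k : nat) (u : poly3 R) : Prop :=
  Qspace [:: (0, k%:Z); (1, k%:Z); (2%:R, k%:Z)] u.

Inductive U_dof (R : realType) (k : nat) (E : box R) : (poly3 R -> R) -> Prop :=
| U_vertex (a : multinom 3) of
    is_vertex E & (forall i : axis, (a i <= 1)%N) :
    U_dof k E (fun u => vertex_value E (mderivm a u))
| U_edge (i j l : axis) (D : poly3 R -> poly3 R) p of
    distinct_axes i j l & is_edge i E &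
    [\/ D = id, D = partial j, D = partial l | D = partial j \o partial l] &
    Qspace [:: (i, k%:Z - 4)] p :
    U_dof k E (fun u => moment E (D u) p)
| U_face (i j l : axis) (D : poly3 R -> poly3 R) p of
    distinct_axes i j l & is_face i j E & (D = id \/ D = partial l) &
    Qspace [:: (i, k%:Z - 4); (j, k%:Z - 4)] p :
    U_dof k E (fun u => moment E (D u) p)
| U_cell p of
    is_cell E & Qspace [:: (0, k%:Z - 4); (1, k%:Z - 4); (2%:R, k%:Z - 4)] p :
    U_dof k E (fun u => moment E u p).

Definition U_h (R : realType) (k : nat) (I : finType) (cell : I -> box R) :
    set (I -> poly3 R) :=
  fe_space cell (@U_shape R k) (@U_dof R k).

Definition Sigma_shape (R : realType) (k : nat) (s : 'M[poly3 R]_3) : Prop :=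
  [/\ s^T = s,
      forall i j l : axis, distinct_axes i j l ->
        Qspace [:: (i, k%:Z - 2); (j, k%:Z); (l, k%:Z)] (s i i)
    & forall i j l : axis, distinct_axes i j l ->
        Qspace [:: (i, k%:Z - 1); (j, k%:Z - 1); (l, k%:Z)] (s i j)].

Inductive Sigma_dof (R : realType) (k : nat) (E : box R) :
    ('M[poly3 R]_3 -> R) -> Prop :=
(* sigma_ii *)
| Sigma_diag_edge (i j l : axis) (D : poly3 R -> poly3 R) p of
    distinct_axes i j l & is_edge i E &
    [\/ D = id, D = partial j, D = partial l | D = partial j \o partial l] &
    Qspace [:: (i, k%:Z - 2)] p :
    Sigma_dof k E (fun s => moment E (D (s i i)) p)
| Sigma_diag_face (i j l : axis) (D : poly3 R -> poly3 R) p of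
    distinct_axes i j l & is_face i j E & (D = id \/ D = partial l) &
    Qspace [:: (i, k%:Z - 2); (j, k%:Z - 4)] p :
    Sigma_dof k E (fun s => moment E (D (s i i)) p)
| Sigma_diag_cell (i j l : axis) p of
    distinct_axes i j l & is_cell E &
    Qspace [:: (i, k%:Z - 2); (j, k%:Z - 4); (l, k%:Z - 4)] p :
    Sigma_dof k E (fun s => moment E (s i i) p)
(* sigma_ij with i < j *)
| Sigma_off_vertex (i j l : axis) (D : poly3 R -> poly3 R) of
    (i < j)%N & distinct_axes i j l & is_vertex E & (D = id \/ D = partial l) :
    Sigma_dof k E (fun s => vertex_value E (D (s i j)))
| Sigma_off_edge_i (i j l : axis) (D : poly3 R -> poly3 R) p of
    (i < j)%N & distinct_axes i j l & is_edge i E & (D = id \/ D = partial l) &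
    Qspace [:: (i, k%:Z - 3)] p :
    Sigma_dof k E (fun s => moment E (D (s i j)) p)
| Sigma_off_edge_j (i j l : axis) (D : poly3 R -> poly3 R) p of
    (i < j)%N & distinct_axes i j l & is_edge j E & (D = id \/ D = partial l) &
    Qspace [:: (j, k%:Z - 3)] p :
    Sigma_dof k E (fun s => moment E (D (s i j)) p)
| Sigma_off_edge_l (i j l : axis) p of
    (i < j)%N & distinct_axes i j l & is_edge l E &
    Qspace [:: (l, k%:Z - 4)] p :
    Sigma_dof k E (fun s => moment E (s i j) p)
| Sigma_off_face_ij (i j l : axis) (D : poly3 R -> poly3 R) p of
    (i < j)%N & distinct_axes i j l & is_face i j E & (D = id \/ D = partial l) &
    Qspace [:: (i, k%:Z - 3); (j, k%:Z - 3)] p :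
    Sigma_dof k E (fun s => moment E (D (s i j)) p)
| Sigma_off_face_il (i j l : axis) p of
    (i < j)%N & distinct_axes i j l & is_face i l E &
    Qspace [:: (i, k%:Z - 3); (l, k%:Z - 4)] p :
    Sigma_dof k E (fun s => moment E (s i j) p)
| Sigma_off_face_jl (i j l : axis) p of
    (i < j)%N & distinct_axes i j l & is_face j l E &
    Qspace [:: (j, k%:Z - 3); (l, k%:Z - 4)] p :
    Sigma_dof k E (fun s => moment E (s i j) p)
| Sigma_off_cell (i j l : axis) p of
    (i < j)%N & distinct_axes i j l & is_cell E &
    Qspace [:: (i, k%:Z - 3); (j, k%:Z - 3); (l, k%:Z - 4)] p :
    Sigma_dof k E (fun s => moment E (s i j) p).

Definition Sigma_h (R : realType) (k : nat) (I : finType) (cell : I -> box R) :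
    set (I -> 'M[poly3 R]_3) :=
  fe_space cell (@Sigma_shape R k) (@Sigma_dof R k).

Definition Xi_shape (R : realType) (k : nat) (t : 'M[poly3 R]_3) : Prop :=
  [/\ \tr t = 0,
      forall i j l : axis, distinct_axes i j l ->
        Qspace [:: (i, k%:Z - 1); (j, k%:Z - 1); (l, k%:Z - 1)] (t i i)
    & forall i j l : axis, distinct_axes i j l ->
        Qspace [:: (i, k%:Z - 2); (j, k%:Z); (l, k%:Z - 1)] (t i j)].

Inductive Xi_dof (R : realType) (k : nat) (E : box R) :
    ('M[poly3 R]_3 -> R) -> Prop :=
(* tau_ii with i < 2, that is, the first two diagonal entries; by linearity
   and tracelessness, any other two entries give the same space *)
| Xi_diag_vertex (i : axis) of (i < 2)%N & is_vertex E :
    Xi_dof k E (fun t => vertex_value E (t i i))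
| Xi_diag_edge (i a : axis) p of
    (i < 2)%N & is_edge a E & Qspace [:: (a, k%:Z - 3)] p :
    Xi_dof k E (fun t => moment E (t i i) p)
| Xi_diag_face (i a b : axis) p of
    (i < 2)%N & is_face a b E & Qspace [:: (a, k%:Z - 3); (b, k%:Z - 3)] p :
    Xi_dof k E (fun t => moment E (t i i) p)
| Xi_diag_cell (i : axis) p of
    (i < 2)%N & is_cell E &
    Qspace [:: (0, k%:Z - 3); (1, k%:Z - 3); (2%:R, k%:Z - 3)] p :
    Xi_dof k E (fun t => moment E (t i i) p)
(* tau_ij with i != j *)
| Xi_off_edge (i j l : axis) (D : poly3 R -> poly3 R) p of
    distinct_axes i j l & is_edge i E & (D = id \/ D = partial j) &
    Qspace [:: (i, k%:Z - 2)] p :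
    Xi_dof k E (fun t => moment E (D (t i j)) p)
| Xi_off_face_ij (i j l : axis) p of
    distinct_axes i j l & is_face i j E &
    Qspace [:: (i, k%:Z - 2); (j, k%:Z - 4)] p :
    Xi_dof k E (fun t => moment E (t i j) p)
| Xi_off_face_il (i j l : axis) (D : poly3 R -> poly3 R) p of
    distinct_axes i j l & is_face i l E & (D = id \/ D = partial j) &
    Qspace [:: (i, k%:Z - 2); (l, k%:Z - 3)] p :
    Xi_dof k E (fun t => moment E (D (t i j)) p)
| Xi_off_cell (i j l : axis) p of
    distinct_axes i j l & is_cell E &
    Qspace [:: (i, k%:Z - 2); (j, k%:Z - 4); (l, k%:Z - 3)] p :
    Xi_dof k E (fun t => moment E (t i j) p).

Definition Xi_h (R : realType) (k : nat) (I : finType) (cell : I -> box R) :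
    set (I -> 'M[poly3 R]_3) :=
  fe_space cell (@Xi_shape R k) (@Xi_dof R k).

Definition Q_shape (R : realType) (k : nat) (q : 'rV[poly3 R]_3) : Prop :=
  forall i j l : axis, distinct_axes i j l ->
    Qspace [:: (i, k%:Z - 2); (j, k%:Z - 1); (l, k%:Z - 1)] (q 0 i).

Inductive Q_dof (R : realType) (k : nat) (E : box R) :
    ('rV[poly3 R]_3 -> R) -> Prop :=
| Q_edge (i : axis) p of is_edge i E & Qspace [:: (i, k%:Z - 2)] p :
    Q_dof k E (fun q => moment E (q 0 i) p)
| Q_face (i j : axis) p of
    is_face i j E & Qspace [:: (i, k%:Z - 2); (j, k%:Z - 3)] p :
    Q_dof k E (fun q => moment E (q 0 i) p)
| Q_cell (i j l : axis) p of
    distinct_axes i j l & is_cell E &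
    Qspace [:: (i, k%:Z - 2); (j, k%:Z - 3); (l, k%:Z - 3)] p :
    Q_dof k E (fun q => moment E (q 0 i) p).

Definition Q_h (R : realType) (k : nat) (I : finType) (cell : I -> box R) :
    set (I -> 'rV[poly3 R]_3) :=
  fe_space cell (@Q_shape R k) (@Q_dof R k).

(* msize is 1 + the total degree. *)
Definition P1 (R : realType) (I : finType) : set (I -> poly3 R) :=
  [set u | exists2 p : poly3 R,
     (mmeasure mdeg p <= 2)%N & forall T, u T = p].

Definition gradgrad (R : realType) (u : poly3 R) : 'M[poly3 R]_3 :=
  \matrix_(i, j) partial i (partial j u).

Definition curl (R : realType) (s : 'M[poly3 R]_3) : 'M[poly3 R]_3 :=
  \matrix_(i, j) (partial (j + 1) (s i (j - 1)) - partial (j - 1) (s i (j + 1))).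

Definition div (R : realType) (t : 'M[poly3 R]_3) : 'rV[poly3 R]_3 :=
  \row_i \sum_(j < 3) partial j (t i j).

Definition cellwise (I V W : Type) (f : V -> W) (v : I -> V) : I -> W :=
  fun T => f (v T).

Definition kernel_on (I : Type) (V : Type) (W : zmodType)
    (f : V -> W) (A : set (I -> V)) : set (I -> V) :=
  [set v | A v /\ forall T, f (v T) = 0].

(* Main.v *)
(* The degrees of freedom say, by unisolvence in each variable, that a scalar
   component is a piecewise polynomial with prescribed degrees and prescribed
   interface continuity in each variable (conforming).  With these spaces the
   sequence is obtained by the Bernstein-Gelfand-Gelfand construction from cuboid
   de Rham complexes: the i-th rows of the matrix fields form such a complex with
   one degree (and derivative) less in x_i, and the symmetry and trace
   constraints are removed with a further de Rham complex, for the scalar fields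
   of U_h.

   Each de Rham complex is exact by a Cech-de Rham zigzag over lists of pairwise
   meeting cells.  In the form direction one uses the polynomial Poincare
   operator on a single box; in the Cech direction, Hermite extension across a
   cell; what remains are constants on the nerve of the mesh.  The nerve has no
   cohomology because the closure of Omega, pushed into Omega along the Lipschitz
   epigraph directions and then contracted, can be contracted in small steps. *)

Require Import Defs.
From HB Require Import structures.
From mathcomp Require Import all_boot all_order all_algebra.
From mathcomp Require Import -(notations) mpoly.
From mathcomp Require Import all_classical all_reals all_analysis.
From mathcomp Require Import ring lra zify polyrcf.

Set Implicit Arguments.
Unset Strict Implicit.
Unset Printing Implicit Defensive.

Import Order.TTheory GRing.Theory Num.Theory.
Import numFieldNormedType.Exports.

Local Open Scope classical_set_scope.
Local Open Scope ring_scope.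

(** * Cohomology of the nerve of the mesh *)

(** The obstacle is the agreement of derivatives across interfaces: restricting to an intersection
    of cells must remember jets. Along an axis where the intersection is degenerate, the trace of
    index [s] is therefore the Taylor polynomial with 2 - s terms, again a polynomial, of degree at
    most 1 - s. Differentiating raises the index by one both in the degree k - s and in the number
    of terms 2 - s, so one polynomial Poincare operator serves on cells, faces, edges and vertices
    alike. An extension with a prescribed two-term jet at one end of an interval and zero jet at the
    other needs cubics, hence k >= 3. Cochains are functions of lists, with repetitions allowed,
    rather than of oriented simplices; prisms and concatenations then have no degenerate cases. In
    the Bernstein-Gelfand-Gelfand step, the trace of [curl s] is minus the divergence of the vector
    that encodes the skew part of [s], and the indices of these skew entries are exactly those of
    2-forms in the scalar complex. Removing a skew part is thus exactness at 2-forms, and removing a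
    trace is exactness at 3-forms. *)

(* The simplicial coboundary: the sum of the (-1)^i f (s without its i-th entry). *)
Fixpoint del (A : Type) (V : zmodType) (f : seq A -> V) (s : seq A) : V :=
  if s is x :: s' then f s' - del (fun t => f (x :: t)) s' else 0.

Lemma eq_del (A : eqType) (V : zmodType) (f g : seq A -> V) (s : seq A) :
  (forall t, (size t).+1 = size s -> {subset t <= s} -> f t = g t) ->
  del f s = del g s.
Proof.
elim: s f g => [//|x s IHs] f g fg /=.
congr (_ - _); first by apply: fg => // y; rewrite inE orbC => ->.
apply: IHs => t st ts; apply: fg => /=; first by rewrite st.
by move=> y; rewrite !inE => /orP[->//|/ts ->]; rewrite orbT.
Qed.

Lemma eq_del1 (A : Type) (V : zmodType) (f g : seq A -> V) : f =1 g -> del f =1 del g.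
Proof.
move=> fg s; elim: s f g fg => [//|x s IHs] f g fg /=.
by rewrite fg; congr (_ - _); apply: IHs => t; apply: fg.
Qed.

Lemma del_raddf (A : Type) (V W : zmodType) (h : {additive V -> W}) (f : seq A -> V) s :
  del (h \o f) s = h (del f s).
Proof.
elim: s f => [|x s IHs] f /=; first by rewrite raddf0.
by rewrite raddfB; congr (_ - _); rewrite -IHs.
Qed.

Lemma del0 (A : Type) (V : zmodType) s : del (fun _ : seq A => 0 : V) s = 0.
Proof. by elim: s => [//|x s IHs] /=; rewrite IHs subr0. Qed.

Lemma delD (A : Type) (V : zmodType) (f g : seq A -> V) s :
  del (fun t => f t + g t) s = del f s + del g s.
Proof. by elim: s f g => [|x s IHs] f g /=; rewrite ?addr0// IHs opprD addrACA. Qed.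

Lemma delN (A : Type) (V : zmodType) (f : seq A -> V) s :
  del (fun t => - f t) s = - del f s.
Proof. by elim: s f => [|x s IHs] f /=; rewrite ?oppr0// IHs opprD. Qed.

Lemma delB (A : Type) (V : zmodType) (f g : seq A -> V) s :
  del (fun t => f t - g t) s = del f s - del g s.
Proof. by rewrite delD delN. Qed.

Lemma delM (A : Type) (V : pzRingType) (a : V) (f : seq A -> V) s :
  del (fun t => a * f t) s = a * del f s.
Proof. by elim: s f => [|x s IHs] f /=; rewrite ?mulr0// IHs mulrBr. Qed.

Lemma del_map (A B : Type) (V : zmodType) (c : A -> B) (f : seq B -> V) s :
  del f (map c s) = del (fun t => f (map c t)) s.
Proof. by elim: s f => [//|x s IHs] f /=; rewrite IHs. Qed.

Lemma del_del (A : Type) (V : zmodType) (f : seq A -> V) s : del (del f) s = 0.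
Proof. by elim: s f => [//|x s IHs] f /=; rewrite delB IHs subr0 subrr. Qed.

Lemma del_swap (A B : Type) (V : zmodType) (f : seq A -> seq B -> V) s t :
  del (fun t => del (f^~ t) s) t = del (fun s => del (f s) t) s.
Proof.
elim: s f => [|x s IHs] f /=; first by rewrite del0.
by rewrite delB; congr (_ - _); rewrite IHs.
Qed.

(** This is the total differential of a double complex, with its usual sign: later [s] holds cells
    and [t] comes from points. *)
Lemma del_cat (A : Type) (V : pzRingType) (f : seq A -> V) s t :
  del f (s ++ t) =
  del (fun s => f (s ++ t)) s + (-1) ^+ size s * del (fun t => f (s ++ t)) t.
Proof.
elim: s f => [|x s IHs] f /=; first by rewrite add0r expr0 mul1r.
by rewrite IHs opprD addrA exprS mulN1r mulNr.
Qed.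

(* The homotopy operator attached to the prism between g and h. *)
Fixpoint prism (A B : Type) (V : zmodType) (g h : A -> B) (f : seq B -> V)
    (s : seq A) : V :=
  if s is x :: s' then
    f (g x :: h x :: map h s') - prism g h (fun t => f (g x :: t)) s'
  else 0.

Lemma prismB (A B : Type) (V : zmodType) (g h : A -> B) (f f' : seq B -> V) s :
  prism g h (fun t => f t - f' t) s = prism g h f s - prism g h f' s.
Proof.
elim: s f f' => [|x s IHs] f f' /=; first by rewrite subr0.
by rewrite IHs !opprB addrACA [RHS]addrACA; congr (_ + _); rewrite addrC.
Qed.

Lemma prism0 (A B : eqType) (V : zmodType) (g h : A -> B) (f : seq B -> V) s :
  (forall t, size t = (size s).+1 -> {subset t <= map g s ++ map h s} -> f t = 0) ->
  prism g h f s = 0.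
Proof.
elim: s f => [//|x s IHs] f f0 /=.
rewrite f0 ?IHs ?subrr//=; last 2 first.
- by rewrite size_map.
- move=> y; rewrite !inE !mem_cat !inE => /or3P[->|->|->]//; rewrite ?orbT//.
move=> t st ts; apply: f0 => /=; first by rewrite st.
move=> y; rewrite !inE !mem_cat !inE => /orP[->//|/ts].
by rewrite mem_cat => /orP[->|->]; rewrite ?orbT.
Qed.

Lemma del_prism (A B : Type) (V : comPzRingType) (g h : A -> B) (f : seq B -> V) s :
  del (prism g h f) s + prism g h (del f) s = f (map h s) - f (map g s).
Proof.
elim: s f => [|x s IHs] f /=; first by rewrite addr0 subrr.
rewrite delB prismB.
rewrite (del_map h (fun t => f [:: g x, h x & t])).
have /eqP := IHs (fun t => f (g x :: t)); rewrite eq_sym subr_eq => /eqP->.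
by ring.
Qed.

(** Consecutive stages of [G] are joined by prisms that stay small, so a cocycle has cohomologous
    pullbacks along [G 0] and [G N]. The last stage is constant, and there coning with apex [a]
    exhibits the pullback as a coboundary. *)
Lemma prism_chain (A B : eqType) (V : comPzRingType) (smA : seq A -> Prop)
    (smB : seq B -> Prop) (G : nat -> A -> B) (N : nat) (a : B) (n : nat)
    (f : seq B -> V) :
  (forall s t, {subset t <= s} -> smB s -> smB t) ->
  (forall m s, smA s -> smB (map (G m) s ++ map (G m.+1) s)) ->
  (forall x, G N x = a) -> smB [:: a] ->
  (forall t, size t = n.+1 -> smB t -> del f t = 0) ->
  exists psi, forall s, size s = n -> smA s -> f (map (G 0) s) = del psi s.
Proof.
move=> her stp GN sa cl.
suff [psi Hpsi] : exists psi, forall s, size s = n -> smA s ->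
    f (map (G 0) s) = f (map (G N) s) + del psi s.
  exists (fun s => f (a :: map (fun=> a) s) + psi s) => s ss sms.
  rewrite Hpsi// delD; congr (_ + _).
  have GNE : map (G N) s = map (fun=> a) s by apply: eq_map.
  have := cl (a :: map (fun=> a) s).
  rewrite /= size_map ss => /(_ erefl) E.
  apply/eqP; rewrite GNE -subr_eq0 -(del_map _ (fun t => f (a :: t))) E//.
  apply: her sa => y; rewrite !inE => /orP[//|/mapP[? _ ->]]; exact: eqxx.
elim: N {GN sa} => [|N [psi Hpsi]]; first by exists (fun _ => 0) => s _ _; rewrite del0 addr0.
exists (fun s => psi s - prism (G N) (G N.+1) f s) => s ss sms.
rewrite Hpsi// delB; have := del_prism (G N) (G N.+1) f s.
rewrite (@prism0 _ _ _ _ _ (del f)); last first.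
  by move=> t st ts; apply: cl; rewrite ?st ?ss//; apply: her ts _; apply: stp.
by rewrite addr0 => ->; ring.
Qed.

(* A zigzag in the double complex of functions of a list of cells and a list of
   points: the columns are acyclic by the last hypothesis, except at s = [::],
   where only the class of f matters. *)
Lemma nerve_descent (A B : eqType) (V : comPzRingType) (reg : seq A -> seq B -> Prop)
    (c : B -> A) (clq : seq A -> Prop) (n : nat) (f : seq A -> V) :
  (forall s s' t t', {subset s' <= s} -> {subset t' <= t} -> reg s t -> reg s' t') ->
  (forall s t, reg s t -> clq (s ++ map c t)) ->
  (forall s, clq s -> reg s [::]) ->
  (forall s, size s = n.+1 -> clq s -> del f s = 0) ->
  (exists psi, forall t, size t = n -> reg [::] t -> f (map c t) = del psi t) ->
  (forall s q (phi : seq B -> V), s != [::] -> clq s ->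
     (forall t, size t = q.+1 -> reg s t -> del phi t = 0) ->
     exists psi, forall t, size t = q -> reg s t -> phi t = del psi t) ->
  exists g, forall s, size s = n -> clq s -> f s = del g s.
Proof.
move=> her rc c0 cl [psi0 Hpsi0] ex.
have clq_reg s t : reg s t -> clq s.
  by move=> r; have /rc := her s s t [::] (fun=> id) (fun _ => ltac:(by [])) r; rewrite cats0.
(* What is left of [f] on mixed lists once [m] accounts for the cell direction; a primitive of
   [u m s] in the point direction provides the next [m]. *)
pose u m s t := f (s ++ map c t) + del (m^~ t) s.
have key a : (a <= n)%N -> exists m : seq A -> seq B -> V, forall s t,
    size s = a -> size t = (n - a).+1 -> reg s t -> del (u m s) t = 0.
  elim: a => [|a IHa] an.
    exists (fun _ _ => 0) => s t /size0nil-> st rt; rewrite /u /=.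
    rewrite (eq_del1 (g := fun t => f (map c t))); last by move=> ? /=; rewrite addr0.
    by rewrite -del_map cl ?size_map ?st ?subn0//; apply: rc rt.
  have [m Hm] := IHa (ltnW an).
  have [psi Hpsi] : exists psi : seq A -> seq B -> V, forall s t, size s = a ->
      size t = (n - a)%N -> reg s t -> u m s t = del (psi s) t.
    have H s : exists psi : seq B -> V, size s = a -> forall t,
        size t = (n - a)%N -> reg s t -> u m s t = del psi t.
      have [sa|] := eqVneq (size s) a; last by move/eqP => sa; exists (fun _ => 0) => /sa.
      have [s0|s0] := eqVneq s [::].
        exists psi0 => _ t; rewrite -sa s0 subn0 => st rt.
        by rewrite /u /= addr0 Hpsi0.
      have [cs|ncs] := pselect (clq s).
        by have [t st rt|psi ?] := ex s (n - a)%N (u m s) s0 cs; [exact: Hm|exists psi].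
      by exists (fun _ => 0) => _ t _ /clq_reg.
    have [psi Hpsi] := choice H; exists psi => s t sa; exact: Hpsi.
  (* The sign is that of [del_cat] for a list of size [a.+1], so that the two parts of the
     coboundary cancel. *)
  exists (fun s t => (-1) ^+ a.+1 * psi s t) => s t sa st rst.
  rewrite delD [X in _ + X](_ : _ = (-1) ^+ a.+1 * del (fun s => u m s t) s).
    rewrite [in X in _ + X]/u delD (del_del (m^~ t)) addr0.
    have := del_cat f s (map c t).
    rewrite cl ?(size_cat, size_map) ?st ?sa; last 2 first.
    - by rewrite addnS subnKC.
    - exact: rc.
    move=> /eqP; rewrite eq_sym addr_eq0 => /eqP->; rewrite del_map mulrN mulrA.
    by rewrite -exprD -signr_odd addnn odd_double expr0 mul1r subrr.
  rewrite (eq_del1 (g := fun t => (-1) ^+ a.+1 * del (psi^~ t) s)) ?delM; last first.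
    by move=> t' /=; rewrite -delM.
  rewrite del_swap; congr (_ * _); apply: eq_del => s' /eqP; rewrite sa eqSS => /eqP sa' ss.
  by rewrite Hpsi ?st ?subnSK//; apply: her rst.
have [m Hm] := key n (leqnn n).
(* Every coboundary is 0 at [[::]], so [u m s [::] = 0]: [f] and the coboundary of [m^~ [::]] add up
   to 0. *)
exists (fun s => - m s [::]) => s ss cs; rewrite delN.
apply/eqP; rewrite -addr_eq0; apply/eqP.
have [s0|s0] := eqVneq s [::].
  by move: ss; rewrite s0 /= addr0 => n0; have := Hpsi0 [::] n0; rewrite /= -s0; apply; apply: c0.
have [t|psi Hpsi] := ex s 0 (u m s) s0 cs; first by move=> *; apply: Hm => //; rewrite subnn.
by have := Hpsi [::] erefl (c0 _ cs); rewrite /u /= cats0.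
Qed.

(** * Cliques of cells and their intersections *)

Definition meets (R : realType) (T T' : box R) : Prop :=
  forall i, lo T 0 i <= hi T' 0 i /\ lo T' 0 i <= hi T 0 i.

Definition clique (R : realType) (I : finType) (cell : I -> box R) (s : seq I) : Prop :=
  forall T T', T \in s -> T' \in s -> meets (cell T) (cell T').

Lemma clique_sub (R : realType) (I : finType) (cell : I -> box R) (s t : seq I) :
  {subset t <= s} -> clique cell s -> clique cell t.
Proof. by move=> ts cs T T' /ts Ts /ts T's; apply: cs. Qed.

(* For s = [::] this is a junk point. *)
Definition cap (R : realType) (I : finType) (cell : I -> box R) (s : seq I) : box R :=
  if s is T :: s' then
    Box (\row_i foldr Num.max (lo (cell T) 0 i) [seq lo (cell T') 0 i | T' <- s'])
        (\row_i foldr Num.min (hi (cell T) 0 i) [seq hi (cell T') 0 i | T' <- s'])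
  else Box 0 0.

Lemma foldr_max_ge (R : realType) (x0 : R) (l : seq R) x :
  x \in x0 :: l -> x <= foldr Num.max x0 l.
Proof.
elim: l => [|y l IHl]; first by rewrite inE => /eqP->.
by rewrite /= le_max !inE => /or3P[?|/eqP->|?]; rewrite ?lexx// IHl ?orbT// inE; apply/orP; [left|right].
Qed.

Lemma foldr_max_mem (R : realType) (x0 : R) (l : seq R) :
  foldr Num.max x0 l \in x0 :: l.
Proof.
elim: l => [|y l IHl]; rewrite /= ?mem_head// maxEle; case: ifP => _; rewrite !inE ?eqxx ?orbT//.
by move: IHl; rewrite inE => /orP[->//|->]; rewrite !orbT.
Qed.

Lemma foldr_min_le (R : realType) (x0 : R) (l : seq R) x :
  x \in x0 :: l -> foldr Num.min x0 l <= x.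
Proof.
elim: l => [|y l IHl]; first by rewrite inE => /eqP->.
by rewrite /= ge_min !inE => /or3P[?|/eqP->|?]; rewrite ?lexx// IHl ?orbT// inE; apply/orP; [left|right].
Qed.

Lemma foldr_min_mem (R : realType) (x0 : R) (l : seq R) :
  foldr Num.min x0 l \in x0 :: l.
Proof.
elim: l => [|y l IHl]; rewrite /= ?mem_head// minEle; case: ifP => _; rewrite !inE ?eqxx ?orbT//.
by move: IHl; rewrite inE => /orP[->//|->]; rewrite !orbT.
Qed.

Section Cap.
Variables (R : realType) (I : finType) (cell : I -> box R).
Implicit Types s : seq I.

Lemma cap_lo s T i : T \in s -> lo (cell T) 0 i <= lo (cap cell s) 0 i.
Proof.
case: s => //= T0 s Ts; rewrite mxE; apply: foldr_max_ge.
by rewrite -[_ :: _](map_cons (fun T => lo (cell T) 0 i)) (map_f (fun T => lo (cell T) 0 i)).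
Qed.

Lemma cap_hi s T i : T \in s -> hi (cap cell s) 0 i <= hi (cell T) 0 i.
Proof.
case: s => //= T0 s Ts; rewrite mxE; apply: foldr_min_le.
by rewrite -[_ :: _](map_cons (fun T => hi (cell T) 0 i)) (map_f (fun T => hi (cell T) 0 i)).
Qed.

Lemma cap_lo_ex s i : s != [::] -> exists2 T, T \in s & lo (cap cell s) 0 i = lo (cell T) 0 i.
Proof.
case: s => //= T0 s _; rewrite mxE.
have := foldr_max_mem (lo (cell T0) 0 i) [seq lo (cell T') 0 i | T' <- s].
by rewrite -[_ :: _](map_cons (fun T => lo (cell T) 0 i)) => /mapP[T ? ->]; exists T.
Qed.

Lemma cap_hi_ex s i : s != [::] -> exists2 T, T \in s & hi (cap cell s) 0 i = hi (cell T) 0 i.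
Proof.
case: s => //= T0 s _; rewrite mxE.
have := foldr_min_mem (hi (cell T0) 0 i) [seq hi (cell T') 0 i | T' <- s].
by rewrite -[_ :: _](map_cons (fun T => hi (cell T) 0 i)) => /mapP[T ? ->]; exists T.
Qed.

(** Helly's theorem for boxes: the largest lower end and the smallest upper end belong to two cells
    of the list, and these two meet. *)
Lemma cap_le s i : s != [::] -> clique cell s -> lo (cap cell s) 0 i <= hi (cap cell s) 0 i.
Proof.
move=> s0 cs; have [T Ts ->] := cap_lo_ex i s0; have [T' T's ->] := cap_hi_ex i s0.
by have [] := cs T T' Ts T's i.
Qed.

End Cap.

Lemma finite_pos_lb (R : realType) (J : finType) (g : J -> R) :
  (forall j, 0 < g j) -> exists2 d, 0 < d & forall j, d <= g j.
Proof.
move=> g0; exists (foldr Num.min 1 [seq g j | j : J]).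
  by have := foldr_min_mem 1 [seq g j | j : J]; rewrite inE => /orP[/eqP->//|/mapP[j _ ->]].
by move=> j; apply: foldr_min_le; rewrite inE map_f ?orbT ?mem_enum.
Qed.

(** There are finitely many cells, so intervals that miss each other do so by more than 2 d. At
    scale d, closeness of points therefore forces their cells to meet. *)
Lemma mesh_gap (R : realType) (I : finType) (cell : I -> box R) :
  exists2 d : R, 0 < d & forall T T' i,
    lo (cell T) 0 i <= hi (cell T') 0 i + 2 * d -> lo (cell T) 0 i <= hi (cell T') 0 i.
Proof.
pose g (j : (I * I) * axis) := let: (T, T', i) := j in
  if lo (cell T) 0 i <= hi (cell T') 0 i then 1
  else (lo (cell T) 0 i - hi (cell T') 0 i) / 3.
have [[[T T'] i]|d d0 dg] := @finite_pos_lb R _ g.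
  by rewrite /g; case: (leP (lo _ _ _)) => // ?; lra.
exists d => // T T' i; have := dg (T, T', i); rewrite /g; case: (leP (lo _ _ _)) => // ?; lra.
Qed.

Definition near_pt (R : realType) (d : R) (x y : 'rV[R]_3) : Prop :=
  forall i : axis, `|x 0 i - y 0 i| <= d.

Definition near_cell (R : realType) (d : R) (T : box R) (x : 'rV[R]_3) : Prop :=
  forall i : axis, lo T 0 i - d <= x 0 i <= hi T 0 i + d.

Lemma dist_max (R : realType) (a b a' b' e : R) :
  `|a - a'| <= e -> `|b - b'| <= e -> `|Num.max a b - Num.max a' b'| <= e.
Proof.
rewrite !ler_norml => /andP[? ?] /andP[? ?].
by case: (leP a b) => ?; case: (leP a' b') => ?; apply/andP; split; lra.
Qed.

Lemma dist_min (R : realType) (a b a' b' e : R) :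
  `|a - a'| <= e -> `|b - b'| <= e -> `|Num.min a b - Num.min a' b'| <= e.
Proof.
rewrite !ler_norml => /andP[? ?] /andP[? ?].
by case: (leP a b) => ?; case: (leP a' b') => ?; apply/andP; split; lra.
Qed.

Lemma clamp_mem (R : realType) (a b x l u : R) :
  a <= u -> l <= b -> l <= x <= u -> l <= Num.max a (Num.min b x) <= u.
Proof.
by move=> au lb /andP[lx xu]; rewrite le_max ge_max ge_min le_min au lb lx xu !orbT.
Qed.

Lemma clamp_bound (R : realType) (a b x l u : R) :
  l <= a -> a <= u -> b <= u -> l <= Num.max a (Num.min b x) <= u.
Proof. by move=> la au bu; rewrite le_max ge_max ge_min la au bu. Qed.

(* Alexander-Spanier cohomology at a small scale: c assigns to every point a cell
   containing it, so that a cochain on cliques of cells restricts to small lists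
   of points.  Small lists near the box cap cell s are contracted by clamping to
   boxes that shrink from a neighbourhood of that box to one of its corners, and
   small lists in X by G. *)
Lemma nerve_exact_of_homotopy (R : realType) (I : finType) (cell : I -> box R)
    (X : set 'rV[R]_3) :
  (forall T i, lo (cell T) 0 i <= hi (cell T) 0 i) ->
  (forall x, X x <-> exists T, box_set (cell T) x) ->
  (forall e, 0 < e -> exists h N (G : nat -> 'rV[R]_3 -> 'rV[R]_3) a,
    X a /\ [/\ 0 < h, forall m x, X x -> X (G m x),
        forall x, X x -> near_pt e x (G 0 x), forall x, G N x = a
      & forall m x y, X x -> X y -> near_pt h x y ->
          near_pt e (G m x) (G m y) /\ near_pt e (G m x) (G m.+1 y)]) ->
  forall n (f : seq I -> R),
    (forall s, size s = n.+1 -> clique cell s -> del f s = 0) ->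
    exists g, forall s, size s = n -> clique cell s -> f s = del g s.
Proof.
move=> cell_le XE htpy n f cl.
have [d d0 gap] := mesh_gap cell.
have [h0 [N [G [a [Xa [h00 XG G0 GN Gnear]]]]]] := htpy d d0.
pose h := Num.min h0 d.
have h_gt0 : 0 < h by rewrite lt_min h00.
have [hh0 hd] : h <= h0 /\ h <= d by rewrite /h !ge_min !lexx orbT.
have [Ta _] : exists T, box_set (cell T) a by apply/XE.
have /choice[c cP] (x : 'rV[R]_3) : exists T, X x -> box_set (cell T) x.
  have [/XE[T ?]|?] := pselect (X x); first by exists T.
  by exists Ta.
have cP' x : X x -> forall i, lo (cell (c x)) 0 i <= x 0 i <= hi (cell (c x)) 0 i.
  by move=> /cP.
have meet_pt x y e : X x -> X y -> e <= 2 * d -> near_pt e x y ->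
    meets (cell (c x)) (cell (c y)).
  move=> Xx Xy ed xy i; have := xy i; rewrite ler_norml => /andP[? ?].
  have /andP[? ?] := cP' x Xx i; have /andP[? ?] := cP' y Xy i.
  by split; apply: gap; lra.
pose reg (s : seq I) (t : seq 'rV[R]_3) := [/\ clique cell s,
  forall x, x \in t -> X x /\ forall T, T \in s -> near_cell d (cell T) x
  & forall x y, x \in t -> y \in t -> near_pt h x y].
have h_refl x e : 0 <= e -> near_pt e x x by move=> e0 i; rewrite subrr normr0.
have near_sym x y e : near_pt e x y -> near_pt e y x by move=> + i => /(_ i); rewrite distrC.
apply: (nerve_descent (reg := reg) (c := c) (clq := clique cell)) => //.
- move=> s s' t t' ss tt [cs Xt tn]; split; first exact: clique_sub cs.
    by move=> x /tt/Xt[? Xs]; split=> // T /ss/Xs.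
  by move=> x y /tt xt /tt yt; apply: tn.
- move=> s t [cs Xt tn] T T'; rewrite !mem_cat.
  have swap U U' : meets U U' -> meets U' U by move=> + i => /(_ i)[].
  have aux : forall T x, T \in s -> x \in t -> meets (cell T) (cell (c x)).
    move=> {}T x Ts /Xt[Xx /(_ T Ts) nx] i; have /andP[? ?] := nx i.
    by have /andP[? ?] := cP' x Xx i; split; apply: gap; lra.
  move=> /orP[Ts|/mapP[x xt ->]] /orP[T's|/mapP[y yt ->]].
  + exact: cs.
  + exact: aux.
  + by apply: swap; apply: aux.
  + by apply: (meet_pt _ _ h); [case: (Xt x)|case: (Xt y)|lra|apply: tn].
(* The identity is put in front of [G], since [G 0] is only near it. Passing from one to the other
   costs at most d + h, within the 2 d that [gap] tolerates. *)
- pose G' m := if m is m'.+1 then G m' else id.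
  pose smB u := (forall x, x \in u -> X x) /\ clique cell (map c u).
  have [|||||psi Hpsi] := @prism_chain _ _ R (reg [::]) smB G' N.+1 a n (fun u => f (map c u)).
  + move=> s t ts [Xs cs]; split=> [x /ts/Xs//|]; apply: clique_sub cs => T /mapP[x /ts xs ->].
    exact: map_f.
  + move=> m s [_ Xs sn].
    have XG' k x : x \in s -> X (G' k x) by move=> /Xs[? _]; case: k => [|k] //=; apply: XG.
    have base x y : x \in s -> y \in s ->
      near_pt (2 * d) (G' m x) (G' m y) /\ near_pt (2 * d) (G' m x) (G' m.+1 y)
      /\ near_pt (2 * d) (G' m.+1 x) (G' m.+1 y).
      move=> xs ys; have [Xx _] := Xs x xs; have [Xy _] := Xs y ys.
      have nxy := sn x y xs ys.
      have nxy0 : near_pt h0 x y by move=> i; apply: le_trans (nxy i) _.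
      have up u v : near_pt d u v -> near_pt (2 * d) u v.
        by move=> + i => /(_ i) /le_trans -> //; lra.
      split; [|split].
      * case: m XG' => [|m] _ /=; last by apply: up; have [] := Gnear m x y Xx Xy nxy0.
        by apply: up => i; apply: le_trans (nxy i) _.
      * case: m XG' => [|m] _ /=; last by apply: up; have [] := Gnear m x y Xx Xy nxy0.
        move=> i; have := nxy i; have := G0 y Xy i; rewrite !ler_norml => /andP[? ?] /andP[? ?].
        by apply/andP; split; lra.
      * by apply: up; have [] := Gnear m x y Xx Xy nxy0.
    split=> [x|T T']; first by rewrite mem_cat => /orP[] /mapP[y ys ->]; apply: XG'.
    rewrite map_cat -!map_comp !mem_cat => /orP[] /mapP[x xs ->] /orP[] /mapP[y ys ->];
      apply: (meet_pt _ _ (2 * d)) => //; try exact: XG'.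
    * exact: (base x y xs ys).1.
    * exact: (base x y xs ys).2.1.
    * by apply: near_sym; exact: (base y x ys xs).2.1.
    * exact: (base x y xs ys).2.2.
  + exact: GN.
  + split=> [x|T T']; first by rewrite inE => /eqP->.
    by rewrite !inE => /eqP-> /eqP->; apply: (meet_pt _ _ 0) => //; [lra|apply: h_refl].
  + by move=> t st [_ ct]; rewrite -del_map cl ?size_map.
  by exists psi => t st rt; rewrite -Hpsi//= map_id.
move=> s q phi s0 cs cphi.
pose L i := lo (cap cell s) 0 i; pose U i := hi (cap cell s) 0 i.
have LU i : L i <= U i by apply: cap_le.
(* While the radius [d - m%:R * h] is nonnegative, both ends move towards the box, and clamping
   keeps a point in its own cell. Afterwards the lower end rests at [L], the upper end goes on down
   to it, and the clamped points lie in every cell of [s]. Each end moves by at most h per step. *)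
pose al m i := L i - Num.max 0 (d - m%:R * h).
pose be m i := Num.max (L i) (U i + (d - m%:R * h)).
pose K m (x : 'rV[R]_3) : 'rV[R]_3 := \row_i Num.max (al m i) (Num.min (be m i) (x 0 i)).
have near_cap x : (forall T, T \in s -> near_cell d (cell T) x) ->
    forall i, L i - d <= x 0 i <= U i + d.
  move=> H i; have [T Ts] := cap_lo_ex cell i s0; have [T' T's] := cap_hi_ex cell i s0.
  rewrite /L /U => -> ->; have /andP[? _] := H T' T's i; have /andP[_ ?] := H T Ts i.
  by apply/andP; split => //; have /andP[? _] := H T Ts i; have /andP[_ ?] := H T' T's i.
have meet_cap x : X x -> (forall T, T \in s -> near_cell d (cell T) x) ->
    forall i, L i <= hi (cell (c x)) 0 i /\ lo (cell (c x)) 0 i <= U i.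
  move=> Xx H i; have [T Ts] := cap_lo_ex cell i s0; have [T' T's] := cap_hi_ex cell i s0.
  have /andP[? ?] := cP' x Xx i; rewrite /L /U => -> ->.
  have /andP[? _] := H T Ts i; have /andP[_ ?] := H T' T's i.
  by split; apply: gap; lra.
have KX m x : X x -> (forall T, T \in s -> near_cell d (cell T) x) -> X (K m x).
  move=> Xx H; have [r0|r0] := leP 0 (d - m%:R * h).
    apply/XE; exists (c x) => i; rewrite mxE /al /be; have ? := LU i; have [? ?] := meet_cap x Xx H i.
    apply: clamp_mem; last exact: cP'.
      by apply: le_trans (meet_cap x Xx H i).1; rewrite gerBl le_max lexx.
    by rewrite le_max; apply/orP; right; apply: le_trans (meet_cap x Xx H i).2 _; rewrite lerDl.
  have [T Ts _] := cap_lo_ex cell 0 s0.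
  apply/XE; exists T => i; rewrite mxE /al /be (@max_l _ _ 0) ?subr0; last exact: ltW.
  have LT := cap_lo cell i Ts; have UT := cap_hi cell i Ts.
  apply: clamp_bound => //; first exact: le_trans (LU i) _.
  apply: le_trans UT; rewrite ge_max LU /=; rewrite gerDl; exact: ltW.
have Knear m x : (forall T, T \in s -> near_cell d (cell T) x) ->
    forall T, T \in s -> near_cell d (cell T) (K m x).
  move=> H T Ts i; rewrite mxE /al /be.
  have LT := cap_lo cell i Ts; have UT := cap_hi cell i Ts.
  have rd : d - m%:R * h <= d by rewrite gerBl mulr_ge0// ltW.
  have UTd : U i <= hi (cell T) 0 i + d by rewrite (le_trans UT)// lerDl ltW.
  apply: clamp_bound; first by rewrite lerB// ge_max rd ltW.
    by rewrite (le_trans _ UTd)// (le_trans _ (LU i))// gerBl le_max lexx.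
  by rewrite ge_max (le_trans (LU i) UTd)/= lerD.
have step m : `|(d - m%:R * h) - (d - m.+1%:R * h)| <= h.
  have -> : (d - m%:R * h) - (d - m.+1%:R * h) = h by rewrite -natr1; ring.
  by rewrite ger0_norm// ltW.
have al_lip m i : `|al m i - al m.+1 i| <= h.
  have -> : al m i - al m.+1 i = Num.max 0 (d - m.+1%:R * h) - Num.max 0 (d - m%:R * h).
    by rewrite /al; ring.
  rewrite distrC; apply: dist_max => //.
  by rewrite subrr normr0 ltW.
have be_lip m i : `|be m i - be m.+1 i| <= h.
  apply: dist_max; first by rewrite subrr normr0 ltW.
  by rewrite opprD addrACA subrr add0r.
have [M HM] : exists M : nat, forall i, d + (U i - L i) <= M%:R * h.
  pose B := d + \sum_i (U i - L i).
  exists (Num.bound `|B / h|) => i.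
  apply: (@le_trans _ _ B).
    rewrite lerD2l (bigD1 i)//= lerDl sumr_ge0// => j _; by rewrite subr_ge0.
  rewrite -ler_pdivrMr// ltW//; apply: le_lt_trans (ler_norm _) _.
  by apply: archi_boundP; exact: normr_ge0.
have a_cap : reg s [:: \row_i L i].
  split=> // [x|x y]; last by rewrite !inE => /eqP-> /eqP->; apply: h_refl; exact: ltW.
  rewrite inE => /eqP->; split.
    have [T Ts _] := cap_lo_ex cell 0 s0; apply/XE; exists T => i; rewrite mxE.
    by rewrite (cap_lo _ _ Ts) (le_trans (LU i))// (cap_hi _ _ Ts).
  move=> T Ts i; rewrite mxE.
  have := LU i; have := cap_lo cell i Ts; have := cap_hi cell i Ts; rewrite -/(L i) -/(U i) => ? ? ?.
  by apply/andP; split; lra.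
have [|||psi Hpsi] := @prism_chain _ _ R (reg s) (reg s) K M (\row_i L i) q phi _ _ _ a_cap cphi.
- move=> t t' tt [_ Xt tn]; split=> //; first by move=> x /tt /Xt.
  by move=> x y /tt xt /tt yt; apply: tn.
- move=> m t [_ Xt tn]; split=> //.
    by move=> x; rewrite mem_cat => /orP[] /mapP[y yt ->]; have [Xy ny] := Xt y yt;
      (split; [apply: KX|apply: Knear]).
  have lip0 k x y : near_pt h x y -> near_pt h (K k x) (K k y).
    by move=> n0 i; rewrite !mxE; apply: dist_max; [rewrite subrr normr0 ltW|apply: dist_min; [rewrite subrr normr0 ltW|exact: n0]].
  have lip1 k x y : near_pt h x y -> near_pt h (K k x) (K k.+1 y).
    by move=> n0 i; rewrite !mxE; apply: dist_max => //; apply: dist_min => //; exact: n0.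
  move=> x y; rewrite !mem_cat => /orP[] /mapP[u ut ->] /orP[] /mapP[v vt ->].
  + by apply: lip0; apply: tn.
  + by apply: lip1; apply: tn.
  + by apply: near_sym; apply: lip1; apply: tn.
  + by apply: lip0; apply: tn.
- move=> x; apply/rowP => i; rewrite !mxE /al /be (@max_l _ _ 0); last by have := HM i; have := LU i; lra.
  have ? : U i + (d - M%:R * h) <= L i by have := HM i; lra.
  rewrite subr0 (@max_l _ _ (L i))//.
  by rewrite max_l// ge_min lexx.
exists psi => t st rt; rewrite -Hpsi//; congr phi; rewrite map_id_in// => x xt.
apply/rowP => i; rewrite mxE /al /be mul0r subr0 (@max_r _ _ 0) ?ltW//.
have [_ Xt _] := rt; have [_ nx] := Xt x xt; have /andP[? ?] := near_cap x nx i.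
have := LU i => ?; rewrite (@max_r _ _ (L i)); last lra.
by rewrite min_r// max_r.
Qed.

(** * Contraction of the closure of the domain in small steps *)

Lemma compact_uniform_continuity (R : realType) (X Y : pseudoMetricType R)
    (K : set X) (f : X -> Y) (e : R) :
  compact K -> {within K, continuous f} -> 0 < e ->
  exists2 d, 0 < d & forall x y, K x -> K y -> ball x d y -> ball (f x) e (f y).
Proof.
move=> /compact_near_coveringP cK /subspace_continuousP cf e0.
have [|d /= d0 dP] := cK _ (0 : R)^'+ (fun d x => K x -> forall y, K y -> ball x d y ->
    ball (f x) e (f y)) _.
  move=> x Kx; have e20 : 0 < e / 2 by rewrite divr_gt0.
  have /nbhs_ballP[r /= r0 rP] : within K (nbhs x) (f @^-1` ball (f x) (e / 2)).
    by apply: (cf x Kx); exact: nbhsx_ballx.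
  exists (ball x (r / 2), [set d | d < r / 2]) => /=.
    split; first by apply: nbhsx_ballx; rewrite divr_gt0.
    exists (r / 2); first by rewrite /= divr_gt0.
    by move=> d /=; rewrite sub0r normrN => dr d0; rewrite -(gtr0_norm d0).
  move=> [x' d] /= [xx' dr] Kx' y Ky x'y.
  apply: (@ball_splitr _ _ (f x)).
    by apply: rP => //; apply: le_ball xx'; lra.
  apply: rP => //; apply: (@ball_split _ _ x') => //; apply: le_ball x'y; exact: ltW.
exists (d / 2); first by rewrite /= divr_gt0.
move=> x y Kx Ky xy; apply: (dP (d / 2)) => //=; last by rewrite divr_gt0.
by rewrite sub0r normrN gtr0_norm; lra.
Qed.

Lemma rV_norm_le (R : realType) (x : 'rV[R]_3) (e : R) :
  0 <= e -> reflect (forall i, `|x 0 i| <= e) (`|x| <= e).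
Proof.
move=> e0; rewrite /Num.norm/= mx_normrE; apply: (iffP (bigmax_leP _ _ _ _)) => [[_ H] i|H].
  exact: (H (0, i)).
by split=> // -[i k] _ /=; rewrite (ord1 i); exact: H.
Qed.

(** Points of the closure satisfy the weak epigraph inequality by continuity of [gam]; moving up
    along the third local axis, whose direction is [v], makes it strict. *)
Lemma boundary_push (R : realType) (Omega : set 'rV[R]_3) (x : 'rV[R]_3) :
  has_lipschitz_boundary Omega -> (closure Omega `\` Omega°) x ->
  exists r (v : 'rV[R]_3), [/\ 0 < r, forall i, `|v 0 i| <= 1 &
    forall p s, closure Omega p -> ball x r p -> 0 < s <= r -> Omega (p + s *: v)].
Proof.
move=> lip /lip[M [gam [L [MM gL /nbhs_ballP[r0 /= r00 rP]]]]].
have MM' : M^T *m M = 1%:M by apply: mulmx1C.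
pose v : 'rV[R]_3 := \row_i M i (2%:R : axis).
have vM : v *m M = delta_mx 0 (2%:R : axis).
  have -> : v = delta_mx 0 (2%:R : axis) *m M^T by rewrite -rowE; apply/rowP => i; rewrite !mxE.
  by rewrite -mulmxA MM' mulmx1.
have v1 i : `|v 0 i| <= 1.
  have := congr1 (fun A : 'M[R]_3 => A i i) MM; rewrite !mxE eqxx (bigD1 (2%:R : axis))//= !mxE.
  rewrite mulr1n => E; rewrite -(@ler_pXn2r _ 2)// ?nnegrE// expr1n real_normK ?num_real// -E expr2 lerDl.
  by apply: sumr_ge0 => j _; rewrite !mxE -expr2 sqr_ge0.
pose y j (p : 'rV[R]_3) := (p *m M) 0 j.
have cy j : continuous (y j).
  have -> : y j = (fun p : 'rV[R]_3 => \sum_k p 0 k * M k j) by apply/funext => p; rewrite /y mxE.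
  apply: continuous_big => [|k _ p]; first exact: add_continuous.
  by apply: continuousM; [exact: coord_continuous|exact: cst_continuous].
have glip : forall a b, `|gam a - gam b| <= `|L| * `|a - b|.
  move=> a b; have /= := gL (a, b) (conj I I); move/le_trans; apply.
  by rewrite ler_wpM2r// ler_norm.
have cg : continuous (fun p : 'rV[R]_3 => gam (y 0 p, y 1 p)).
  move=> p; apply/(@cvgrPdist_le _ _ _ (nbhs p)) => e e0; near=> q.
  apply: le_trans (glip _ _) _; have Lp : 0 < `|L| + 1 by rewrite ltr_wpDl.
  apply: (@le_trans _ _ ((`|L| + 1) * `|(y 0 p, y 1 p) - (y 0 q, y 1 q)|)).
    by rewrite ler_wpM2r// lerDl.
  rewrite mulrC -ler_pdivlMr// prod_normE ge_max; apply/andP; split; near: q.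
    by apply: cvgr_dist_le; [exact: cy|rewrite divr_gt0].
  by apply: cvgr_dist_le; [exact: cy|rewrite divr_gt0].
have cl p : closure Omega p -> ball x r0 p -> gam (y 0 p, y 1 p) <= y (2%:R : axis) p.
  move=> clp xp; rewrite leNgt; apply/negP => lt.
  have [q [Oq [bq ltq]]] : Omega `&` (ball x r0 `&`
      [set q | y (2%:R : axis) q < gam (y 0 q, y 1 q)]) !=set0.
    apply: clp; apply: filterI.
      by apply: open_nbhs_nbhs; split=> //; exact: ball_open.
    have /(_ p) : continuous (fun q : 'rV[R]_3 => gam (y 0 q, y 1 q) - y (2%:R : axis) q).
      by move=> q; apply: (@cvgB _ _ _ (nbhs q)); [exact: (cg q)|exact: (cy _ q)].
    move/cvgr_gt => /(_ 0); rewrite subr_gt0 => /(_ lt); apply: filterS => q.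
    by rewrite subr_gt0.
  by have /= /(lt_trans ltq) := (rP q bq).1 Oq; rewrite ltxx.
(* A third for the distance to [x] and a third for the displacement keep the pushed point in the
   ball where the epigraph description holds. *)
exists (r0 / 3), v; split=> //; first by rewrite divr_gt0.
move=> p s clp xp /andP[s0 sr].
have xp0 : ball x r0 p by apply: le_ball xp; lra.
have near_p : ball x r0 (p + s *: v).
  have -> : r0 = r0 / 3 + (r0 - r0 / 3) by lra.
  apply: (@ball_triangle _ _ p) => //.
  rewrite mx_norm_ball /ball_ /= opprD addrA subrr sub0r normrN.
  apply: (@le_lt_trans _ _ s); last lra.
  apply/rV_norm_le; first exact: ltW.
  move=> i; have -> : (s *: v) 0 i = s * v 0 i by rewrite mxE.
  by rewrite normrM (gtr0_norm s0) ler_piMr// ltW.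
apply/(rP _ near_p).
have yE j : ((p + s *: v) *m M) 0 j = y j p + s * (j == (2%:R : axis))%:R.
  rewrite mulmxDl -scalemxAl vM.
  have -> : (p *m M + s *: delta_mx 0 (2%:R : axis)) 0 j =
      (p *m M) 0 j + s * (delta_mx 0 (2%:R : axis) : 'rV[R]_3) 0 j.
    by move: (p *m M) => A; rewrite !mxE.
  by congr (_ + s * _); rewrite mxE eqxx.
rewrite !yE !mulr0 !addr0 mulr1; apply: le_lt_trans (cl _ clp xp0) _.
by rewrite ltrDl.
Unshelve. all: by end_near. Qed.

(* Successive pushes along the local epigraph directions move the closure into
   Omega: a boundary point stays put until the first push whose ball contains
   it, and the pushes preserve Omega. *)
Lemma push_into (R : realType) (Omega : set 'rV[R]_3) (e : R) :
  open Omega -> has_lipschitz_boundary Omega -> compact (closure Omega) -> 0 < e ->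
  exists j : 'rV[R]_3 -> 'rV[R]_3, [/\ continuous j,
    forall p, closure Omega p -> Omega (j p) & forall p, near_pt e p (j p)].
Proof.
move=> oO lip cO e0.
pose good (c : 'rV[R]_3 * R * 'rV[R]_3) := [/\ 0 < c.1.2, forall i, `|c.2 0 i| <= 1 &
    forall p s, closure Omega p -> ball c.1.1 c.1.2 p -> 0 < s <= c.1.2 -> Omega (p + s *: c.2)].
have subc : Omega `<=` closure Omega by apply: subset_closure.
have pushes (l : seq ('rV[R]_3 * R * 'rV[R]_3)) : (forall c, c \in l -> good c) ->
    forall e, 0 < e -> exists j : 'rV[R]_3 -> 'rV[R]_3, [/\ continuous j,
      forall p, closure Omega p ->
        Omega (j p) \/ j p = p /\ forall c, c \in l -> ~ ball c.1.1 c.1.2 p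
      & forall p, near_pt e p (j p)].
  elim: l => [|c l IHl] lgood {}e {}e0.
    exists id; split=> [p|p _|p i]; [exact: cvg_id|by right|].
    by rewrite subrr normr0 ltW.
  have lg d : d \in l -> good d by move=> dl; apply: lgood; rewrite inE dl orbT.
  have e20 : 0 < e / 2 by rewrite divr_gt0.
  have [j [cj jO je]] := IHl lg (e / 2) e20.
  have [r0 v1 push] : good c by apply: lgood; rewrite mem_head.
  (* A continuous push length that is positive exactly on the ball, at most the radius that [good]
     permits, and at most the half of [e] not spent by [j]. *)
  pose t (p : 'rV[R]_3) := Num.min (e / 2) (Num.max 0 (c.1.2 - `|c.1.1 - p|)).
  have t0 p : 0 <= t p by rewrite le_min (ltW e20) le_max lexx.
  pose k (p : 'rV[R]_3) := p + t p *: c.2.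
  have t_ball p : ball c.1.1 c.1.2 p -> 0 < t p <= c.1.2.
    rewrite mx_norm_ball /ball_ /= => cp; rewrite lt_min e20 lt_max subr_gt0 cp orbT /=.
    by rewrite ge_min ge_max (ltW r0)/= gerBl normr_ge0 orbT.
  have t_out p : ~ ball c.1.1 c.1.2 p -> t p = 0.
    rewrite mx_norm_ball /ball_ /= => /negP; rewrite -leNgt => cp.
    by rewrite /t max_l ?subr_le0// min_r// ltW.
  have kO p : Omega p -> Omega (k p).
    move=> Op; have [b|b] := pselect (ball c.1.1 c.1.2 p).
      by apply: push => //; [exact: subc|exact: t_ball].
    by rewrite /k t_out// scale0r addr0.
  exists (k \o j); split.
  - move=> p; apply: continuous_comp; first exact: cj.
    have ct : continuous t.
      pose n (q : 'rV[R]_3) : R^o := `|c.1.1 - q|.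
      have cn : continuous n.
        move=> q; apply: (@cvg_norm _ _ _ (nbhs q)).
        by apply: (@cvgB _ _ _ (nbhs q)); [exact: cvg_cst|exact: cvg_id].
      pose m (q : 'rV[R]_3) : R^o := c.1.2 - n q.
      have cm : continuous m.
        by move=> q; apply: (@continuousB _ _ _ (fun=> c.1.2) n); [exact: cst_continuous|exact: cn].
      move=> q; apply: (@continuous_min _ _ (fun=> e / 2) ((fun=> 0) \max m)).
        exact: cst_continuous.
      by apply: continuous_max; [exact: cst_continuous|exact: cm].
    apply: continuousD; first exact: cvg_id.
    by apply: continuousZr_tmp; exact: ct.
  - move=> p clp /=; have [Oj|[jp npl]] := jO p clp; first by left; apply: kO.
    rewrite jp; have [b|b] := pselect (ball c.1.1 c.1.2 p).
      by left; apply: push => //; exact: t_ball.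
    right; split; first by rewrite /k t_out// scale0r addr0.
    by move=> d; rewrite inE => /orP[/eqP->//|]; apply: npl.
  - move=> p i /=; have := je p i; rewrite /k !mxE !ler_norml => /andP[? ?].
    have tv : `|t (j p) * c.2 0 i| <= e / 2.
      rewrite normrM ger0_norm//; apply: le_trans (ler_wpM2l _ (v1 i)) _ => //.
      by rewrite mulr1 ge_min lexx.
    by move: tv; rewrite ler_norml => /andP[? ?]; apply/andP; split; lra.
have [l lgood lcov] : exists2 l : seq ('rV[R]_3 * R * 'rV[R]_3), forall c, c \in l -> good c &
    forall p, closure Omega p -> ~ Omega p -> exists2 c, c \in l & ball c.1.1 c.1.2 p.
  pose B := closure Omega `\` Omega.
  have cB : compact B.
    apply: (subclosed_compact _ cO); last by move=> p [].
    by apply: closedI; [exact: closed_closure|exact: open_closedC].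
  have [D Dgood Dcov] : finite_subset_cover good
      (fun c => [set p | ball c.1.1 c.1.2 p]) B.
    move: cB; rewrite compact_cover; apply; first by move=> c [? _ _]; exact: ball_open.
    move=> p [clp nOp]; have [|r [v [r0 v1 pv]]] := @boundary_push R Omega p lip.
      by split=> //; move/interior_id: oO => ->.
    by exists (p, r, v) => //=; exact: ballxx.
  exists (finmap.enum_fset D); first by move=> c cD; have := Dgood c cD; rewrite inE.
  by move=> p clp nOp; have [|c /= cD cp] := Dcov p; [split|exists c].
have [j [cj jO je]] := pushes l lgood e e0.
exists j; split=> // p clp; have [//|[jp nl]] := jO p clp.
rewrite jp; apply: contrapT => nOp; have [c cl cp] := lcov p clp nOp.
exact: nl cp.
Qed.

(** [H] is continuous only over [Omega], which is not compact. Precomposing with the push [j] gives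
    a map on the compact product of [[0, 1]] and the closure; its uniform continuity bounds both the
    effect of a time step and that of moving the point. *)
Lemma contraction_chain (R : realType) (Omega : set 'rV[R]_3) :
  open Omega -> has_lipschitz_boundary Omega -> compact (closure Omega) ->
  contractible R Omega ->
  forall e, 0 < e -> exists h N (G : nat -> 'rV[R]_3 -> 'rV[R]_3) a,
    closure Omega a /\ [/\ 0 < h, forall m x, closure Omega x -> closure Omega (G m x),
        forall x, closure Omega x -> near_pt e x (G 0 x), forall x, G N x = a
      & forall m x y, closure Omega x -> closure Omega y -> near_pt h x y ->
          near_pt e (G m x) (G m y) /\ near_pt e (G m x) (G m.+1 y)].
Proof.
move=> oO lip cO [x0 [H [Ox0 cH HO H0 H1]]] e e0.
have [j [cj jO je]] := push_into oO lip cO e0.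
have subc : Omega `<=` closure Omega by apply: subset_closure.
pose K : set (R * 'rV[R]_3) := `[0, 1] `*` closure Omega.
have cK : compact K by apply: compact_setX => //; exact: segment_compact.
pose f (z : R * 'rV[R]_3) := H (z.1, j z.2).
have cf : {within K, continuous f}.
  apply/subspace_continuousP => -[t x] [/= t01 clx].
  move/subspace_continuousP : cH => /(_ (t, j x) (conj t01 (jO x clx))) cH.
  apply: cvg_trans cH => W /= [[U V] /= [Ut Vx] UVW].
  exists (U, j @^-1` V) => /=; first by split=> //; exact: cj.
  move=> [t' x'] /= [Ut' Vx'] [/= t'01 clx']; apply: (UVW (t', j x')) => //=.
  by split=> //; exact: jO.
have [d d0 dP] := compact_uniform_continuity cK cf e0.
pose N := (Num.bound d^-1).+1.
have N0 : (0 : R) < N%:R by rewrite ltr0n.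
have Nd : N%:R^-1 < d :> R.
  rewrite -(invrK d) ltf_pV2 ?posrE ?invr_gt0//.
  apply: lt_trans (archi_boundP _) _; first by rewrite invr_ge0 ltW.
  by rewrite ltr_nat.
pose t m : R := Num.min (m%:R / N%:R) 1.
have t01 m : `[0, 1]%classic (t m).
  by rewrite /= in_itv /= le_min ge_min divr_ge0 ?lexx ?orbT// ?ler0n ltW.
have tN m : (N <= m)%N -> t m = 1.
  by move=> Nm; apply: min_r; rewrite ler_pdivlMr// mul1r ler_nat.
have tS m : `|t m - t m.+1| < d.
  apply: le_lt_trans Nd; apply: dist_min; last by rewrite subrr normr0 invr_ge0 ltW.
  rewrite -mulrBl -natr1 opprD addrA subrr sub0r mulN1r normrN ger0_norm// invr_ge0 ltW//.
(* The last stages are set to [x0] outright because they must be constant on all points, including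
   those outside the closure, where [H] is arbitrary. *)
pose G m x := if (m < N)%N then f (t m, x) else x0.
have GE m x : closure Omega x -> G m x = f (t m, x).
  move=> clx; rewrite /G; case: ltnP => // Nm; rewrite tN// /f /= H1//; exact: jO.
exists (d / 2), N, G, x0; split; first exact: subc.
split=> //.
- by rewrite divr_gt0.
- by move=> m x clx; rewrite GE//; apply/subc/HO; [exact: t01|exact: jO].
- by move=> x clx; rewrite GE// /f /= /t mul0r min_l// H0; [exact: je|exact: jO].
- by move=> x; rewrite /G ltnn.
move=> m x y clx cly xy.
have bxy : ball x d y.
  rewrite mx_norm_ball /ball_ /=; apply: (@le_lt_trans _ _ (d / 2)); last lra.
  by apply/rV_norm_le => [|i]; [rewrite divr_ge0// ltW|rewrite !mxE; exact: xy].
have up u v : ball (u : 'rV[R]_3) e v -> near_pt e u v.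
  rewrite mx_norm_ball /ball_ /= => /ltW /(rV_norm_le _ (ltW e0)) uv i.
  by have := uv i; rewrite !mxE.
have Kt k z : closure Omega z -> K (t k, z) by move=> ?; split=> //=; exact: t01.
rewrite !GE//; split; apply: up; apply: dP; try exact: Kt; split=> //=.
  exact: ballxx.
by rewrite -ball_normE /ball_ /=; exact: tS.
Qed.

(** The complex is augmented: [del g [:: T]] is [g [::]], so for [n = 1] this says that a function
    constant on meeting cells is globally constant. *)
Lemma mesh_nerve_exact (R : realType) (Omega : set 'rV[R]_3) (I : finType)
    (cell : I -> box R) :
  lipschitz_domain Omega -> contractible R Omega -> cuboid_mesh Omega cell ->
  forall n (f : seq I -> R),
    (forall s, size s = n.+1 -> clique cell s -> del f s = 0) ->
    exists g, forall s, size s = n -> clique cell s -> f s = del g s.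
Proof.
move=> [oO _ lip] ctr [cells clE _].
have cO : compact (closure Omega).
  rewrite clE (_ : \bigcup_(_ in _) _ = \big[setU/set0]_(T : I) box_set (cell T)).
    apply: bigsetU_compact => T _.
    have := @rV_compact _ _ (fun i => `[lo (cell T) 0 i, hi (cell T) 0 i]%classic).
    rewrite (_ : [set v | _] = box_set (cell T)); first by apply=> i; exact: segment_compact.
    by apply/seteqP; split=> x /= H i; have := H i; rewrite in_itv.
  rewrite -bigcup_seq; congr (\bigcup_(T in _) _); apply/seteqP; split=> // T _ /=.
  by rewrite mem_index_enum.
apply: (nerve_exact_of_homotopy (X := closure Omega)).
- move=> T i; have := cells T; rewrite /is_cell => /setP/(_ i); rewrite !inE => /ltW //.
- move=> x; rewrite clE; split; first by move=> [T _ ?]; exists T.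
  by move=> [T ?]; exists T.
exact: contraction_chain.
Qed.

(** * Operators acting in one variable *)

Definition mlin (R : realType) (V : lmodType R) (F : multinom 3 -> V) (p : poly3 R) : V :=
  \sum_(m <- msupp p) mcoeff m p *: F m.

Lemma mlin_wide (R : realType) (V : lmodType R) (F : multinom 3 -> V) (p : poly3 R)
    (r : seq (multinom 3)) :
  uniq r -> {subset msupp p <= r} -> mlin F p = \sum_(m <- r) mcoeff m p *: F m.
Proof.
move=> ur pr; rewrite [RHS](bigID (fun m => m \in msupp p))/= addrC big1 ?add0r; last first.
  by move=> m /=; rewrite -mcoeff_eq0 => /eqP->; rewrite scale0r.
rewrite -big_filter; apply: perm_big; apply: uniq_perm; rewrite ?msupp_uniq ?filter_uniq//.
move=> m /=; rewrite mem_filter; by case: (boolP (m \in msupp p)) => //= /pr ->.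
Qed.

Lemma mlin_is_linear (R : realType) (V : lmodType R) (F : multinom 3 -> V) :
  linear (mlin F).
Proof.
move=> a p q; pose r := undup (msupp (a *: p + q) ++ msupp p ++ msupp q).
have ur : uniq r := undup_uniq _.
have sub s : {subset s <= msupp (a *: p + q) ++ msupp p ++ msupp q} -> {subset s <= r}.
  by move=> h m /h; rewrite mem_undup.
rewrite !(mlin_wide F ur) ?scaler_sumr -?big_split/=.
- by apply: eq_bigr => m _; rewrite mcoeffD mcoeffZ scalerDl scalerA.
- by apply: sub => m ms; rewrite !mem_cat ms !orbT.
- by apply: sub => m ms; rewrite !mem_cat ms !orbT.
- by apply: sub => m ms; rewrite !mem_cat ms.
Qed.

HB.instance Definition _ (R : realType) (V : lmodType R) (F : multinom 3 -> V) :=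
  GRing.isLinear.Build R (poly3 R) V _ (mlin F) (mlin_is_linear F).

Lemma mlinX (R : realType) (V : lmodType R) (F : multinom 3 -> V) m :
  mlin F (mpolyX R m) = F m.
Proof. by rewrite /mlin msuppX big_seq1 mcoeffX eqxx scale1r. Qed.

Lemma eq_mlinear (R : realType) (V : lmodType R) (f g : {linear poly3 R -> V}) :
  (forall m, f (mpolyX R m) = g (mpolyX R m)) -> f =1 g.
Proof.
move=> fg p; rewrite [p]mpolyE !linear_sum; apply: eq_bigr => m _.
by rewrite !linearZ fg.
Qed.

Definition plin (R : realType) (V : lmodType R) (F : nat -> V) (p : {poly R}) : V :=
  \sum_(d < size p) p`_d *: F d.

Lemma plin_wide (R : realType) (V : lmodType R) (F : nat -> V) (p : {poly R}) n :
  (size p <= n)%N -> plin F p = \sum_(d < n) p`_d *: F d.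
Proof.
move=> pn; rewrite /plin (big_ord_widen _ (fun d => p`_d *: F d) pn) big_mkcond/=.
apply: eq_bigr => d _; case: ltnP => // dp.
by rewrite nth_default// scale0r.
Qed.

Lemma plin_is_linear (R : realType) (V : lmodType R) (F : nat -> V) : linear (plin F).
Proof.
move=> a p q; pose n := (maxn (size (a *: p + q)) (maxn (size p) (size q))).
rewrite !(@plin_wide _ _ F _ n) ?leq_max ?leqnn ?orbT//.
rewrite scaler_sumr -big_split/=; apply: eq_bigr => d _.
by rewrite coefD coefZ scalerDl scalerA.
Qed.

HB.instance Definition _ (R : realType) (V : lmodType R) (F : nat -> V) :=
  GRing.isLinear.Build R {poly R} V _ (plin F) (plin_is_linear F).

Lemma plinXn (R : realType) (V : lmodType R) (F : nat -> V) n : plin F 'X^n = F n.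
Proof.
rewrite /plin size_polyXn big_ord_recr/= coefXn eqxx scale1r big1 ?add0r// => i _.
by rewrite coefXn ltn_eqF ?ltn_ord// scale0r.
Qed.

Lemma eq_plinear (R : realType) (V : lmodType R) (f g : {linear {poly R} -> V}) :
  (forall n, f 'X^n = g 'X^n) -> f =1 g.
Proof.
move=> fg p; rewrite -[p]coefK poly_def !linear_sum; apply: eq_bigr => d _.
by rewrite !linearZ fg.
Qed.

Definition mset (m : multinom 3) (i : axis) (d : nat) : multinom 3 :=
  Multinom (mktuple (fun j => if j == i then d else m j)).

Lemma msetE m i d j : mset m i d j = if j == i then d else m j.
Proof. exact: mnmE. Qed.

Lemma mset_eq m i d : mset m i d i = d. Proof. by rewrite msetE eqxx. Qed.

Lemma mset_id m i : mset m i (m i) = m.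
Proof. by apply/mnmP => j; rewrite msetE; case: eqP => [->|]. Qed.

Lemma mset_mset m i d e : mset (mset m i d) i e = mset m i e.
Proof. by apply/mnmP => j; rewrite !msetE; case: eqP. Qed.

Lemma msetC m i j d e : i != j -> mset (mset m i d) j e = mset (mset m j e) i d.
Proof.
move=> ij; apply/mnmP => k; rewrite !msetE; case: eqP => // ->; case: eqP => // ji.
by rewrite ji eqxx in ij.
Qed.

Notation op R := {linear {poly R} -> {poly R}}.

(** The exponent of [m] at [i] is discarded; [m] only supplies the monomial in the other two
    variables. *)
Definition ins (R : realType) (i : axis) (m : multinom 3) (p : {poly R}) : poly3 R :=
  plin (fun d => mpolyX R (mset m i d)) p.

HB.instance Definition _ (R : realType) (i : axis) (m : multinom 3) :=
  GRing.isLinear.Build R {poly R} (poly3 R) _ (@ins R i m) (plin_is_linear _).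

(* A linear operator L on univariate polynomials, acting in the variable x_i. *)
Definition lift (R : realType) (i : axis) (L : {poly R} -> {poly R}) (p : poly3 R) : poly3 R :=
  mlin (fun m => ins i m (L 'X^(m i))) p.

HB.instance Definition _ (R : realType) (i : axis) (L : {poly R} -> {poly R}) :=
  GRing.isLinear.Build R (poly3 R) (poly3 R) _ (@lift R i L) (mlin_is_linear _).

Section Lift.
Variable R : realType.
Implicit Types (i j : axis) (m : multinom 3) (p : poly3 R) (q : {poly R}) (L : op R).

Lemma ins_Xn i m d : ins i m 'X^d = mpolyX R (mset m i d).
Proof. exact: plinXn. Qed.

Lemma lift_X i (L : {poly R} -> {poly R}) m : lift i L (mpolyX R m) = ins i m (L 'X^(m i)).
Proof. exact: mlinX. Qed.

Lemma ins_mset i m d q : ins i (mset m i d) q = ins i m q.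
Proof. by apply: eq_bigr => e _; rewrite mset_mset. Qed.

Lemma lift_ins i L m q : lift i L (ins i m q) = ins i m (L q).
Proof.
apply: (@eq_plinear R _ (lift i L \o ins i m) (ins i m \o L)) => n /=.
by rewrite ins_Xn lift_X mset_eq ins_mset.
Qed.

Lemma lift_comp i L L' p : lift i (L \o L') p = lift i L (lift i L' p).
Proof.
apply: (@eq_mlinear R _ (lift i (L \o L')) (lift i L \o lift i L')) => m /=.
by rewrite !lift_X lift_ins.
Qed.

Lemma eq_lift i (L L' : {poly R} -> {poly R}) p :
  (forall n, L 'X^n = L' 'X^n) -> lift i L p = lift i L' p.
Proof. by move=> LL; apply: (@eq_mlinear R _ (lift i L) (lift i L')) => m /=; rewrite !lift_X LL. Qed.

Lemma lift_id i p : lift i id p = p.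
Proof. by apply: (@eq_mlinear R _ (lift i id) idfun) => m /=; rewrite lift_X ins_Xn mset_id. Qed.

Lemma lift0 i p : lift i (fun=> 0) p = 0.
Proof. by apply: (@eq_mlinear R _ (lift i _) \0) => m /=; rewrite lift_X linear0. Qed.

Lemma liftB i (L L' : {poly R} -> {poly R}) p :
  lift i (fun q => L q - L' q) p = lift i L p - lift i L' p.
Proof.
apply: (@eq_mlinear R _ (lift i _) (lift i L \- lift i L')) => m /=.
by rewrite !lift_X linearB.
Qed.

Lemma liftC i j L L' p : i != j -> lift i L (lift j L' p) = lift j L' (lift i L p).
Proof.
move=> ij; apply: (@eq_mlinear R _ (lift i L \o lift j L') (lift j L' \o lift i L)) => m /=.
rewrite !lift_X /ins /plin !linear_sum /=.
under eq_bigr do rewrite linearZ/= lift_X /ins /plin msetE (negbTE ij) scaler_sumr.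
under [RHS]eq_bigr do rewrite linearZ/= lift_X /ins /plin msetE eq_sym (negbTE ij) scaler_sumr.
rewrite exchange_big/=; apply: eq_bigr => e _; apply: eq_bigr => d _.
by rewrite scalerA mulrC -scalerA msetC// eq_sym.
Qed.

Lemma lift_partial i p : partial i p = lift i (@deriv R) p.
Proof.
apply: (@eq_mlinear R _ (mderiv i) (lift i (@deriv R))) => m /=.
rewrite mderivX lift_X derivXn raddfMn/= ins_Xn scaler_nat; congr (mpolyX R _ *+ _).
apply/mnmP => j; rewrite msetE mnmBE mnm1E eq_sym; case: eqP => [->|]; rewrite ?subn1 ?subn0//.
Qed.

End Lift.

(** * Degree bounds and tensor products of one-variable operators *)

(** Degree at most K - s. Bounding the size by [K.+1 - s] makes the truncated subtraction harmless:
    if s > K, only 0 qualifies. In [degb] the sum on the left has the same effect. *)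
Definition pdeg (R : realType) (K s : nat) (q : {poly R}) : Prop := (size q <= K.+1 - s)%N.

Definition degb (R : realType) (K s : axis -> nat) (p : poly3 R) : Prop :=
  forall m, m \in msupp p -> forall i, (m i + s i <= K i)%N.

Section Degb.
Variable R : realType.
Implicit Types (i j : axis) (m : multinom 3) (p : poly3 R) (q : {poly R}) (L : op R).
Implicit Types (K s : axis -> nat).

Lemma degb0 K s : degb K s (0 : poly3 R).
Proof. by move=> m; rewrite msupp0. Qed.

Lemma degbZ K s a p : degb K s p -> degb K s (a *: p).
Proof. by move=> dp m /msuppZ_le/dp. Qed.

Lemma degbD K s p p' : degb K s p -> degb K s p' -> degb K s (p + p').
Proof. by move=> dp dp' m /msuppD_le; rewrite mem_cat => /orP[/dp|/dp']. Qed.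

Lemma degbN K s p : degb K s p -> degb K s (- p).
Proof. by move=> dp m; rewrite (perm_mem (msuppN p)) => /dp. Qed.

Lemma degbB K s p p' : degb K s p -> degb K s p' -> degb K s (p - p').
Proof. by move=> dp dp'; apply: degbD => //; exact: degbN. Qed.

Lemma degb_sum K s (J : Type) (r : seq J) (P : pred J) (F : J -> poly3 R) :
  (forall u, P u -> degb K s (F u)) -> degb K s (\sum_(u <- r | P u) F u).
Proof. by move=> dF; elim/big_ind: _ => //; [exact: degb0|exact: degbD]. Qed.

Lemma degbX K s m : (forall i, (m i + s i <= K i)%N) -> degb K s (mpolyX R m).
Proof. by move=> dm m'; rewrite msuppX inE => /eqP->. Qed.

Lemma eq_degb K s K' s' p : K =1 K' -> s =1 s' -> degb K s p -> degb K' s' p.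
Proof. by move=> KK ss dp m mp i; rewrite -KK -ss; exact: dp. Qed.

Lemma pdegXn (k r n : nat) : (n + r <= k)%N -> pdeg k r ('X^n : {poly R}).
Proof. by move=> h; rewrite /pdeg size_polyXn; lia. Qed.

Lemma degb_lift K s K' s' i (L : {poly R} -> {poly R}) p : degb K s p ->
  (forall j, j != i -> K' j = K j /\ s' j = s j) ->
  (forall q, pdeg (K i) (s i) q -> pdeg (K' i) (s' i) (L q)) ->
  degb K' s' (lift i L p).
Proof.
move=> dp KK dL; rewrite /lift /mlin big_seq; apply: degb_sum => m mp.
apply: degbZ; apply: degb_sum => d _; apply: degbZ; apply: degbX => j.
rewrite msetE; case: eqP => [->|/eqP ji]; last by have [-> ->] := KK j ji; exact: dp.
have := dL _ (pdegXn (dp _ mp i)); rewrite /pdeg; have := ltn_ord d; lia.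
Qed.

Lemma eq_lift_degb K s i (L L' : {poly R} -> {poly R}) p : degb K s p ->
  (forall q, pdeg (K i) (s i) q -> L q = L' q) -> lift i L p = lift i L' p.
Proof.
move=> dp LL; rewrite /lift /mlin !big_seq; apply: eq_bigr => m mp.
by rewrite LL//; apply: pdegXn; apply: dp.
Qed.

(** The polynomial in [x_i] that multiplies the monomial of [m] in the other variables. It turns
    [lift i L] into [L] itself, so one-variable facts apply slice by slice. *)
Definition slice i m p : {poly R} :=
  mlin (fun m' => if mset m' i 0 == mset m i 0 then 'X^(m' i) else 0) p.

HB.instance Definition _ i m :=
  GRing.isLinear.Build R (poly3 R) {poly R} _ (slice i m) (mlin_is_linear _).

Lemma sliceX i m m' :
  slice i m (mpolyX R m') = if mset m' i 0 == mset m i 0 then 'X^(m' i) else 0.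
Proof. exact: mlinX. Qed.

Lemma slice_ins i m m' q : slice i m (ins i m' q) = if mset m' i 0 == mset m i 0 then q else 0.
Proof.
case: ifP => mm.
  by apply: (@eq_plinear R _ (slice i m \o ins i m') idfun) => n /=;
     rewrite ins_Xn sliceX mset_mset mset_eq mm.
by apply: (@eq_plinear R _ (slice i m \o ins i m') \0) => n /=;
   rewrite ins_Xn sliceX mset_mset mm.
Qed.

Lemma slice_lift i L m p : slice i m (lift i L p) = L (slice i m p).
Proof.
apply: (@eq_mlinear R _ (slice i m \o lift i L) (L \o slice i m)) => m' /=.
by rewrite lift_X slice_ins sliceX; case: ifP => _ //; rewrite raddf0.
Qed.

Lemma coef_slice i m p : (slice i m p)`_(m i) = mcoeff m p.
Proof.
pose f := (fun p => (slice i m p)`_(m i) : R^o).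
have fl : linear f by move=> a x y; rewrite /f linearP coefD coefZ.
pose F := HB.pack f (GRing.isLinear.Build R (poly3 R) R^o _ f fl) : {linear poly3 R -> R^o}.
pose g := (fun p => mcoeff m p : R^o).
have gl : linear g by move=> a x y; rewrite /g mcoeffD mcoeffZ.
pose G := HB.pack g (GRing.isLinear.Build R (poly3 R) R^o _ g gl) : {linear poly3 R -> R^o}.
apply: (@eq_mlinear R _ F G) => m' /=; rewrite /f /g sliceX mcoeffX.
case: (m' =P m) => [->|mm']; first by rewrite eqxx coefXn eqxx.
case: eqP => [mm|_]; last by rewrite coef0.
rewrite coefXn; case: eqP => // mi; case: mm'.
by rewrite -(mset_id m' i) -(mset_id m i) -mi -(mset_mset m' i 0) mm mset_mset.
Qed.

Lemma slice_eq0 i p : (forall m, slice i m p = 0) -> p = 0.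
Proof. by move=> sp; apply/mpolyP => m; rewrite -(coef_slice i) sp coef0 mcoeff0. Qed.

Lemma slice_degb K s i m p : degb K s p -> pdeg (K i) (s i) (slice i m p).
Proof.
move=> dp; rewrite /pdeg /slice /mlin; apply/leq_sizeP => j Kj.
rewrite coef_sum big_seq big1// => m' mp; rewrite coefZ; case: ifP => _; last by rewrite coef0 mulr0.
rewrite coefXn; case: eqP => [ji|_]; last by rewrite mulr0.
by have := dp _ mp i; lia.
Qed.

Lemma lift_separated K s i (Lam : op R -> Prop) (J : op R) p :
  (forall q, pdeg (K i) (s i) q -> (forall l, Lam l -> l q = 0) -> J q = 0) ->
  degb K s p -> (forall l : op R, Lam l -> lift i l p = 0) -> lift i J p = 0.
Proof.
move=> sep dp lp; apply: (@slice_eq0 i) => m; rewrite slice_lift; apply: sep.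
  exact: slice_degb.
by move=> l Ll; rewrite -slice_lift lp// raddf0.
Qed.

End Degb.

Section Lift3.
Variable R : realType.
Implicit Types (K s : axis -> nat) (p : poly3 R).

Definition ax0 : axis := 0.
Definition ax1 : axis := 1.
Definition ax2 : axis := 2%:R.

Lemma axisP (P : axis -> Prop) : P ax0 -> P ax1 -> P ax2 -> forall i, P i.
Proof.
move=> P0 P1 P2 [[|[|[|//]]] Hi].
- by rewrite (_ : Ordinal _ = ax0)//; exact: val_inj.
- by rewrite (_ : Ordinal _ = ax1)//; exact: val_inj.
- by rewrite (_ : Ordinal _ = ax2)//; exact: val_inj.
Qed.

Definition lift3 (L : axis -> {poly R} -> {poly R}) (p : poly3 R) : poly3 R :=
  lift ax0 (L ax0) (lift ax1 (L ax1) (lift ax2 (L ax2) p)).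

Lemma lift3_is_linear L : linear (lift3 L).
Proof. by move=> a x y; rewrite /lift3 !linearP. Qed.

HB.instance Definition _ (L : axis -> {poly R} -> {poly R}) :=
  GRing.isLinear.Build R (poly3 R) (poly3 R) _ (lift3 L) (lift3_is_linear L).

Lemma lift3_comp (L L' : axis -> op R) p :
  lift3 (fun i => L i \o L' i) p = lift3 L (lift3 L' p).
Proof.
rewrite /lift3 !lift_comp (liftC (L' ax1) (L ax2))// (liftC (L' ax0) (L ax1))//.
by rewrite (liftC (L' ax0) (L ax2)).
Qed.

Lemma eq_lift3 (L L' : axis -> {poly R} -> {poly R}) p :
  (forall i n, L i 'X^n = L' i 'X^n) -> lift3 L p = lift3 L' p.
Proof.
by move=> LL; rewrite /lift3 (eq_lift _ _ (LL ax0)) (eq_lift _ _ (LL ax1)) (eq_lift _ _ (LL ax2)).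
Qed.

Lemma lift3_id p : lift3 (fun=> id) p = p.
Proof. by rewrite /lift3 !lift_id. Qed.

Definition axis_op i (D : op R) : axis -> op R := fun j => if j == i then D else idfun.

Lemma lift3_axis_op i (D : op R) p : lift3 (axis_op i D) p = lift i D p.
Proof. by elim/axisP: i; rewrite /lift3 /axis_op /= ?lift_id. Qed.

Lemma lift3_intertwine (L L' : axis -> op R) i (D D' : op R) p :
  (forall n, D (L i 'X^n) = L' i (D' 'X^n)) ->
  (forall j n, j != i -> L j 'X^n = L' j 'X^n) ->
  lift i D (lift3 L p) = lift3 L' (lift i D' p).
Proof.
move=> LD LL; rewrite -!lift3_axis_op -!lift3_comp; apply: eq_lift3 => j n /=.
by rewrite /axis_op; case: eqP => [->//|/eqP ji] /=; exact: LL.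
Qed.

Lemma lift3_eq0 (L : axis -> op R) i p : (forall n, L i 'X^n = 0) -> lift3 L p = 0.
Proof.
move=> L0; have E (j : axis) p' : j = i -> lift j (L j) p' = 0.
  by move=> ->; rewrite (@eq_lift _ _ _ (fun=> 0))// lift0.
by rewrite /lift3; elim/axisP: i E {L0} => E;
  [rewrite E|rewrite (E ax1) ?raddf0|rewrite (E ax2) ?raddf0].
Qed.

Lemma degb_lift3 K s K' s' (L : axis -> {poly R} -> {poly R}) p : degb K s p ->
  (forall i q, pdeg (K i) (s i) q -> pdeg (K' i) (s' i) (L i q)) ->
  degb K' s' (lift3 L p).
Proof.
move=> dp dL; rewrite /lift3.
pose mix (f g : axis -> nat) (n : nat) (i : axis) := if (i < n)%N then f i else g i.
apply: (@degb_lift _ (mix K K' 1) (mix s s' 1)).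
- apply: (@degb_lift _ (mix K K' 2) (mix s s' 2)).
  + apply: (@degb_lift _ K s) => //; last exact: dL.
    by elim/axisP.
  + by elim/axisP.
  + exact: dL.
- by elim/axisP.
- exact: dL.
Qed.

Lemma eq_lift3_degb K s (L L' : axis -> op R) p : degb K s p ->
  (forall i q, pdeg (K i) (s i) q -> pdeg (K i) (s i) (L i q)) ->
  (forall i q, pdeg (K i) (s i) q -> L i q = L' i q) -> lift3 L p = lift3 L' p.
Proof.
move=> dp dL LL; rewrite /lift3.
have d2 : degb K s (lift ax2 (L ax2) p) by apply: (degb_lift dp) => //; exact: dL.
have d1 : degb K s (lift ax1 (L ax1) (lift ax2 (L ax2) p)) by apply: (degb_lift d2) => //; exact: dL.
rewrite (eq_lift_degb d1 (LL ax0)) (eq_lift_degb d2 (LL ax1)).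
by rewrite (eq_lift_degb dp (LL ax2)).
Qed.

(** Unisolvence is inherited by tensor products: the functionals are traded for [J] one axis at a
    time, the operators on the other axes commuting past. *)
Lemma lift3_separated K s (Lam : axis -> op R -> Prop) (J : axis -> op R) p :
  (forall i q, pdeg (K i) (s i) q -> (forall l, Lam i l -> l q = 0) -> J i q = 0) ->
  (forall i q (l : op R), pdeg (K i) (s i) q -> Lam i l -> pdeg (K i) (s i) (l q)) ->
  (forall i q, pdeg (K i) (s i) q -> pdeg (K i) (s i) (J i q)) ->
  degb K s p ->
  (forall l : axis -> op R, (forall i, Lam i (l i)) -> lift3 l p = 0) -> lift3 J p = 0.
Proof.
move=> sep dl dJ dp lp.
have dlift i (L : op R) p' : degb K s p' -> (forall q, pdeg (K i) (s i) q -> pdeg (K i) (s i) (L q)) ->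
  degb K s (lift i L p').
  by move=> dp' dL; apply: (degb_lift dp').
pose l3 (l0 l1 l2 : op R) (i : axis) := if i == ax0 then l0 else if i == ax1 then l1 else l2.
have E0 l1 l2 : Lam ax1 l1 -> Lam ax2 l2 ->
    lift ax0 (J ax0) (lift ax1 l1 (lift ax2 l2 p)) = 0.
  move=> L1 L2; apply: (lift_separated (sep ax0)) => [|l0 L0].
    by apply: (dlift) => [|q dq]; [apply: (dlift) => // q dq; exact: dl|exact: dl].
  by apply: (lp (l3 l0 l1 l2)); elim/axisP.
have E1 l2 : Lam ax2 l2 -> lift ax1 (J ax1) (lift ax0 (J ax0) (lift ax2 l2 p)) = 0.
  move=> L2; apply: (lift_separated (sep ax1)) => [|l1 L1].
    by apply: (dlift) => [|q dq]; [apply: (dlift) => // q dq; exact: dl|exact: dJ].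
  by rewrite liftC// E0.
rewrite /lift3 (liftC (J ax0) (J ax1))// (liftC (J ax0) (J ax2))// (liftC (J ax1) (J ax2))//.
apply: (lift_separated (sep ax2)) => [|l2 L2].
  by apply: (dlift) => [|q dq]; [apply: (dlift) => // q dq; exact: dJ|exact: dJ].
by rewrite (liftC l2)// (liftC l2)// E1.
Qed.

End Lift3.

(** * Jets, Hermite interpolation and unisolvence on an interval *)

Section OneVariable.
Variable R : realType.
Implicit Types (a b c : R) (q f g : {poly R}) (s K n : nat).

Definition jet a f g q : {poly R} := q.[a] *: f + q^`().[a] *: g.

Lemma jet_is_linear a f g : linear (jet a f g).
Proof.
move=> c p q; rewrite /jet derivD derivZ !hornerE /= !scalerDl !scalerDr !scalerA.
by rewrite addrACA addrA.
Qed.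

HB.instance Definition _ a f g :=
  GRing.isLinear.Build R {poly R} {poly R} _ (jet a f g) (jet_is_linear a f g).

Lemma jet_jet a f g a' f' g' q :
  f'.[a] = (a == a')%:R -> g'.[a] = 0 -> f'^`().[a] = 0 -> g'^`().[a] = (a == a')%:R ->
  jet a f g (jet a' f' g' q) = if a == a' then jet a f g q else 0.
Proof.
move=> f0 g0 f1 g1; rewrite /jet derivD !derivZ !hornerE /= f0 g0 f1 g1.
case: eqP => [->|_]; first by rewrite !mulr1 !mulr0 addr0 add0r.
by rewrite !mulr0 !addr0 !scale0r addr0.
Qed.

Definition tay1 s : {poly R} := if (s <= 1)%N then 1 else 0.
Definition tayX a s : {poly R} := if s == 0%N then 'X - a%:P else 0.

(* Taylor polynomial at a with 2 - s terms. *)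
Definition tay a s : op R := jet a (tay1 s) (tayX a s).

Lemma tayE a s q : tay a s q = jet a (tay1 s) (tayX a s) q. Proof. by []. Qed.

Lemma tay_id a s q : pdeg 1 s q -> tay a s q = q.
Proof.
rewrite /pdeg tayE /jet /tay1 /tayX; case: s => [|[|s]] /=.
- rewrite subn0 => q2.
  have -> : q = q`_0 *: 1 + q`_1 *: 'X.
    apply/polyP => i; rewrite coefD !coefZ coef1 coefX.
    by case: i => [|[|i]] /=; rewrite ?mulr1 ?mulr0 ?addr0 ?add0r// nth_default// (leq_trans q2).
  move: q`_0 q`_1 => u v; rewrite derivD !derivZ derivC derivX !hornerE /= -!mul_polyC.
  by rewrite ?rmorphD ?rmorphM/=; ring.
- by move=> /size1_polyC ->; rewrite scaler0 addr0 hornerC alg_polyC.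
- have -> : (2 - s.+2 = 0)%N by lia.
  by rewrite leqn0 size_poly_eq0 => /eqP->; rewrite !horner0 deriv0 horner0 !scale0r addr0.
Qed.

Lemma pdeg_tay a s q : pdeg 1 s (tay a s q).
Proof.
rewrite /pdeg tayE /jet /tay1 /tayX; case: s => [|[|s]] /=.
- rewrite subn0; apply: leq_trans (size_polyD _ _) _; rewrite geq_max.
  by rewrite !(leq_trans (size_scale_leq _ _))// ?size_poly1// size_XsubC.
- by rewrite scaler0 addr0 (leq_trans (size_scale_leq _ _))// size_poly1.
- by rewrite !scaler0 addr0 size_poly0.
Qed.

Lemma tay_tay a s q : tay a s (tay a s q) = tay a s q.
Proof. by rewrite tay_id//; exact: pdeg_tay. Qed.

(** Differentiation removes one term of the jet, just as the index goes up by one. This is what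
    makes traces commute with the exterior derivative. *)
Lemma deriv_tay a s q : (tay a s q)^`() = tay a s.+1 q^`().
Proof.
rewrite !tayE /jet /tay1 /tayX derivD !derivZ; case: s => [|s] /=.
  by rewrite derivC derivB derivX derivC !scaler0 add0r addr0 subr0.
by case: s => [|s] /=; rewrite ?derivC ?deriv0 !scaler0 !addr0.
Qed.

(** The Hermite basis function for the value at [a]: cubic for s = 0, linear for s = 1. [hermX] is
    the one for the slope, used only when s = 0. *)
Definition herm1 a b s : {poly R} :=
  if s == 0%N then ((a - b) ^- 3)%:P * ('X - b%:P) ^+ 2 * ((a - b)%:P - 2%:P * ('X - a%:P))
  else if s == 1%N then (a - b)^-1%:P * ('X - b%:P) else 0.
Definition hermX a b s : {poly R} :=
  if s == 0%N then ((a - b) ^- 2)%:P * ('X - a%:P) * ('X - b%:P) ^+ 2 else 0.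

(* The polynomial of least degree with the jet of q at a and zero jet at b. *)
Definition herm a b s : op R := jet a (herm1 a b s) (hermX a b s).

Lemma hermE a b s q : herm a b s q = jet a (herm1 a b s) (hermX a b s) q. Proof. by []. Qed.

Lemma tay_herm a b s q : a != b -> tay a s (herm a b s q) = tay a s q.
Proof.
move=> ab; have ab0 : a - b != 0 by rewrite subr_eq0.
rewrite !tayE hermE /tay1 /tayX /herm1 /hermX; case: s => [|[|s]] /=.
- rewrite jet_jet ?eqxx //.
  + by rewrite !hornerE/= mulr1n; field.
  + by rewrite !hornerE/=; field.
  + rewrite expr2 !poly.derivE !hornerE/=; field => //.
  + by rewrite expr2 !poly.derivE !hornerE/= mulr1n; field.
- rewrite /jet !scaler0 !addr0; congr (_ *: _); rewrite !hornerE/=; field => //.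
- by rewrite /jet !scaler0.
Qed.

Lemma tay_herm0 a b s q : a != b -> tay b s (herm a b s q) = 0.
Proof.
move=> ab; have ab0 : a - b != 0 by rewrite subr_eq0.
rewrite !tayE hermE /tay1 /tayX /herm1 /hermX; case: s => [|[|s]] /=.
- have ba : (b == a) = false by rewrite eq_sym (negbTE ab).
  rewrite jet_jet ?ba//=.
  + by rewrite !hornerE/= ; ring.
  + by rewrite !hornerE/=; ring.
  + by rewrite expr2 !poly.derivE !hornerE/=; ring.
  + by rewrite expr2 !poly.derivE !hornerE/=; ring.
- by rewrite /jet !scaler0 !addr0 !hornerE/= subrr !mulr0 scale0r.
- by rewrite /jet !scaler0 !addr0.
Qed.

Lemma pdeg_herm a b s K q : (3 <= K)%N -> pdeg K s (herm a b s q).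
Proof.
move=> K3; rewrite /pdeg hermE /jet /herm1 /hermX; case: s => [|[|s]] /=.
- rewrite subn0; apply: leq_trans (_ : 4 <= _)%N => //.
  apply: leq_trans (size_polyD _ _) _; rewrite geq_max.
  apply/andP; split; apply: leq_trans (size_scale_leq _ _) _.
  + rewrite -mulrA mul_polyC; apply: leq_trans (size_scale_leq _ _) _.
    apply: leq_trans (size_polyMleq _ _) _; rewrite size_exp_XsubC.
    suff : (size ((a - b)%:P - 2%:P * ('X - a%:P) : {poly R})%R <= 2)%N by lia.
    apply: leq_trans (size_polyD _ _) _; rewrite geq_max size_polyN.
    rewrite (leq_trans (size_polyC_leq1 _))//= mul_polyC.
    by rewrite (leq_trans (size_scale_leq _ _))// size_XsubC.
  + rewrite -mulrA mul_polyC; apply: leq_trans (size_scale_leq _ _) _.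
    by apply: leq_trans (size_polyMleq _ _) _; rewrite size_exp_XsubC size_XsubC.
- rewrite scaler0 addr0; apply: leq_trans (_ : 2 <= _)%N; last lia.
  rewrite (leq_trans (size_scale_leq _ _))// mul_polyC (leq_trans (size_scale_leq _ _))//.
  by rewrite size_XsubC.
- by rewrite !scaler0 addr0 size_poly0.
Qed.

Lemma herm_tay a b s q : herm a b s (tay a s q) = herm a b s q.
Proof.
rewrite !hermE tayE /tay1 /tayX /herm1 /hermX; case: s => [|[|s]] /=.
- by rewrite jet_jet ?eqxx ?derivXsubC ?derivC ?hornerXsubC ?hornerC ?subrr.
- by rewrite /jet !scaler0 !addr0 !hornerE/= ?mulr1.
- by rewrite /jet !scaler0.
Qed.

Lemma pdeg_tayK a s K q : (0 < K)%N -> pdeg K s (tay a s q).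
Proof. by move=> K0; apply: leq_trans (pdeg_tay a s q) _; lia. Qed.

Definition prim (q : {poly R}) : {poly R} := plin (fun d => d.+1%:R^-1 *: 'X^(d.+1)) q.
HB.instance Definition _ := GRing.isLinear.Build R {poly R} {poly R} _ prim (plin_is_linear _).

Lemma prim_Xn n : prim 'X^n = n.+1%:R^-1 *: 'X^(n.+1).
Proof. exact: plinXn. Qed.

Lemma deriv_prim q : (prim q)^`() = q.
Proof.
apply: (@eq_plinear R _ (@deriv R \o prim) idfun) => n /=.
by rewrite prim_Xn derivZ derivXn -scalerMnr scalerMnl -mulr_natr mulVf ?scale1r// pnatr_eq0.
Qed.

(** Evaluation takes values in constant polynomials, so that it is an operator that [lift] can apply
    in one variable. *)
Definition ev a (q : {poly R}) : {poly R} := jet a 1 0 q.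
HB.instance Definition _ a := GRing.isLinear.Build R {poly R} {poly R} _ (ev a) (jet_is_linear a 1 0).

Lemma evE a q : ev a q = q.[a]%:P.
Proof. by rewrite /ev /jet scaler0 addr0 alg_polyC. Qed.

Lemma prim_deriv q : prim q^`() = q - ev 0 q.
Proof.
apply: (@eq_plinear R _ (prim \o @deriv R) (idfun \- ev 0)) => -[|n] /=.
  by rewrite expr0 derivC raddf0 evE hornerC subrr.
rewrite derivXn raddfMn/= prim_Xn evE hornerXn expr0n/= subr0 scalerMnl -mulr_natr.
by rewrite mulVf ?scale1r// pnatr_eq0.
Qed.

Lemma pdeg_prim K s q : pdeg K s.+1 q -> pdeg K s (prim q).
Proof.
rewrite /pdeg; have [->|q0 qK] := eqVneq q 0; first by rewrite raddf0 size_poly0.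
apply: (@leq_trans (size q).+1); last by move: qK; rewrite -size_poly_eq0 in q0; lia.
apply: leq_trans (size_sum _ _ _) _; apply/bigmax_leqP => d _.
apply: leq_trans (size_scale_leq _ _) _; apply: leq_trans (size_scale_leq _ _) _.
by rewrite size_polyXn ltnS.
Qed.

Lemma pdeg_deriv K s q : pdeg K s q -> pdeg K s.+1 q^`().
Proof.
rewrite /pdeg; have [->|q0] := eqVneq q 0; first by rewrite deriv0 size_poly0.
by move=> qK; have := lt_size_deriv q0; lia.
Qed.

Lemma pdeg_ev K s a q : pdeg K s q -> pdeg K s (ev a q).
Proof.
rewrite /pdeg evE; have [->|q0] := eqVneq q 0; first by rewrite horner0 size_poly0.
by apply: leq_trans; apply: leq_trans (size_polyC_leq1 _) _; rewrite size_poly_gt0.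
Qed.

Definition intv a b q : R := (prim q).[b] - (prim q).[a].

Lemma poly_eq0_itv a b q : a < b -> (forall x, a < x < b -> q.[x] = 0) -> q = 0.
Proof.
move=> ab q0; apply/eqP; apply: contraT => nq0.
pose r n : R := a + (b - a) / n.+2%:R.
have rI : injective r.
  have ba0 : b - a != 0 by rewrite subr_eq0 gt_eqF.
  by move=> m n /addrI /(mulfI ba0) /invr_inj /eqP; rewrite eqr_nat !eqSS => /eqP.
have := @max_poly_roots _ q [seq r n | n <- iota 0 (size q)] nq0.
rewrite size_map size_iota ltnn; apply.
  apply/allP => _ /mapP[n _ ->]; apply/eqP/q0; rewrite /r; apply/andP; split.
    by rewrite ltrDl divr_gt0 ?subr_gt0.
  rewrite -ltrBrDl ltr_pdivrMr// ltr_pMr ?subr_gt0// ltr1n//.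
by rewrite map_inj_uniq// iota_uniq.
Qed.

Lemma intv_eq0 a b q : a < b -> (forall x, a < x < b -> 0 <= q.[x]) -> intv a b q = 0 -> q = 0.
Proof.
move=> ab q0 /eqP; rewrite subr_eq0 => /eqP Pab.
have mono : {in `[a, b] &, {homo horner (prim q) : x y / x <= y}}.
  by apply: ler_hornerW => x; rewrite in_itv/= deriv_prim; exact: q0.
have aI : a \in `[a, b] by rewrite in_itv/= lexx ltW.
have bI : b \in `[a, b] by rewrite in_itv/= lexx ltW.
suff P0 : prim q - (prim q).[a]%:P = 0.
  by rewrite -(deriv_prim q) -(subrK (prim q).[a]%:P (prim q)) P0 add0r derivC.
apply: (poly_eq0_itv ab) => x /andP[ax xb]; rewrite !hornerE/=.
have xI : x \in `[a, b] by rewrite in_itv/= !ltW.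
apply/eqP; rewrite subr_eq0 eq_le -{1}Pab; apply/andP; split; apply: mono => //; exact: ltW.
Qed.

Lemma double_root a q : q.[a] = 0 -> q^`().[a] = 0 -> exists r, q = r * ('X - a%:P) ^+ 2.
Proof.
move=> /eqP/factor_theorem[r ->]; rewrite !poly.derivE !hornerE/= subrr mulr0 add0r ?mulr1.
by move=> /eqP/factor_theorem[t ->]; exists t; rewrite expr2 mulrA.
Qed.

Lemma intv_linear a b (p q : {poly R}) :
  (forall n, (n < size q)%N -> intv a b (p * 'X^n) = 0) -> intv a b (p * q) = 0.
Proof.
move=> pn; rewrite -[q]coefK poly_def mulr_sumr /intv raddf_sum !horner_sum -sumrB/= big1// => d _.
by rewrite -scalerAr linearZ !hornerZ -mulrBr -/(intv a b _) pn ?mulr0.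
Qed.

(** The endpoint conditions give q = t w, where w has degree 4 - 2 s and is nonnegative on the
    interval. Then t has degree at most K + s - 4, so it is an admissible weight, and the integral
    of t^2 w vanishes. *)
Lemma interval_unisolvent a b s K q :
  a < b -> (3 <= K)%N -> (s <= 2)%N -> pdeg K s q ->
  (forall c r, (c == a) || (c == b) -> (r + s < 2)%N -> (iter r (@deriv R) q).[c] = 0) ->
  (forall n, (n + 4 <= K + s)%N -> intv a b (q * 'X^n) = 0) -> q = 0.
Proof.
move=> ab K3 s2 dq q0 mq.
have ba0 : b - a != 0 by rewrite subr_eq0 gt_eqF.
have [w [t [qE w0 sw wn0]]] : exists w t : {poly R}, [/\ q = t * w,
    (forall x, a < x < b -> 0 <= w.[x]), size w = (5 - 2 * s)%N & w != 0].
  case: s s2 dq q0 {mq} => [|[|[|//]]] _ dq q0.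
  - have qa r : (r < 2)%N -> (iter r (@deriv R) q).[a] = 0 by move=> ?; rewrite q0 ?eqxx ?addn0.
    have qb r : (r < 2)%N -> (iter r (@deriv R) q).[b] = 0 by move=> ?; rewrite q0 ?eqxx ?orbT ?addn0.
    have qa0 : q.[a] = 0 := qa 0%N isT.
    have qa1 : q^`().[a] = 0 := qa 1%N isT.
    have [r rE] := double_root qa0 qa1.
    have rb : r.[b] = 0.
      have /eqP := qb 0%N isT; rewrite /= rE hornerM horner_exp hornerXsubC mulf_eq0 expf_eq0/= (negbTE ba0) orbF.
      by move/eqP.
    have rb' : r^`().[b] = 0.
      have /eqP := qb 1%N isT; rewrite /= rE derivM hornerD [(r * _).[b]]hornerM rb mul0r addr0 hornerM horner_exp hornerXsubC.
      by rewrite mulf_eq0 expf_eq0/= (negbTE ba0) orbF => /eqP.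
    have [t tE] := double_root rb rb'.
    exists (('X - a%:P) ^+ 2 * ('X - b%:P) ^+ 2), t; split.
    + by rewrite rE tE; ring.
    + by move=> x _; rewrite -exprMn horner_exp sqr_ge0.
    + by rewrite size_mul ?expf_neq0 ?polyXsubC_eq0// !size_exp_XsubC.
    + by rewrite mulf_neq0 ?expf_neq0 ?polyXsubC_eq0.
  - have : q.[a] = 0 by apply: (q0 a 0%N); rewrite ?eqxx.
    move=> /eqP/factor_theorem[r rE].
    have : r.[b] = 0.
      have /eqP : q.[b] = 0 by apply: (q0 b 0%N); rewrite ?eqxx ?orbT.
      by rewrite rE hornerM hornerXsubC mulf_eq0 (negbTE ba0) orbF => /eqP.
    move=> /eqP/factor_theorem[t tE].
    exists (('X - a%:P) * (b%:P - 'X)), (- t); split.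
    + by rewrite rE tE; ring.
    + by move=> x /andP[? ?]; rewrite !hornerE/= mulr_ge0// subr_ge0 ltW.
    + by rewrite -(opprB 'X b%:P) mulrN size_polyN size_mul ?polyXsubC_eq0// !size_XsubC.
    + by rewrite -(opprB 'X b%:P) mulrN oppr_eq0 mulf_neq0 ?polyXsubC_eq0.
  - exists 1, q; split; rewrite ?mulr1 ?size_poly1 ?oner_eq0// => x _; rewrite hornerC ler01 //.
have [t0|t0] := eqVneq t 0; first by rewrite qE t0 mul0r.
suff : t ^+ 2 * w = 0.
  by move=> /eqP; rewrite mulf_eq0 expf_eq0/= (negbTE t0) (negbTE wn0).
apply: (intv_eq0 ab) => [x xab|]; first by rewrite !hornerE mulr_ge0 ?sqr_ge0 ?w0.
rewrite expr2 -mulrA mulrC -qE; apply: intv_linear => n nt; apply: mq.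
move: dq; rewrite /pdeg qE size_mul// sw; move: nt s2 K3; clear; move: (size t) => u; lia.
Qed.

End OneVariable.

(** * Traces and Hermite extensions *)

(** The form in which face-to-face meshes are used from here on: along each axis, meeting cells have
    equal or adjacent intervals. *)
Definition aligned_mesh (R : realType) (I : finType) (cell : I -> box R) : Prop :=
  (forall T i, lo (cell T) 0 i < hi (cell T) 0 i) /\
  forall T T', meets (cell T) (cell T') -> forall i,
    [\/ lo (cell T) 0 i = lo (cell T') 0 i /\ hi (cell T) 0 i = hi (cell T') 0 i,
        hi (cell T) 0 i = lo (cell T') 0 i | hi (cell T') 0 i = lo (cell T) 0 i].

Lemma cuboid_mesh_aligned (R : realType) (Omega : set 'rV[R]_3) (I : finType)
    (cell : I -> box R) : cuboid_mesh Omega cell -> aligned_mesh cell.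
Proof.
move=> [cells _ ftf].
have clt T i : lo (cell T) 0 i < hi (cell T) 0 i.
  by have := cells T; rewrite /is_cell => /setP/(_ i); rewrite !inE.
split=> // T T' TT' i; have [->|nTT] := eqVneq T T'; first by constructor.
pose p : 'rV[R]_3 := \row_j Num.max (lo (cell T) 0 j) (lo (cell T') 0 j).
have pT : box_set (cell T) p.
  by move=> j; rewrite mxE le_max lexx ge_max (ltW (clt T j)); have [_ ->] := TT' j.
have pT' : box_set (cell T') p.
  by move=> j; rewrite mxE le_max lexx orbT ge_max (ltW (clt T' j)); have [-> _] := TT' j.
have [E0|[E [_ ET ET' EE]]] := ftf T T' nTT.
  by have : (box_set (cell T) `&` box_set (cell T')) p by []; rewrite E0.
pose q (t : R) : 'rV[R]_3 := \row_j (if j == i then t else p 0 j).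
have qE t : lo (cell T) 0 i <= t <= hi (cell T) 0 i -> lo (cell T') 0 i <= t <= hi (cell T') 0 i ->
    lo E 0 i <= t <= hi E 0 i.
  move=> tT tT'; have : box_set E (q t).
    rewrite -EE; split=> j; rewrite mxE; case: eqP => [->//|_]; [exact: pT|exact: pT'].
  by move/(_ i); rewrite mxE eqxx.
have hlt := clt T i; have hlt' := clt T' i.
have [m1 m2] := TT' i.
have /andP[qlo1 qlo2] : lo E 0 i <= Num.max (lo (cell T) 0 i) (lo (cell T') 0 i) <= hi E 0 i.
  by apply: qE; rewrite le_max ge_max lexx ?orbT /= ?(ltW hlt) ?(ltW hlt') ?m1 ?m2.
have /andP[qhi1 qhi2] : lo E 0 i <= Num.min (hi (cell T) 0 i) (hi (cell T') 0 i) <= hi E 0 i.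
  by apply: qE; rewrite le_min ge_min lexx ?orbT /= ?(ltW hlt) ?(ltW hlt') ?m1 ?m2.
(* An overlap longer than a point makes [E] nondegenerate along [i]. This excludes the cases where
   [E] is the lower end of both intervals or the upper end of both. *)
have lmax : Num.max (lo (cell T) 0 i) (lo (cell T') 0 i) < Num.min (hi (cell T) 0 i) (hi (cell T') 0 i)
    -> lo E 0 i < hi E 0 i.
  by move=> h; apply: le_lt_trans qlo1 _; apply: lt_le_trans h qhi2.
move: lmax; rewrite gt_max !lt_min hlt hlt' /= andbT.
case: (ET i) => -[e1 e2]; case: (ET' i) => -[e3 e4] lmax.
- by constructor 1; split; congruence.
- by move: hlt; rewrite -e1 -e2 e3 e4 ltxx.
- by move: hlt; rewrite -e1 -e2 e3 e4 ltxx.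
- by move: hlt'; rewrite -e3 -e4 e1 e2 ltxx.
- by move: lmax; rewrite -e3 e1 hlt -e1 e3 hlt' e4 ltxx => /(_ isT).
- by constructor 3; congruence.
- by move: hlt'; rewrite -e3 -e4 e1 e2 ltxx.
- by constructor 2; congruence.
- by move: lmax; rewrite -e4 e2 hlt -e2 e4 hlt' e3 ltxx => /(_ isT).
Qed.

Section AlignedMesh.
Variables (R : realType) (I : finType) (cell : I -> box R).
Hypothesis mesh : aligned_mesh cell.
Implicit Types (s t : seq I) (i : axis) (q : {poly R}) (sg : axis -> nat).

Local Notation L s i := (lo (cap cell s) 0 i).
Local Notation H s i := (hi (cap cell s) 0 i).

Lemma cap_free s T i : clique cell s -> L s i < H s i -> T \in s ->
  lo (cell T) 0 i = L s i /\ hi (cell T) 0 i = H s i.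
Proof.
have [clt al] := mesh => cs LH Ts; have s0 : s != [::] by case: s Ts {cs LH}.
have [T1 T1s E1] := cap_lo_ex cell i s0; have [T2 T2s E2] := cap_hi_ex cell i s0.
have eqT1 T' : T' \in s -> lo (cell T') 0 i = L s i /\ hi (cell T') 0 i = hi (cell T1) 0 i.
  move=> T's; case: (al _ _ (cs T' T1 T's T1s) i) => [[-> ->]//|e|e].
    by have := cap_hi cell i T's; rewrite e -E1 => /(lt_le_trans LH); rewrite ltxx.
  have := cap_lo cell i T's; rewrite -e => /le_lt_trans /(_ LH).
  by move/lt_le_trans => /(_ _ (cap_hi cell i T1s)); rewrite ltxx.
have [-> ->] := eqT1 T Ts; split=> //.
by have [_ <-] := eqT1 T2 T2s.
Qed.

Lemma cap_sub_lo s t i : t != [::] -> {subset t <= s} -> L t i <= L s i.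
Proof.
by move=> t0 ts; have [T /ts Ts ->] := cap_lo_ex cell i t0; exact: cap_lo.
Qed.

Lemma cap_sub_hi s t i : t != [::] -> {subset t <= s} -> H s i <= H t i.
Proof.
by move=> t0 ts; have [T /ts Ts ->] := cap_hi_ex cell i t0; exact: cap_hi.
Qed.

(** Adding cells to a list either leaves the interval along an axis unchanged or collapses it to an
    endpoint. Traces and extensions are compared by this alternative. *)
Lemma cap_sub s t i : clique cell s -> t != [::] -> {subset t <= s} ->
  (L s i = L t i /\ H s i = H t i) \/
  [/\ L t i < H t i, L s i = H s i & L s i = L t i \/ L s i = H t i].
Proof.
have [clt al] := mesh => cs t0 ts; have s0 : s != [::] by case: t t0 ts => // T t _ /(_ T); case: s {cs} => // /(_ (mem_head _ _)).
have Ls := cap_sub_lo i t0 ts; have Hs := cap_sub_hi i t0 ts; have LHs := cap_le i s0 cs.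
have ct := clique_sub ts cs.
have [LHt|] := boolP (L t i < H t i); last first.
  by rewrite -leNgt => HLt; left; split; apply/eqP; rewrite eq_le; apply/andP; split=> //; lra.
have [V Vt _] := cap_lo_ex cell i t0; have [V1 V2] := cap_free ct LHt Vt.
have Vs := ts _ Vt.
have [LHs'|] := boolP (L s i < H s i).
  by left; have [<- <-] := cap_free cs LHs' Vs.
rewrite -leNgt => HLs; have LHe : L s i = H s i by apply/eqP; rewrite eq_le LHs.
right; split=> //.
have [U Us EU] := cap_lo_ex cell i s0.
case: (al _ _ (cs V U Vs Us) i) => [[e _]|e|e].
- by left; rewrite EU -e V1.
- by right; rewrite EU -e V2.
by have := clt U i; rewrite e V1 -EU ltNge Ls.
Qed.

Lemma cap_cons_eq T s i : clique cell (T :: s) -> L s i < H s i ->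
  lo (cell T) 0 i = L s i -> hi (cell T) 0 i = H s i ->
  L (T :: s) i = L s i /\ H (T :: s) i = H s i.
Proof.
move=> cTs LH e1 e2.
have cs : clique cell s by apply: clique_sub cTs => x xs; rewrite inE xs orbT.
have all_eq W : W \in T :: s -> lo (cell W) 0 i = L s i /\ hi (cell W) 0 i = H s i.
  by rewrite inE => /orP[/eqP->//|/(cap_free cs LH)].
have [W Ws ->] := cap_lo_ex cell i (isT : T :: s != [::]).
have [W' Ws' ->] := cap_hi_ex cell i (isT : T :: s != [::]).
by have [-> _] := all_eq _ Ws; have [_ ->] := all_eq _ Ws'.
Qed.

(** Along a degenerate axis the jet is kept rather than the value, so that equal traces also mean
    equal normal derivatives up to the order that the index allows. *)
Definition trace (E : box R) sg (i : axis) : op R :=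
  if lo E 0 i < hi E 0 i then (idfun : op R) else tay (lo E 0 i) (sg i).

(* Extends data on T and E to E: when T and E only share an endpoint along x_i,
   the jet there is extended by a polynomial with zero jet at the other end, so
   that the extension vanishes on the cells that do not meet T. *)
Definition exten (T E : box R) sg (i : axis) : op R :=
  if lo E 0 i < hi E 0 i then
    if hi T 0 i <= lo E 0 i then herm (lo E 0 i) (hi E 0 i) (sg i)
    else if hi E 0 i <= lo T 0 i then herm (hi E 0 i) (lo E 0 i) (sg i)
    else (idfun : op R)
  else tay (lo E 0 i) (sg i).

(* Along a degenerate axis a trace is a jet of at most two terms. *)
Definition ebound (k : nat) (E : box R) (i : axis) : nat :=
  if lo E 0 i < hi E 0 i then k else 1.

Definition tr s sg (p : poly3 R) := lift3 (fun i => trace (cap cell s) sg i) p.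

HB.instance Definition _ s sg :=
  GRing.isLinear.Build R (poly3 R) (poly3 R) _ (tr s sg) (lift3_is_linear _).

(** Zero if the cells of [T :: s] do not all meet; this cutoff replaces a partition of unity.
    Compatibility with derivatives is not asked for: extensions act on one coefficient of a form at
    a time. *)
Definition ext T s sg (p : poly3 R) : poly3 R :=
  if `[< clique cell (T :: s) >] then lift3 (fun i => exten (cell T) (cap cell s) sg i) p else 0.

Lemma ext_is_linear T s sg : linear (ext T s sg).
Proof.
move=> a x y; rewrite /ext; case: asboolP => _; last by rewrite scaler0 addr0.
exact: lift3_is_linear.
Qed.

HB.instance Definition _ T s sg :=
  GRing.isLinear.Build R (poly3 R) (poly3 R) _ (ext T s sg) (ext_is_linear T s sg).

Lemma tr_tr s t sg p : clique cell s -> t != [::] -> {subset t <= s} ->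
  tr s sg (tr t sg p) = tr s sg p.
Proof.
move=> cs t0 ts; rewrite /tr -lift3_comp; apply: eq_lift3 => i n /=; rewrite /trace.
have [[-> ->]|[LHt e _]] := cap_sub i cs t0 ts; last by rewrite LHt.
by case: ifP => _ //=; rewrite tay_tay.
Qed.

Lemma tr_id k s sg p : degb (ebound k (cap cell s)) sg p -> tr s sg p = p.
Proof.
move=> dp; rewrite /tr -[RHS](lift3_id p) /tr.
apply: (eq_lift3_degb (L' := fun _ => idfun) dp) => i q; rewrite /ebound /trace; case: ifP => //= _.
  by move=> _; exact: pdeg_tay.
exact: tay_id.
Qed.

Lemma degb_tr k s t sg p : (0 < k)%N -> clique cell s -> t != [::] -> {subset t <= s} ->
  degb (ebound k (cap cell t)) sg p -> degb (ebound k (cap cell s)) sg (tr s sg p).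
Proof.
move=> k0 cs t0 ts dp; apply: (degb_lift3 dp) => i q; rewrite /ebound /trace.
have [[-> ->]|[LHt <- _]] := cap_sub i cs t0 ts; rewrite ?ltxx; last by move=> _; exact: pdeg_tay.
by case: ifP => _ //= _; exact: pdeg_tay.
Qed.

Lemma degb_ext k T s sg p : (3 <= k)%N -> s != [::] ->
  degb (ebound k (cap cell (T :: s))) sg p -> degb (ebound k (cap cell s)) sg (ext T s sg p).
Proof.
move=> k3 s0 dp; rewrite /ext; case: asboolP => [cTs|_]; last exact: degb0.
apply: (degb_lift3 dp) => i q; rewrite /ebound /exten.
have sub : {subset s <= T :: s} by move=> x xs; rewrite inE xs orbT.
have cs := clique_sub sub cTs.
case: (boolP (L s i < H s i)) => [LH|_]; last by move=> _; exact: pdeg_tay.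
case: (boolP (hi (cell T) 0 i <= L s i)) => [_ _|hT]; first exact: pdeg_herm.
case: (boolP (H s i <= lo (cell T) 0 i)) => [_ _|lT]; first exact: pdeg_herm.
have [U Us _] := cap_lo_ex cell i s0; have [U1 U2] := cap_free cs LH Us.
have [clt al] := mesh.
case: (al _ _ (cTs T U (mem_head _ _) (sub _ Us)) i) => [[e1 e2]|e|e].
- have [-> ->] := cap_cons_eq cTs LH (etrans e1 U1) (etrans e2 U2).
  by rewrite LH.
- by move: hT; rewrite e U1 lexx.
- by move: lT; rewrite -e U2 lexx.
Qed.

Lemma ext_id k T s sg p : clique cell s -> T \in s -> degb (ebound k (cap cell s)) sg p ->
  ext T s sg p = p.
Proof.
move=> cs Ts dp; have [clt _] := mesh; rewrite /ext asboolT; last first.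
  by apply: clique_sub cs => U; rewrite inE => /orP[/eqP->|].
rewrite -[RHS](lift3_id p).
have E i : exten (cell T) (cap cell s) sg i =1 trace (cap cell s) sg i.
  move=> q; rewrite /exten /trace; case: ifP => // LH; have [U1 U2] := cap_free cs LH Ts.
  by rewrite -U1 leNgt clt /= -U2 leNgt clt.
rewrite (eq_lift3 (L' := fun i => trace (cap cell s) sg i)); last by move=> *; exact: E.
by rewrite -/(tr s sg p) (tr_id dp) lift3_id.
Qed.

(** Extension is natural in the list. If [T] meets all of [s], both sides use the same jets; if it
    meets all of [t] but not all of [s], the right side is 0 by definition and the left side because
    Hermite extensions have zero jet at the far end. *)
Lemma tr_ext s t T sg p : clique cell s -> t != [::] -> {subset t <= s} ->
  tr s sg (ext T t sg p) = ext T s sg (tr (T :: s) sg p).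
Proof.
have [clt al] := mesh => cs t0 ts.
have s0 : s != [::] by case: t t0 ts => // U t _ /(_ U); case: s {cs} => // /(_ (mem_head _ _)).
have [V Vt _] := cap_lo_ex cell 0 t0; have Vs := ts _ Vt.
have sT : {subset s <= T :: s} by move=> x xs; rewrite inE xs orbT.
have ct := clique_sub ts cs.
rewrite /ext; case: asboolP => [cTt|nTt]; last first.
  rewrite raddf0 asboolF// => cTs; apply: nTt; apply: clique_sub cTs => x.
  by rewrite !inE => /orP[->//|/ts ->]; rewrite orbT.
have TV := cTt _ _ (mem_head _ _) (mem_behead (s := T :: t) Vt).
have V_free i : L t i < H t i -> lo (cell V) 0 i = L t i /\ hi (cell V) 0 i = H t i.
  by move=> LH; exact: cap_free.
case: asboolP => [cTs|nTs].
  rewrite /tr -!lift3_comp; apply: eq_lift3 => i n /=.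
  have TL := cap_lo cell i (mem_head T s); have TH := cap_hi cell i (mem_head T s).
  have cLH := cap_le i (isT : T :: s != [::]) cTs.
  have cL := cap_sub_lo i s0 sT; have cH := cap_sub_hi i s0 sT.
  rewrite /trace /exten; case: (cap_sub i cs t0 ts) => [[eL eH]|[LHt eLH Le]].
    rewrite -eL -eH; case: (boolP (L s i < H s i)) => [LH|nLH] /=; last first.
      case: (cap_sub i cTs s0 sT) => [[-> ->]|[LH _ _]]; last by rewrite LH in nLH.
      by rewrite (negbTE nLH).
    have [V1 V2] := V_free i (ltac:(by rewrite -eL -eH)); rewrite -eL in V1; rewrite -eH in V2.
    case: (al _ _ TV i) => [[e1 e2]|e|e].
    - have [-> ->] := cap_cons_eq cTs LH (etrans e1 V1) (etrans e2 V2).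
      by rewrite LH.
    - have hT : hi (cell T) 0 i = L s i by rewrite e V1.
      have cE : L (T :: s) i = L s i by apply/eqP; rewrite eq_le cL -hT (le_trans cLH TH).
      have cE' : H (T :: s) i = L s i by apply/eqP; rewrite eq_le -{1}hT TH -cE cLH.
      by rewrite cE cE' ltxx hT lexx /= herm_tay.
    - have lT : lo (cell T) 0 i = H s i by rewrite -e V2.
      have cE : H (T :: s) i = H s i by apply/eqP; rewrite eq_le cH -lT (le_trans TL cLH).
      have cE' : L (T :: s) i = H s i by apply/eqP; rewrite eq_le -{2}lT TL -cE cLH.
      by rewrite cE cE' ltxx lT lexx (leNgt (hi _ 0 i)) -{1}lT (lt_trans LH _) -?lT //= herm_tay.
  have cs_eq : L (T :: s) i = L s i /\ H (T :: s) i = H s i.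
    by case: (cap_sub i cTs s0 sT) => // -[LH]; rewrite eLH ltxx in LH.
  have [-> ->] := cs_eq; rewrite -eLH ltxx tay_tay LHt.
  rewrite cs_eq.1 in TL; rewrite cs_eq.2 -eLH in TH.
  have [V1 V2] := V_free i LHt.
  case: (al _ _ TV i) => [[e1 e2]|e|e].
  - by rewrite e2 V2 leNgt LHt e1 V1 /= leNgt LHt.
  - have hT : hi (cell T) 0 i = L t i by rewrite e V1.
    rewrite hT lexx; have -> : L s i = L t i by case: Le => // E; move: TH; rewrite hT E leNgt LHt.
    by rewrite tay_herm// lt_eqF.
  - have lT : lo (cell T) 0 i = H t i by rewrite -e V2.
    have hT : (hi (cell T) 0 i <= L t i) = false.
      by apply/negbTE; rewrite -ltNge (lt_trans LHt)// -lT.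
    rewrite hT lT lexx; have -> : L s i = H t i by case: Le => // E; move: TL; rewrite lT E leNgt LHt.
    by rewrite tay_herm// gt_eqF.
(* [T] misses a cell [U] of [s], hence misses it along some axis [i]. There [cap cell s] must be the
   endpoint of [cap cell t] that is away from [T]. *)
have [U Us nTU] : exists2 U, U \in s & ~ meets (cell T) (cell U).
  apply: contrapT => nex; apply: nTs => A B; rewrite !inE => /orP[/eqP->|As] /orP[/eqP->|Bs].
  - by move=> i; rewrite (ltW (clt T i)).
  - by apply: contrapT => nm; apply: nex; exists B.
  - apply: contrapT => nm; apply: nex; exists A => // m; apply: nm => i.
    by have [? ?] := m i.
  - exact: cs.
have [i nTUi] : exists i, ~ (lo (cell T) 0 i <= hi (cell U) 0 i /\ lo (cell U) 0 i <= hi (cell T) 0 i).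
  by apply: contrapT => nex; apply: nTU => i; apply: contrapT => h; apply: nex; exists i.
rewrite /tr -lift3_comp; apply: (lift3_eq0 (i := i)) => n /=.
have UL := cap_lo cell i Us; have UH := cap_hi cell i Us.
have TL := cap_lo cell i (mem_head T t); have TH := cap_hi cell i (mem_head T t).
have cLH := cap_le i (isT : T :: t != [::]) cTt.
have tT : {subset t <= T :: t} by move=> x xt; rewrite inE xt orbT.
have cL := cap_sub_lo i t0 tT; have cH := cap_sub_hi i t0 tT.
rewrite /trace /exten; case: (cap_sub i cs t0 ts) => [[eL eH]|[LHt eLH Le]].
  case: nTUi; split.
    by rewrite (le_trans TL)// (le_trans cLH)// (le_trans cH)// -eH.
  by rewrite (le_trans UL)// eL (le_trans cL)// (le_trans cLH).
have [V1 V2] := V_free i LHt.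
rewrite -eLH ltxx LHt; rewrite -eLH in UH.
case: (al _ _ TV i) => [[e1 e2]|e|e].
- case: nTUi; rewrite e1 e2 V1 V2; case: Le => E; rewrite -E; split=> //.
  + by rewrite (le_trans UL)// E ltW.
  + by rewrite (le_trans _ UH)// E ltW.
- have hT : hi (cell T) 0 i = L t i by rewrite e V1.
  rewrite hT lexx; case: Le => E; last by rewrite E tay_herm0// lt_eqF.
  case: nTUi; split; last by rewrite hT -E.
  by rewrite (le_trans (ltW (clt T i)))// hT -E.
- have lT : lo (cell T) 0 i = H t i by rewrite -e V2.
  have hT : (hi (cell T) 0 i <= L t i) = false.
    by apply/negbTE; rewrite -ltNge (lt_trans LHt)// -lT.
  rewrite hT lT lexx; case: Le => E; first by rewrite E tay_herm0// gt_eqF.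
  case: nTUi; split; first by rewrite lT -E.
  by rewrite (le_trans UL)// E -lT ltW.
Qed.

End AlignedMesh.

(** * De Rham complexes of piecewise polynomials *)

Lemma del_ind (A : eqType) (V : zmodType) (P : V -> Prop) (f : seq A -> V) s :
  P 0 -> (forall x y, P x -> P y -> P (x - y)) ->
  (forall t, (size t).+1 = size s -> {subset t <= s} -> P (f t)) -> P (del f s).
Proof.
move=> P0 PB; elim: s f => [//|x s IHs] f Pf /=; apply: PB.
  by apply: Pf => // y; rewrite inE orbC => ->.
apply: IHs => t st ts; apply: Pf => /=; first by rewrite st.
by move=> y; rewrite !inE => /orP[->//|/ts ->]; rewrite orbT.
Qed.

Section Rows.
Variables (R : realType) (I : finType) (cell : I -> box R) (k : nat).
Hypothesis mesh : aligned_mesh cell.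
Hypothesis k3 : (3 <= k)%N.
Implicit Types (s t : seq I) (sg : axis -> nat).

Local Notation deg s sg := (degb (ebound k (cap cell s)) sg).

Lemma clique_cons T s : clique cell s -> T \in s -> clique cell (T :: s).
Proof. by move=> cs Ts; apply: clique_sub cs => U; rewrite inE => /orP[/eqP->|]. Qed.

Lemma cap_perm s t i : s != [::] -> t != [::] -> clique cell s -> {subset s <= t} ->
  {subset t <= s} -> lo (cap cell s) 0 i = lo (cap cell t) 0 i /\
  hi (cap cell s) 0 i = hi (cap cell t) 0 i.
Proof.
move=> s0 t0 cs st ts; split; apply/eqP; rewrite eq_le.
  by rewrite !cap_sub_lo.
by rewrite !cap_sub_hi.
Qed.

Lemma del_tr s sg (y : seq I -> poly3 R) :
  del (fun t => tr cell s sg (y t)) s = tr cell s sg (del y s).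
Proof. exact: (del_raddf (tr cell s sg)). Qed.

(* The cells are treated one at a time: extending the value on T :: s from T
   corrects z on every list containing T, and changes nothing on the lists
   already corrected. *)
Lemma row_exact sg n (z : seq I -> poly3 R) : (0 < n)%N ->
  (forall s, size s = n.+1 -> clique cell s -> deg s sg (z s)) ->
  (forall s, size s = n.+2 -> clique cell s -> tr cell s sg (del z s) = 0) ->
  exists y, (forall s, size s = n -> clique cell s -> deg s sg (y s)) /\
    forall s, size s = n.+1 -> clique cell s -> z s = tr cell s sg (del y s).
Proof.
move=> n0 dz cz.
have size_neq0 m s : size s = m.+1 -> s != [::] by case: s.
have faces m s t : size s = m.+2 -> (size t).+1 = size s -> t != [::].
  by move=> -> [] /size_neq0.
suff [y [dy zy]] : exists y, (forall s, size s = n -> clique cell s -> deg s sg (y s)) /\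
    forall s, size s = n.+1 -> clique cell s -> has (mem (enum I)) s -> z s = tr cell s sg (del y s).
  exists y; split=> // s ss cs; apply: zy => //.
  by case: s ss {cs} => //= T s _; rewrite mem_enum.
elim: (enum I) => [|T l [y [dy zy]]].
  exists (fun=> 0); split; first by move=> *; exact: degb0.
  by move=> s _ _ /hasP[].
pose z' s := z s - tr cell s sg (del y s).
have dz' s : size s = n.+1 -> clique cell s -> deg s sg (z' s).
  move=> ss cs; apply: degbB; first exact: dz.
  rewrite /= -del_tr; apply: del_ind => [||t st ts]; first exact: degb0.
    by move=> *; exact: degbB.
  have tn : size t = n by move: st; rewrite ss => -[].
  apply: (degb_tr mesh (ltn_trans (isT : 0 < 2)%N k3) cs _ ts).
    by apply/eqP => t0; move: n0; rewrite -tn t0.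
  by apply: dy => //; exact: clique_sub cs.
have cz' s : size s = n.+2 -> clique cell s -> tr cell s sg (del z' s) = 0.
  move=> ss cs; rewrite delB raddfB /= cz// sub0r -del_tr.
  rewrite (eq_del (g := fun t => tr cell s sg (del y t))); last first.
    by move=> t st ts; rewrite (tr_tr mesh)//; apply: faces st; exact: ss.
  by rewrite del_tr del_del raddf0 oppr0.
pose yT s := ext cell T s sg (z' (T :: s)).
exists (fun s => y s + yT s); split=> [s ss cs|s ss cs].
  apply: degbD; first exact: dy.
  rewrite /yT; have [cTs|nTs] := pselect (clique cell (T :: s)); last first.
    by rewrite /ext asboolF//; exact: degb0.
  apply: (degb_ext mesh) => //; first by apply/eqP => s0; move: n0; rewrite -ss s0.
  by apply: dz' => //=; rewrite ss.
(* The cocycle condition on [T :: s] says that the coboundary of [z' (T :: t)] over the faces t of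
   [s] has the trace of [z' s]. With [tr_ext], prepending [T] and extending is therefore a
   contracting homotopy. *)
have key : tr cell s sg (del yT s) = ext cell T s sg (tr cell (T :: s) sg (z' s)).
  rewrite -del_tr (eq_del (g := fun t => ext cell T s sg (tr cell (T :: s) sg (z' (T :: t))))).
    rewrite (del_raddf (ext cell T s sg) (fun t => tr cell (T :: s) sg (z' (T :: t)))).
    rewrite (del_raddf (tr cell (T :: s) sg) (fun t => z' (T :: t))).
    have [cTs|nTs] := pselect (clique cell (T :: s)); last by rewrite /= /ext (asboolF nTs).
    have := cz' (T :: s); rewrite /= ss => /(_ erefl cTs); rewrite raddfB => /eqP.
    by rewrite subr_eq0 => /eqP ->.
  move=> t st ts; apply: (tr_ext mesh) => //.
  by apply/eqP => t0; move: st n0; rewrite ss t0 => -[<-].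
rewrite delD raddfD /= key => hTl.
have [Ts|nTs] := boolP (T \in s); last first.
  have hl : has (mem l) s.
    move: hTl => /hasP[x xs]; rewrite inE => /orP[/eqP xT|xl]; last by apply/hasP; exists x.
    by move: nTs; rewrite -xT xs.
  have z'0 : z' s = 0 by rewrite /z' {1}zy// subrr.
  by rewrite z'0 !raddf0 addr0; apply: zy.
have sne : s != [::] by apply: size_neq0 ss.
have cTs := clique_cons cs Ts.
have capE i : lo (cap cell s) 0 i = lo (cap cell (T :: s)) 0 i /\
    hi (cap cell s) 0 i = hi (cap cell (T :: s)) 0 i.
  apply: cap_perm => // x; rewrite inE; first by move=> ->; rewrite orbT.
  by move=> /orP[/eqP->|].
rewrite (@tr_id _ _ cell k (T :: s)); last first.
  apply: (eq_degb _ _ (dz' _ ss cs)) => // i; rewrite /ebound.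
  by have [-> ->] := capE i.
have -> : ext cell T s sg (z' s) = z' s by apply: (ext_id mesh (k := k)) => //; exact: dz'.
by rewrite /z' addrC subrK.
Qed.


(** * Polynomial differential forms and the Poincare lemma *)

(* A form with polynomial coefficients; w x y z is the coefficient of the
   product of those of dx_0, dx_1, dx_2 whose flag is set, in this order. *)
Definition form := bool -> bool -> bool -> poly3 R.

Definition dform (w : form) : form := fun x y z =>
  (if x then partial ax0 (w false y z) else 0) +
  (if y then (if x then - partial ax1 (w x false z) else partial ax1 (w x false z)) else 0) +
  (if z then (if x (+) y then - partial ax2 (w x y false) else partial ax2 (w x y false)) else 0).

(** Carrying [dx_i] costs one degree and one matching derivative in [x_i], as a derivative in [x_i]
    does; [dform] thus respects these indices. *)
Definition fdeg (b : axis -> nat) (x y z : bool) : axis -> nat :=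
  fun i => (b i + (if i == ax0 then x else if i == ax1 then y else z))%N.

Definition prim_in i (p : poly3 R) := lift i (@prim R) p.
Definition ev_in i (p : poly3 R) := lift i (ev (0 : R)) p.

(** Integration from the origin along axis 0, then along axis 1 in the plane x_0 = 0, then along
    axis 2 on the line x_0 = x_1 = 0. The origin may lie outside the box, since the coefficients are
    polynomials on the whole space. *)
Definition hform (w : form) : form := fun x y z =>
  if x then 0 else prim_in ax0 (w true y z) +
  (if y then 0 else prim_in ax1 (ev_in ax0 (w false true z)) +
  (if z then 0 else prim_in ax2 (ev_in ax1 (ev_in ax0 (w false false true))))).

Lemma partial_prim i p : partial i (prim_in i p) = p.
Proof.
rewrite lift_partial /prim_in -lift_comp -[RHS](lift_id i).
by apply: eq_lift => n /=; rewrite deriv_prim.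
Qed.

Lemma prim_partial i p : prim_in i (partial i p) = p - ev_in i p.
Proof.
rewrite lift_partial /prim_in -lift_comp -{2}(lift_id i p) -liftB.
by apply: eq_lift => n /=; rewrite prim_deriv.
Qed.

Lemma partial_ev i p : partial i (ev_in i p) = 0.
Proof.
rewrite lift_partial /ev_in -lift_comp -[RHS](lift0 i p).
by apply: eq_lift => n /=; rewrite evE derivC.
Qed.

Lemma partial_primC i j p : i != j -> partial i (prim_in j p) = prim_in j (partial i p).
Proof. by move=> ij; rewrite !lift_partial /prim_in liftC. Qed.

Lemma partial_evC i j p : i != j -> partial i (ev_in j p) = ev_in j (partial i p).
Proof. by move=> ij; rewrite !lift_partial /ev_in liftC. Qed.

Lemma prim_evC i j p : i != j -> prim_in i (ev_in j p) = ev_in j (prim_in i p).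
Proof. by move=> ij; rewrite /prim_in /ev_in liftC. Qed.

Lemma prim_in_linear i : linear (prim_in i).
Proof. by move=> a x y; rewrite /prim_in linearP. Qed.

HB.instance Definition _ i :=
  GRing.isLinear.Build R (poly3 R) (poly3 R) _ (prim_in i) (prim_in_linear i).

Lemma ev_in_linear i : linear (ev_in i).
Proof. by move=> a x y; rewrite /ev_in linearP. Qed.

HB.instance Definition _ i :=
  GRing.isLinear.Build R (poly3 R) (poly3 R) _ (ev_in i) (ev_in_linear i).

Lemma partial_linear i : linear (@partial R i).
Proof. by move=> a x y; rewrite /partial linearP. Qed.

HB.instance Definition _ i :=
  GRing.isLinear.Build R (poly3 R) (poly3 R) _ (@partial R i) (partial_linear i).

Lemma partialC i j (p : poly3 R) : partial i (partial j p) = partial j (partial i p).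
Proof. exact: mderiv_comm. Qed.

Lemma poincare (w : form) : (forall x y z, dform w x y z = 0) ->
  forall x y z, w x y z = dform (hform w) x y z +
    (if [|| x, y | z] then 0 else ev_in ax2 (ev_in ax1 (ev_in ax0 (w false false false)))).
Proof.
move=> cl.
have c100 := cl true false false; have c010 := cl false true false.
have c001 := cl false false true; have c110 := cl true true false.
have c101 := cl true false true; have c011 := cl false true true.
have c111 := cl true true true; rewrite /dform /= ?(addr0, add0r) in c100 c010 c001 c110 c101 c011 c111.
move/subr0_eq in c110; move/subr0_eq in c101; move/subr0_eq in c011.
have pp i j p : i != j -> partial i (prim_in j (ev_in i p)) = 0.
  by move=> ij; rewrite partial_primC// partial_ev raddf0.
have pe i p : partial i p = 0 -> ev_in i p = p.
  by move=> h; have := prim_partial i p; rewrite h raddf0 => /esym/subr0_eq/esym.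
case; case; case; rewrite /dform /hform /= ?(addr0, add0r) ?raddf0 ?(addr0, subr0) ?raddfD /=
  ?partial_prim //.
- by rewrite pp// addr0.
- by rewrite pp// prim_evC// partial_evC// partial_primC// partial_ev !raddf0 !addr0.
- have := congr1 (prim_in ax0) c111; rewrite raddf0 raddfD raddfB /= prim_partial.
  by rewrite !(@partial_primC _ ax0)// => h; apply/eqP; rewrite -subr_eq0 -h; apply/eqP; ring.
- by rewrite partial_primC// -c110 prim_partial pp// addr0 subrK.
- rewrite partial_primC// -c101 prim_partial partial_primC// partial_evC// -c011.
  by rewrite -partial_evC// prim_partial; ring.
- by rewrite !pe.
Qed.

Lemma closed_const (p : poly3 R) : (forall i, partial i p = 0) ->
  p = mpolyC 3 (mcoeff (@mnm0 3) p).
Proof.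
move=> dp; apply/mpolyP => m; rewrite mcoeffC.
have [->|m0] := eqVneq m (@mnm0 3); first by rewrite mulr1.
rewrite mulr0.
have [i mi] : exists i, m i != 0%N.
  apply: contrapT => nex; move/eqP: m0; apply; apply/mnmP => i; rewrite mnm0E.
  by apply: contrapT => /eqP h; apply: nex; exists i.
have /(congr1 (mcoeff (mnm_sub m (mnm1 i)))) := dp i; rewrite mcoeff_deriv mcoeff0.
have -> : mnm_add (mnm_sub m (mnm1 i)) (mnm1 i) = m by apply: submK; rewrite lep1mP.
by move/eqP; rewrite mulrn_eq0 => /eqP.
Qed.

Lemma tr_partial s sg sg' i p : sg' i = (sg i).+1 -> (forall j, j != i -> sg' j = sg j) ->
  tr cell s sg' (partial i p) = partial i (tr cell s sg p).
Proof.
move=> si sj; rewrite !lift_partial /tr; apply/esym; apply: lift3_intertwine.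
  by move=> n; rewrite /trace; case: ifP => _ //=; rewrite si; exact: deriv_tay.
by move=> j n ji; rewrite /trace sj.
Qed.

Lemma tr_dform s b (w : form) x y z :
  tr cell s (fdeg b x y z) (dform w x y z) =
  dform (fun x y z => tr cell s (fdeg b x y z) (w x y z)) x y z.
Proof.
have t0 u v p : tr cell s (fdeg b true u v) (partial ax0 p) =
    partial ax0 (tr cell s (fdeg b false u v) p).
  by apply: tr_partial; rewrite /fdeg ?addn1 ?addn0//; elim/axisP.
have t1 u v p : tr cell s (fdeg b u true v) (partial ax1 p) =
    partial ax1 (tr cell s (fdeg b u false v) p).
  by apply: tr_partial; rewrite /fdeg ?addn1 ?addn0//; elim/axisP.
have t2 u v p : tr cell s (fdeg b u v true) (partial ax2 p) =
    partial ax2 (tr cell s (fdeg b u v false) p).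
  by apply: tr_partial; rewrite /fdeg ?addn1 ?addn0//; elim/axisP.
by case: x y z => -[] []; rewrite /dform /= !raddfD /= ?raddfN /= ?t0 ?t1 ?t2 ?raddf0.
Qed.

Lemma del_dform s (z : bool -> bool -> bool -> seq I -> poly3 R) x y u :
  del (fun t => dform (fun x y u => z x y u t) x y u) s =
  dform (fun x y u => del (z x y u) s) x y u.
Proof.
have dp i a c d : del (fun t => partial i (z a c d t)) s = partial i (del (z a c d) s).
  exact: (del_raddf (@partial R i)).
rewrite /dform !delD; congr (_ + _ + _).
- by case: x; rewrite ?del0.
- by case: y; case: x; rewrite ?delN ?del0 ?dp.
- by case: u; case: (x (+) y); rewrite ?delN ?del0 ?dp.
Qed.

Lemma dform_dform (w : form) x y z : dform (dform w) x y z = 0.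
Proof.
case: x y z => -[] []; rewrite /dform /= ?(addr0, add0r) ?raddf0 ?raddfD /= ?raddfN /= ?raddf0;
  rewrite ?(partialC ax1 ax0) ?(partialC ax2 ax0) ?(partialC ax2 ax1); ring.
Qed.

Lemma eq_dform (w w' : form) : (forall x y z, w x y z = w' x y z) ->
  forall x y z, dform w x y z = dform w' x y z.
Proof. by move=> ww x y z; rewrite /dform !ww. Qed.

Lemma dformB (w w' : form) x y z :
  dform (fun x y z => w x y z - w' x y z) x y z = dform w x y z - dform w' x y z.
Proof.
by case: x y z => -[] []; rewrite /dform /= ?raddfB /=; ring.
Qed.

Definition hom (q : nat) (w : form) := forall x y z : bool, (x + y + z)%N != q -> w x y z = 0.

Lemma hom_hform q w : hom q.+1 w -> hom q (hform w).
Proof.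
move=> hw [] y z yz; rewrite /hform//=.
rewrite hw ?raddf0 ?add0r; last by move: yz; case: y z => -[].
case: y yz => // yz; rewrite hw ?raddf0 ?add0r; last by move: yz; case: z.
by case: z yz => // yz; rewrite hw ?raddf0.
Qed.

Lemma hom_dform q w : hom q w -> hom q.+1 (dform w).
Proof.
move=> hw x y z xyz; rewrite /dform.
case: x y z xyz => -[] [] xyz /=; rewrite ?(addr0, add0r)// ?hw ?raddf0 ?oppr0 ?addr0//;
  by move: xyz; rewrite ?addnE.
Qed.

Definition form_deg K b (w : form) := forall x y z, degb K (fdeg b x y z) (w x y z).

Lemma form_deg_hform K b w : form_deg K b w -> form_deg K b (hform w).
Proof.
move=> dw.
have dp0 y z p : degb K (fdeg b true y z) p -> degb K (fdeg b false y z) (prim_in ax0 p).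
  move=> dp; apply: (degb_lift dp); first by elim/axisP.
  by move=> q; rewrite /fdeg /= addn1 addn0; exact: pdeg_prim.
have dp1 x z p : degb K (fdeg b x true z) p -> degb K (fdeg b x false z) (prim_in ax1 p).
  move=> dp; apply: (degb_lift dp); first by elim/axisP.
  by move=> q; rewrite /fdeg /= addn1 addn0; exact: pdeg_prim.
have dp2 x y p : degb K (fdeg b x y true) p -> degb K (fdeg b x y false) (prim_in ax2 p).
  move=> dp; apply: (degb_lift dp); first by elim/axisP.
  by move=> q; rewrite /fdeg /= addn1 addn0; exact: pdeg_prim.
have de i sg p : degb K sg p -> degb K sg (ev_in i p).
  by move=> dp; apply: (degb_lift dp) => // q; exact: pdeg_ev.
case=> y z; rewrite /hform; first exact: degb0.
apply: degbD; first exact: dp0.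
case: y; first exact: degb0.
apply: degbD; first by apply/dp1/de.
case: z; first exact: degb0.
by apply/dp2/de/de.
Qed.

Lemma form_deg_dform K b w : form_deg K b w -> form_deg K b (dform w).
Proof.
move=> dw.
have dp i sg sg' p : degb K sg p -> sg' i = (sg i).+1 -> (forall j, j != i -> sg' j = sg j) ->
    degb K sg' (partial i p).
  move=> dsp si sj; rewrite lift_partial; apply: (degb_lift dsp) => [j ji|q]; first by rewrite sj.
  by rewrite si; exact: pdeg_deriv.
have d0 y z : degb K (fdeg b true y z) (partial ax0 (w false y z)).
  by apply: dp (dw _ _ _) _ _; rewrite /fdeg ?addn1 ?addn0//; elim/axisP.
have d1 x z : degb K (fdeg b x true z) (partial ax1 (w x false z)).
  by apply: dp (dw _ _ _) _ _; rewrite /fdeg ?addn1 ?addn0//; elim/axisP.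
have d2 x y : degb K (fdeg b x y true) (partial ax2 (w x y false)).
  by apply: dp (dw _ _ _) _ _; rewrite /fdeg ?addn1 ?addn0//; elim/axisP.
move=> x y z; apply: degbD; first apply: degbD.
- by case: x; [exact: d0|exact: degb0].
- by case: y; [case: x; [apply: degbN|]; exact: d1|exact: degb0].
- by case: z; [case: (x (+) y); [apply: degbN|]; exact: d2|exact: degb0].
Qed.

End Rows.

(** * The Cech-de Rham double complex *)

Section DeRham.
Variables (R : realType) (I : finType) (cell : I -> box R) (k : nat).
Hypothesis mesh : aligned_mesh cell.
Hypothesis k3 : (3 <= k)%N.
Hypothesis nerve : forall n (f : seq I -> R),
  (forall s, size s = n.+1 -> clique cell s -> del f s = 0) ->
  exists g, forall s, size s = n -> clique cell s -> f s = del g s.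
Variable b : axis -> nat.
Hypothesis b1 : forall i, (b i <= 1)%N.
Implicit Types (s t : seq I).

Definition cochain := bool -> bool -> bool -> seq I -> poly3 R.

Local Notation at_ z s := (fun x y u => z x y u s).

Definition cform (c : R) : form R := fun x y u => if [|| x, y | u] then 0 else mpolyC 3 c.

Lemma dform_cform c x y u : dform (cform c) x y u = 0.
Proof.
by case: x y u => -[] []; rewrite /dform /cform /partial /= ?mderivC ?mderiv0 ?oppr0 ?addr0.
Qed.

(** Here [b i <= 1] matters: along a degenerate axis the degree bound is 1 - b i, so index 2 would
    leave only 0 and no constants. *)
Lemma degb_cform s c : form_deg (ebound k (cap cell s)) b (cform c).
Proof.
move=> x y u; rewrite /cform; case: ifP => [_|/norP[/negbTE-> /norP[/negbTE-> /negbTE->]]].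
  exact: degb0.
move=> m; rewrite msuppC; case: eqP => // _; rewrite inE => /eqP-> i.
rewrite mnm0E add0n /fdeg; have := b1 i; rewrite /ebound.
by case: ifP => _; case: ifP => _; (try case: ifP => _); move: k3; lia.
Qed.

Definition closed_at q n (z : cochain) := forall s, size s = n -> clique cell s ->
  [/\ form_deg (ebound k (cap cell s)) b (at_ z s), hom q (at_ z s) &
     forall x y u, dform (at_ z s) x y u = 0].

Definition primitive_at q n (w z : cochain) := forall s, size s = n -> clique cell s ->
  [/\ form_deg (ebound k (cap cell s)) b (at_ w s), hom q (at_ w s) &
     forall x y u, z x y u s = dform (at_ w s) x y u].

(** On a list of two cells this is the jump of the jets across their common box. *)
Definition cech (z : cochain) : cochain := fun x y u s =>
  tr cell s (fdeg b x y u) (del (z x y u) s).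

Definition cocycle_at n (z : cochain) := forall s, size s = n -> clique cell s ->
  forall x y u, cech z x y u s = 0.

Lemma primitive_exists q n (z : cochain) : closed_at q.+1 n z ->
  exists w, primitive_at q n w z.
Proof.
move=> zP; exists (fun x y u s => hform (at_ z s) x y u) => s ss cs.
have [dz hz cz] := zP s ss cs; split; [exact: form_deg_hform|exact: hom_hform|].
by move=> x y u; rewrite (poincare cz) hz// !raddf0 if_same addr0.
Qed.

Lemma cech_closed q n (w z : cochain) : (0 < n)%N -> primitive_at q n w z ->
  cocycle_at n.+1 z -> closed_at q n.+1 (cech w).
Proof.
move=> n0 wP zc s ss cs.
have face t : (size t).+1 = size s -> {subset t <= s} -> [/\ size t = n, clique cell t & t != [::]].
  rewrite ss => -[tn] ts; split=> //; first exact: clique_sub cs.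
  by apply/eqP => t0; move: n0; rewrite -tn t0.
split=> [x y u|x y u xyu|x y u].
- rewrite /cech -del_tr; apply: del_ind => [||t st ts]; [exact: degb0|by move=> *; exact: degbB|].
  have [tn ct t0] := face t st ts; have [dw _ _] := wP t tn ct.
  by apply: (degb_tr mesh (ltn_trans (isT : 0 < 2)%N k3) cs t0 ts); exact: dw.
- rewrite /cech (eq_del (g := fun=> 0)) ?del0 ?raddf0// => t st ts.
  by have [tn ct _] := face t st ts; have [_ hw _] := wP t tn ct; exact: hw.
rewrite /cech -tr_dform -del_dform -[RHS](zc s ss cs x y u); congr (tr _ _ _ _).
apply: eq_del => t st ts; have [tn ct _] := face t st ts.
by have [_ _ ->] := wP t tn ct.
Qed.

Lemma cech_cech n (w : cochain) : cocycle_at n.+2 (cech w).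
Proof.
move=> s ss cs x y u; rewrite /cech -del_tr.
rewrite (eq_del (g := fun t => tr cell s (fdeg b x y u) (del (w x y u) t))).
  by rewrite del_tr del_del raddf0.
move=> t st ts; rewrite (tr_tr mesh)//.
by apply/eqP => t0; move: st; rewrite ss t0.
Qed.

Lemma const_coboundary n (z : cochain) : closed_at 0 n.+1 z -> cocycle_at n.+2 z ->
  exists g, forall s, size s = n.+1 -> clique cell s -> forall x y u,
    z x y u s = cform (del g s) x y u.
Proof.
move=> zP zc; pose c s := mcoeff (@mnm0 3) (z false false false s).
have zE s : size s = n.+1 -> clique cell s -> z false false false s = mpolyC 3 (c s).
  move=> ss cs; have [_ _ cz] := zP s ss cs; apply: closed_const.
  have := cz true false false; have := cz false true false; have := cz false false true.
  by rewrite /dform /= ?(add0r, addr0) => h2 h1 h0; elim/axisP.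
have [|g gP] := nerve (n := n.+1) (f := c).
  move=> s ss cs; have := zc s ss cs false false false; rewrite /cech.
  rewrite (eq_del (g := fun t => mpolyC 3 (c t))); last first.
    move=> t st ts; apply: zE; first by move: st; rewrite ss => -[].
    exact: clique_sub cs.
  rewrite (del_raddf (@mpolyC 3 R) c) (tr_id (k := k)).
    by move/(congr1 (mcoeff (@mnm0 3))); rewrite mcoeff0 mcoeffC eqxx mulr1.
  exact: (@degb_cform s (del c s) false false false).
exists g => s ss cs x y u; have [_ hz _] := zP s ss cs; rewrite /cform.
case: ifP => [xyu|/norP[/negbTE-> /norP[/negbTE-> /negbTE->]]].
  by apply: hz; move: xyu; case: x y u => -[] [].
by rewrite zE// gP.
Qed.

Lemma cech_rows q n (z : cochain) : (0 < n)%N ->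
  (forall s, size s = n.+1 -> clique cell s ->
     form_deg (ebound k (cap cell s)) b (at_ z s) /\ hom q (at_ z s)) ->
  cocycle_at n.+2 z -> exists Y : cochain,
  (forall s, size s = n -> clique cell s ->
     form_deg (ebound k (cap cell s)) b (at_ Y s) /\ hom q (at_ Y s)) /\
  (forall s, size s = n.+1 -> clique cell s -> forall x y u, z x y u s = cech Y x y u s).
Proof.
move=> n0 zP zc.
have row (c : bool * bool * bool) : exists y : seq I -> poly3 R, let: (x, y', u) := c in
    (forall s, size s = n -> clique cell s -> degb (ebound k (cap cell s)) (fdeg b x y' u) (y s) /\
       ((x + y' + u)%N != q -> y s = 0)) /\
    (forall s, size s = n.+1 -> clique cell s ->
       z x y' u s = tr cell s (fdeg b x y' u) (del y s)).
  move: c => [[x y'] u]; have [xyu|xyu] := eqVneq (x + y' + u)%N q; last first.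
    exists (fun=> 0); split=> s ss cs; first by split=> //; exact: degb0.
    by have [_ hz] := zP s ss cs; rewrite del0 raddf0; exact: hz.
  have [||y [dy zy]] := row_exact mesh k3 (sg := fdeg b x y' u) (z := z x y' u) n0.
  - by move=> s ss cs; have [dz _] := zP s ss cs; exact: dz.
  - by move=> s ss cs; exact: zc.
  by exists y; split=> // s ss cs; split=> //; exact: dy.
have [Y YP] := choice row.
exists (fun x y u s => Y (x, y, u) s); split=> s ss cs; last first.
  by move=> x y u; have [_ ->] := YP (x, y, u).
by split=> x y u; have [/(_ s ss cs)[? ?] _] := YP (x, y, u).
Qed.

(* Induction on the form degree q of the primitive: each step trades one form
   degree for one more cell, until only constants on the nerve are left. *)
Lemma zigzag q n (z : cochain) : (0 < n)%N -> closed_at q.+1 n z -> cocycle_at n.+1 z ->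
  exists2 w, primitive_at q n w z & cocycle_at n.+1 w.
Proof.
elim: q n z => [|q IHq] n z n0 zP zc; have [p pP] := primitive_exists zP;
  have cP := cech_closed n0 pP zc; have cc := @cech_cech n p.
(* The Cech coboundary of [p] is closed of form degree 0, hence consists of constants; these bound
   on the nerve, and subtracting a bounding cochain turns [p] into a cocycle. *)
- have [g gP] := const_coboundary cP cc.
  exists (fun x y u s => p x y u s - cform (g s) x y u) => s ss cs.
    have [dp hp zE] := pP s ss cs; split=> [x y u|x y u xyu|x y u].
    + by apply: degbB; [exact: dp|exact: degb_cform].
    + rewrite hp// /cform ifT ?subrr//; by move: xyu; case: x y u => -[] [].
    + by rewrite dformB dform_cform subr0.
  move=> x y u; rewrite /cech delB raddfB /=; have := gP s ss cs x y u; rewrite /cech => ->.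
  have -> : del (fun t => cform (g t) x y u) s = cform (del g s) x y u.
    rewrite /cform; case: ifP => _; first by rewrite del0.
    exact: (del_raddf (@mpolyC 3 R) g).
  by rewrite (tr_id (k := k)) ?subrr//; exact: degb_cform.
have [w wP wc] := IHq n.+1 (cech p) isT cP cc.
have [Y [YP YE]] : exists Y : cochain,
  (forall s, size s = n -> clique cell s ->
     form_deg (ebound k (cap cell s)) b (at_ Y s) /\ hom q (at_ Y s)) /\
  (forall s, size s = n.+1 -> clique cell s -> forall x y u, w x y u s = cech Y x y u s).
  apply: cech_rows => //.
  by move=> s ss cs; have [dw hw _] := wP s ss cs; split.
(* Since [cech p] is d w and [w] is [cech Y], the Cech coboundary of p - d Y is d w - d (cech Y) =
   0, while its differential is still [z]. *)
exists (fun x y u s => p x y u s - dform (at_ Y s) x y u) => s ss cs.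
  have [dp hp zE] := pP s ss cs; have [dY hY] := YP s ss cs; split=> [x y u|x y u xyu|x y u].
  - by apply: degbB; [exact: dp|exact: form_deg_dform].
  - by rewrite hp// (hom_dform hY)// subrr.
  - by rewrite dformB dform_dform subr0.
move=> x y u; rewrite /cech delB raddfB /= del_dform tr_dform.
have [_ _ wE] := wP s ss cs; rewrite -/(cech p x y u s) wE.
by apply/eqP; rewrite subr_eq0; apply/eqP/eq_dform => x' y' u'; exact: YE.
Qed.

End DeRham.

Lemma ax_cyc : (ax0 + 1 = ax1) * (ax1 + 1 = ax2) * (ax2 + 1 = ax0) *
  (ax0 - 1 = ax2) * (ax1 - 1 = ax0) * (ax2 - 1 = ax1).
Proof. by do !split; exact: val_inj. Qed.

Lemma sum_axis (V : zmodType) (F : axis -> V) : \sum_i F i = F ax0 + (F ax1 + F ax2).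
Proof.
rewrite !big_ord_recl big_ord0 addr0; congr (F _ + (F _ + F _)); exact: val_inj.
Qed.

(** * Conforming spaces and global exactness *)

(** Indices of the coefficient of [dx_i] in a 1-form; [upn] is for 2-forms, labelled by the axis [i]
    whose differential is missing. *)
Definition up (b : axis -> nat) (i : axis) : axis -> nat := fun j => (b j + (j == i))%N.
Definition upn (b : axis -> nat) (i : axis) : axis -> nat := fun j => (b j + (j != i))%N.

(* Piecewise polynomials of degree at most k - sg i in x_i, with 2 - sg i
   derivatives (counting the value) in x_i agreeing across interfaces. *)
Definition conforming (R : realType) (I : finType) (cell : I -> box R) (k : nat)
    (sg : axis -> nat) (v : I -> poly3 R) : Prop :=
  (forall T, degb (fun=> k) sg (v T)) /\
  forall T T', meets (cell T) (cell T') ->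
    tr cell [:: T; T'] sg (v T) = tr cell [:: T; T'] sg (v T').

Section Global.
Variables (R : realType) (I : finType) (cell : I -> box R) (k : nat).
Hypothesis mesh : aligned_mesh cell.
Hypothesis k3 : (3 <= k)%N.
Implicit Types (sg b : axis -> nat) (v w : I -> poly3 R).

Local Notation S := (conforming cell k).

Lemma conforming0 sg : S sg (fun=> 0).
Proof. by split=> // T; exact: degb0. Qed.

Lemma conformingD sg v w : S sg v -> S sg w -> S sg (fun T => v T + w T).
Proof.
move=> [dv cv] [dw cw]; split=> [T|T T' m]; first exact: degbD.
by rewrite !raddfD /= cv// cw.
Qed.

Lemma conformingN sg v : S sg v -> S sg (fun T => - v T).
Proof.
move=> [dv cv]; split=> [T|T T' m]; first exact: degbN.
by rewrite !raddfN /= cv.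
Qed.

Lemma conformingB sg v w : S sg v -> S sg w -> S sg (fun T => v T - w T).
Proof. by move=> Sv Sw; apply: conformingD => //; exact: conformingN. Qed.

Lemma eq_tr s sg sg' p : sg =1 sg' -> tr cell s sg p = tr cell s sg' p.
Proof. by move=> e; apply: eq_lift3 => i n; rewrite /trace e. Qed.

Lemma eq_conforming sg sg' v : sg =1 sg' -> S sg v -> S sg' v.
Proof.
move=> e [dv cv]; split=> [T|T T' m]; first exact: eq_degb (dv T).
by rewrite -!(eq_tr _ _ e) cv.
Qed.

Lemma conforming_partial sg i v : S sg v -> S (up sg i) (fun T => partial i (v T)).
Proof.
move=> [dv cv]; split=> [T|T T' m].
  rewrite lift_partial; apply: (degb_lift (dv T)) => [j ji|q].
    by rewrite /up (negbTE ji) addn0.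
  by rewrite /up eqxx addn1; exact: pdeg_deriv.
rewrite !(@tr_partial _ _ _ _ sg) ?cv// /up ?eqxx ?addn1// => j /negbTE->; exact: addn0.
Qed.

Lemma clique_pair T T' : meets (cell T) (cell T') -> clique cell [:: T; T'].
Proof.
have [clt _] := mesh => m U U'; rewrite !inE => /orP[]/eqP-> /orP[]/eqP-> //.
- by move=> i; rewrite ltW.
- by move=> i; have [? ?] := m i.
- by move=> i; rewrite ltW.
Qed.

Lemma ebound_cell T i : ebound k (cap cell [:: T]) i = k.
Proof. by have [clt _] := mesh; rewrite /ebound /= !mxE /= clt. Qed.

Hypothesis nerve : forall n (f : seq I -> R),
  (forall s, size s = n.+1 -> clique cell s -> del f s = 0) ->
  exists g, forall s, size s = n -> clique cell s -> f s = del g s.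
Variable b : axis -> nat.
Hypothesis b1 : forall i, (b i <= 1)%N.

(** The case of lists of one cell in [zigzag]: there a cochain is a piecewise field, and being a
    Cech cocycle is conformity. *)
Lemma de_rham q (W : bool -> bool -> bool -> I -> poly3 R) :
  (forall x y u, S (fdeg b x y u) (W x y u)) ->
  (forall T, hom q.+1 (fun x y u => W x y u T)) ->
  (forall T x y u, dform (fun x y u => W x y u T) x y u = 0) ->
  exists U : bool -> bool -> bool -> I -> poly3 R,
    [/\ forall x y u, S (fdeg b x y u) (U x y u),
        forall T, hom q (fun x y u => U x y u T) &
        forall T x y u, W x y u T = dform (fun x y u => U x y u T) x y u].
Proof.
move=> SW hW cW.
pose z : cochain R I := fun x y u s => if s is T :: _ then W x y u T else 0.
have degE T p sg : degb (ebound k (cap cell [:: T])) sg p <-> degb (fun=> k) sg p.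
  by split; apply: eq_degb => // i; rewrite ebound_cell.
have [|s|w wP wc] := zigzag mesh k3 nerve b1 (q := q) (n := 1) (z := z) isT.
- case=> [//|T []// _ _]; split=> [x y u||]; [|exact: hW|exact: cW].
  by apply/degE; have [dW _] := SW x y u; exact: dW.
- case: s => [//|T [//|T' []//]] _ cs x y u.
  have [_ cWS] := SW x y u; rewrite /cech /= subr0 raddfB /= cWS ?subrr//.
  by apply: cs; rewrite !inE eqxx ?orbT.
have c1 T : clique cell [:: T].
  by have [clt _] := mesh => U U'; rewrite !inE => /eqP-> /eqP-> i; rewrite ltW.
exists (fun x y u T => w x y u [:: T]); split=> [x y u|T|T x y u].
- split=> [T|T T' m].
    by have [dw _ _] := wP [:: T] erefl (c1 T); apply/degE; exact: dw.
  have := wc [:: T; T'] erefl (clique_pair m) x y u; rewrite /cech /= subr0 raddfB /=.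
  by move/eqP; rewrite subr_eq0 eq_sym => /eqP.
- by have [_ hw _] := wP [:: T] erefl (c1 T).
by have [_ _ <-] := wP [:: T] erefl (c1 T).
Qed.

Lemma grad_const v : S b v -> (forall i T, partial i (v T) = 0) ->
  exists c, forall T, v T = mpolyC 3 c.
Proof.
move=> [dv cv] v0; pose c T := mcoeff (@mnm0 3) (v T).
have vE T : v T = mpolyC 3 (c T) by apply: closed_const => i; exact: v0.
have [clt _] := mesh.
have [|g gP] := nerve (n := 1) (f := fun s => if s is T :: _ then c T else 0).
  case=> [//|T [//|T' []//]] _ cs /=; rewrite subr0; apply/eqP; rewrite subr_eq0; apply/eqP.
  have m : meets (cell T) (cell T') by apply: cs; rewrite !inE eqxx ?orbT.
  have := cv _ _ m; rewrite !vE !(@tr_id _ _ _ k).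
  + by move/(congr1 (mcoeff (@mnm0 3))); rewrite !mcoeffC eqxx !mulr1.
  + by apply: (eq_degb _ _ (@degb_cform _ _ cell k k3 b b1 [:: T; T'] (c T') false false false)) => // i;
      rewrite /fdeg !if_same addn0.
  + by apply: (eq_degb _ _ (@degb_cform _ _ cell k k3 b b1 [:: T; T'] (c T) false false false)) => // i;
      rewrite /fdeg !if_same addn0.
exists (g [::]) => T; rewrite vE; congr mpolyC; have := gP [:: T] erefl; rewrite /= subr0; apply.
by move=> U U'; rewrite !inE => /eqP-> /eqP-> i; rewrite ltW.
Qed.

Lemma grad_exact (v : axis -> I -> poly3 R) : (forall i, S (up b i) (v i)) ->
  (forall i j T, partial i (v j T) = partial j (v i T)) ->
  exists2 u, S b u & forall i T, v i T = partial i (u T).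
Proof.
move=> Sv cv.
pose W x y u : I -> poly3 R := match x, y, u with
  | true, false, false => v ax0 | false, true, false => v ax1 | false, false, true => v ax2
  | _, _, _ => fun=> 0 end.
have [|T|T|U [SU hU UE]] := de_rham (q := 0) (W := W).
- by case=> -[] []; rewrite /W; (try exact: conforming0);
    apply: eq_conforming (Sv _) => i; rewrite /up /fdeg; elim/axisP: i.
- by case=> -[] [].
- by case=> -[] []; rewrite /dform /W /= ?raddf0 ?addr0 ?add0r ?subr0 //
    ?(cv ax0 ax1) ?(cv ax0 ax2) ?(cv ax1 ax2) ?subrr ?oppr0.
exists (U false false false) => [|i T].
  by apply: eq_conforming (SU false false false) => i; rewrite /fdeg !if_same addn0.
elim/axisP: i.
- by have := UE T true false false; rewrite /dform /= !addr0.
- by have := UE T false true false; rewrite /dform /= addr0 add0r.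
- by have := UE T false false true; rewrite /dform /= !add0r.
Qed.

Lemma curl_exact (c : axis -> I -> poly3 R) : (forall i, S (upn b i) (c i)) ->
  (forall T, \sum_i partial i (c i T) = 0) ->
  exists2 v : axis -> I -> poly3 R, (forall i, S (up b i) (v i)) &
    forall i T, c i T = partial (i + 1) (v (i - 1) T) - partial (i - 1) (v (i + 1) T).
Proof.
move=> Sc cc.
(* The middle entry is negated because [form] orders the differentials increasingly while the curl
   is cyclic: dx_2 dx_0 = - dx_0 dx_2. *)
pose W x y u : I -> poly3 R := match x, y, u with
  | false, true, true => c ax0 | true, false, true => fun T => - c ax1 T
  | true, true, false => c ax2 | _, _, _ => fun=> 0 end.
have [|T|T|U [SU hU UE]] := de_rham (q := 1) (W := W).
- by case=> -[] []; rewrite /W; (try exact: conforming0); (try apply: conformingN);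
    apply: eq_conforming (Sc _) => i; rewrite /upn /fdeg; elim/axisP: i.
- by case=> -[] [].
- have := cc T; rewrite sum_axis => ccT.
  case=> -[] []; rewrite /dform /W /= ?raddf0 ?addr0 ?add0r ?subr0 ?oppr0//.
  by rewrite raddfN opprK /= -addrA.
exists (fun i => if i == ax0 then U true false false else if i == ax1 then U false true false
    else U false false true).
  by elim/axisP; apply: eq_conforming (SU _ _ _); elim/axisP.
move=> i T; elim/axisP: i; rewrite !ax_cyc /=.
- by have := UE T false true true; rewrite /W /dform /= add0r.
- by have := UE T true false true; rewrite /W /dform /= addr0 => /(congr1 -%R); rewrite opprK opprB.
- by have := UE T true true false; rewrite /W /dform /= addr0.
Qed.

Lemma div_exact q : S (fun j => (b j + 1)%N) q ->
  exists2 c : axis -> I -> poly3 R, (forall i, S (upn b i) (c i)) &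
    forall T, q T = \sum_i partial i (c i T).
Proof.
move=> Sq.
pose W x y u : I -> poly3 R := if [&& x, y & u] then q else fun=> 0.
have [|T|T|U [SU hU UE]] := de_rham (q := 2) (W := W).
- by case=> -[] []; rewrite /W /=; (try exact: conforming0);
    apply: eq_conforming Sq => i; rewrite /fdeg; elim/axisP: i.
- by case=> -[] [].
- by case=> -[] []; rewrite /dform /W /= ?raddf0 ?addr0 ?add0r ?subr0 ?oppr0.
exists (fun i => if i == ax0 then U false true true else if i == ax1 then fun T => - U true false true T
    else U true true false).
  by elim/axisP => /=; (try apply: conformingN); apply: eq_conforming (SU _ _ _); elim/axisP.
move=> T; have := UE T true true true; rewrite /W /dform sum_axis /= raddfN /= => ->.
by rewrite addrA.
Qed.

End Global.

(** * Degrees of freedom *)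

Lemma prod_axis (V : comPzRingType) (F : axis -> V) : \prod_i F i = F ax0 * (F ax1 * F ax2).
Proof.
rewrite !big_ord_recl big_ord0 mulr1; congr (F _ * (F _ * F _)); exact: val_inj.
Qed.

Lemma integral_horner_intv (R : realType) (a b : R) (q : {poly R}) : a < b ->
  \int[lebesgue_measure]_(t in `[a, b]) q.[t] = intv a b q.
Proof.
move=> ab; rewrite /Rintegral (@continuous_FTC2 _ _ (horner (prim q)))//.
- by apply: continuous_subspaceT; exact: continuous_horner.
- split=> [x _||]; first exact: derivable_horner.
  + by apply: cvg_at_right_filter; exact: continuous_horner.
  + by apply: cvg_at_left_filter; exact: continuous_horner.
- move=> x _; rewrite derive1E; have h := is_derive_poly (prim q) x.
  by rewrite derive_val deriv_prim.
Qed.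

Section Moments.
Variable R : realType.
Implicit Types (E : box R) (f g p : poly3 R) (q : {poly R}) (i : axis) (x : axis -> R).

Lemma enum_axis : enum 'I_3 = [:: ax0; ax1; ax2].
Proof. by apply: (inj_map val_inj); rewrite val_enum_ord. Qed.

Definition intop (a b : R) q : {poly R} := (intv a b q)%:P.

Lemma intop_is_linear a b : linear (intop a b).
Proof.
move=> c q r; rewrite /intop /intv linearP !hornerE/= -mul_polyC -polyCM -polyCD.
by congr polyC; ring.
Qed.

HB.instance Definition _ a b :=
  GRing.isLinear.Build R {poly R} {poly R} _ (intop a b) (intop_is_linear a b).

Definition line x i p : {poly R} :=
  mlin (fun m => (\prod_(j | j != i) x j ^+ m j) *: 'X^(m i)) p.

HB.instance Definition _ x i :=
  GRing.isLinear.Build R (poly3 R) {poly R} _ (line x i) (mlin_is_linear _).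

Lemma eq_mlinear_scalar (f g : poly3 R -> R) : scalar f -> scalar g ->
  (forall m, f (mpolyX R m) = g (mpolyX R m)) -> f =1 g.
Proof.
move=> fl gl.
pose F := HB.pack (f : poly3 R -> R^o) (GRing.isLinear.Build R (poly3 R) R^o _ f fl) :
  {linear poly3 R -> R^o}.
pose G := HB.pack (g : poly3 R -> R^o) (GRing.isLinear.Build R (poly3 R) R^o _ g gl) :
  {linear poly3 R -> R^o}.
by move=> fg p; exact: (@eq_mlinear R _ F G).
Qed.

Lemma meval_scalar x : scalar (meval x : poly3 R -> R).
Proof. by move=> a p q; rewrite mevalD mevalZ. Qed.

Lemma line_horner x i p t :
  (line x i p).[t] = meval (fun j => if j == i then t else x j) p.
Proof.
apply: (eq_mlinear_scalar (f := fun p => (line x i p).[t]) (g := meval _)).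
- by move=> a p' q'; rewrite linearP hornerD hornerZ.
- exact: meval_scalar.
move=> m; rewrite /line mlinX mevalX hornerZ hornerXn [RHS](bigD1 i)//= eqxx mulrC.
by congr (_ * _); apply: eq_bigr => j /negbTE->.
Qed.

Lemma meval_lift_const x i (L : op R) (c : {poly R} -> R) p : (forall q, L q = (c q)%:P) ->
  meval x (lift i L p) = c (line x i p).
Proof.
move=> Lc; have cl : scalar c.
  move=> a q r; have := linearP L a q r; rewrite !Lc -mul_polyC -polyCM -polyCD => /polyC_inj.
  by [].
apply: (eq_mlinear_scalar (f := fun p => meval x (lift i L p)) (g := fun p => c (line x i p))).
- by move=> a p' q'; rewrite linearP mevalD mevalZ.
- by move=> a p' q'; rewrite linearP cl.
move=> m; rewrite lift_X Lc /line mlinX.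
have -> : c ((\prod_(j | j != i) x j ^+ m j) *: 'X^(m i)) = (\prod_(j | j != i) x j ^+ m j) * c 'X^(m i).
  have := cl (\prod_(j | j != i) x j ^+ m j) 'X^(m i) 0; rewrite addr0 => ->.
  by have := cl (-1) 0 0; rewrite scaler0 addr0 mulN1r addNr => ->; rewrite addr0.
rewrite -[(c _)%:P]mulr1 mul_polyC linearZ /= -(expr0 'X) ins_Xn mevalZ mevalX (bigD1 i)//=.
rewrite mset_eq expr0 mul1r mulrC; congr (_ * _).
by apply: eq_bigr => j ji; rewrite msetE (negbTE ji).
Qed.

Definition intaxis E i : op R := if i \in free_axes E then (intop (lo E 0 i) (hi E 0 i) : op R) else idfun.

Lemma integrate_axis_lift E i f : integrate_axis E i (fun x => meval x f) =
  fun x => meval x (lift i (intaxis E i) f).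
Proof.
apply/funext => x; rewrite /integrate_axis /intaxis; case: ifP => [|_] /=; last by rewrite lift_id.
rewrite inE => ab; rewrite (@meval_lift_const _ _ _ (intv (lo E 0 i) (hi E 0 i)))//.
rewrite -integral_horner_intv//; congr Rintegral.
by apply/funext => t; rewrite line_horner.
Qed.

Lemma box_integral_lift E f :
  box_integral E (fun x => meval x f) = meval (lo E 0) (lift3 (intaxis E) f).
Proof. by rewrite /box_integral enum_axis /= !integrate_axis_lift. Qed.

Lemma moment_lift E f p : moment E f p = meval (lo E 0) (lift3 (intaxis E) (f * p)).
Proof.
rewrite /moment -box_integral_lift; congr box_integral.
by apply/funext => x; rewrite mevalM.
Qed.

Lemma momentBl E f g p : moment E (f - g) p = moment E f p - moment E g p.
Proof. by rewrite !moment_lift mulrBl raddfB mevalB. Qed.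

Lemma moment_scalar E f : scalar (moment E f).
Proof. by move=> a p q; rewrite !moment_lift mulrDr -scalerAr linearP mevalD mevalZ. Qed.

Lemma lift3_ev (a : axis -> R) f : lift3 (fun i => ev (a i)) f = mpolyC 3 (meval a f).
Proof.
pose c : poly3 R -> poly3 R := fun f => meval a f *: mpolyX R (@mnm0 3).
have cl : linear c by move=> s p q; rewrite /c mevalD mevalZ scalerDl scalerA.
pose C := HB.pack c (GRing.isLinear.Build R (poly3 R) (poly3 R) _ c cl) : {linear poly3 R -> poly3 R}.
have -> : mpolyC 3 (meval a f) = C f by rewrite /C /= /c mpolyX0 alg_mpolyC.
apply: (@eq_mlinear R _ (lift3 (fun i => ev (a i))) C) => m /=.
have evX i n : ev (a i) 'X^n = a i ^+ n *: 'X^0 by rewrite evE hornerXn expr0 alg_polyC.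
rewrite /lift3 !(lift_X, evX, linearZ, ins_Xn) /= !(lift_X, evX, linearZ, ins_Xn) /=.
rewrite !(lift_X, evX, linearZ, ins_Xn) /= !scalerA /c mevalX.
rewrite ins_Xn prod_axis !msetE /=; congr (_ *: mpolyX R _); first by rewrite -mulrA mulrC mulrA.
by apply/mnmP; elim/axisP; rewrite !msetE mnm0E.
Qed.

Lemma mulXn_is_linear n : linear (fun q : {poly R} => q * 'X^n).
Proof. by move=> a p q; rewrite mulrDl scalerAl. Qed.

Definition mulXn n q : {poly R} := q * 'X^n.
HB.instance Definition _ n :=
  GRing.isLinear.Build R {poly R} {poly R} _ (mulXn n) (mulXn_is_linear n).

Definition derivs n q : {poly R} := iter n (@deriv R) q.

Lemma derivs_is_linear n : linear (derivs n).
Proof. by move=> a p q; rewrite /derivs; elim: n => //= n ->; rewrite linearP. Qed.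

HB.instance Definition _ n :=
  GRing.isLinear.Build R {poly R} {poly R} _ (derivs n) (derivs_is_linear n).

Lemma mul_monomial f m : f * mpolyX R m = lift3 (fun i => mulXn (m i)) f.
Proof.
have ml : linear (fun f : poly3 R => f * mpolyX R m).
  by move=> a p q; rewrite mulrDl scalerAl.
pose M := HB.pack (fun f : poly3 R => f * mpolyX R m)
  (GRing.isLinear.Build R (poly3 R) (poly3 R) _ _ ml) : {linear poly3 R -> poly3 R}.
apply: (@eq_mlinear R _ M (lift3 (fun i => mulXn (m i)))) => m' /=.
rewrite /lift3 !(lift_X, ins_Xn, msetE) /= /mulXn -!exprD !ins_Xn.
rewrite !(lift_X, ins_Xn, msetE) /= -?exprD ?ins_Xn -mpolyXD.
rewrite lift_X !msetE /= -exprD ins_Xn; congr mpolyX.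
by apply/mnmP; elim/axisP; rewrite mnmDE !msetE.
Qed.

Definition deriv_multi (al : axis -> nat) f : poly3 R := lift3 (fun i => derivs (al i)) f.

Lemma mderivm_multi (a : multinom 3) f : mderivm a f = deriv_multi a f.
Proof.
apply: (@eq_mlinear R _ (mderivm a) (lift3 (fun i => derivs (a i)))) => m /=.
have dX n d : derivs n ('X^d : {poly R}) = (d ^_ n)%:R *: 'X^(d - n).
  by have := @derivnXn R d n; rewrite /derivs /derivn => ->; rewrite scaler_nat.
rewrite mderivmX /lift3 !(lift_X, dX, linearZ, ins_Xn, msetE) /=.
rewrite !(lift_X, dX, linearZ, ins_Xn, msetE) /= !(lift_X, dX, linearZ, ins_Xn, msetE) /= .
rewrite ins_Xn natr_prod prod_axis !scalerA; congr (_ *: mpolyX R _).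
  by rewrite mulrA [LHS]mulrC mulrA.
by apply/mnmP; elim/axisP; rewrite mnmBE !msetE.
Qed.

(** The one-variable factor of a degree of freedom: derivative, weight, then the integral along a
    free axis or the value at a fixed coordinate. After an integral the outer [ev] acts on a
    constant and changes nothing. *)
Definition dofop E (a n : nat) i : op R :=
  ev (lo E 0 i) \o (intaxis E i \o (mulXn n \o derivs a)).

Lemma moment_dofop E (a n : multinom 3) f :
  mpolyC 3 (moment E (mderivm a f) (mpolyX R n)) = lift3 (fun i => dofop E (a i) (n i) i) f.
Proof.
by rewrite moment_lift -lift3_ev mul_monomial mderivm_multi /deriv_multi -!lift3_comp.
Qed.

(** A vertex has no free axis, so point values are moments too and all entities can be treated
    alike. *)
Lemma moment_vertex E f : is_vertex E -> vertex_value E f = moment E f 1.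
Proof.
move=> vE; rewrite moment_lift mulr1 /vertex_value; congr meval.
rewrite -[LHS]lift3_id; apply: eq_lift3 => i n.
by rewrite /intaxis vE inE.
Qed.

Lemma tay_derivs c s a q : (a + s < 2)%N -> (derivs a (tay c s q)).[c] = (derivs a q).[c].
Proof.
have t0 q' : (tay c 0 q').[c] = q'.[c] by rewrite tayE /jet !hornerE/= subrr mulr0 addr0.
have t1 q' : (tay c 1 q').[c] = q'.[c] by rewrite tayE /jet scaler0 addr0 !hornerE.
case: a s => [|[|a]] [|[|s]] // _; rewrite /derivs.
- exact: t0.
- exact: t1.
- by rewrite iterS deriv_tay; exact: t1.
Qed.

Lemma eq_moment E f g : (forall n, moment E f (mpolyX R n) = moment E g (mpolyX R n)) ->
  forall p, moment E f p = moment E g p.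
Proof. by move=> fg; apply: eq_mlinear_scalar => //; exact: moment_scalar. Qed.

(** Across the entity only derivatives of order less than 2 - sg i occur, and these depend only on
    the jet that the trace keeps. *)
Lemma moment_trace E sg (a : multinom 3) f p :
  (forall i, if lo E 0 i < hi E 0 i then a i = 0%N else (a i + sg i < 2)%N) ->
  moment E (mderivm a (lift3 (trace E sg) f)) p = moment E (mderivm a f) p.
Proof.
move=> aP; move: p; apply: eq_moment => n.
apply: (can_inj (@mpolyCK 3 R)); rewrite !moment_dofop -lift3_comp.
apply: eq_lift3 => i d; rewrite /dofop /trace /intaxis /= inE; have := aP i.
by case: ifP => //= _ ai; rewrite !evE /mulXn !hornerM tay_derivs.
Qed.

End Moments.

(** * Conformity tested by moments on subentities *)

Section Unisolvence.
Variables (R : realType) (I : finType) (cell : I -> box R) (k : nat).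
Hypothesis mesh : aligned_mesh cell.
Hypothesis k3 : (3 <= k)%N.
Implicit Types (sg : axis -> nat) (v w : I -> poly3 R) (E : box R) (a n : multinom 3).

Definition deriv_ok sg E a := forall i,
  if lo E 0 i < hi E 0 i then a i = 0%N else (a i + sg i < 2)%N.

(** Along a free axis there are k + 1 - sg i coefficients and 2 (2 - sg i) endpoint conditions,
    which leaves k + sg i - 3 weights, of degrees up to k + sg i - 4. *)
Definition weight_ok sg E n := forall i,
  if lo E 0 i < hi E 0 i then is_true (n i + 4 <= k + sg i)%N else n i = 0%N.

Lemma subentity_le E T i : subentity E (cell T) -> lo E 0 i <= hi E 0 i.
Proof. by have [clt _] := mesh; move=> /(_ i)[] [-> ->] //; exact: ltW. Qed.

Lemma subentity_sub E T i : subentity E (cell T) ->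
  lo (cell T) 0 i <= lo E 0 i /\ hi E 0 i <= hi (cell T) 0 i.
Proof.
by have [clt _] := mesh; have h := ltW (clt T i); move=> /(_ i)[] [-> ->]; rewrite ?lexx.
Qed.

Lemma subentity_meets E T T' : subentity E (cell T) -> subentity E (cell T') ->
  meets (cell T) (cell T').
Proof.
move=> ET ET' i; have Ele := subentity_le i ET.
have [? ?] := subentity_sub i ET; have [? ?] := subentity_sub i ET'.
by split; [apply: (@le_trans _ _ (lo E 0 i)) => //; apply: le_trans Ele _|
  apply: (@le_trans _ _ (lo E 0 i)) => //; apply: le_trans Ele _].
Qed.

Lemma trace_cap E T T' sg i (d : nat) : subentity E (cell T) -> subentity E (cell T') ->
  trace E sg i (trace (cap cell [:: T; T']) sg i 'X^d) = trace E sg i 'X^d.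
Proof.
move=> ET ET'; have Ele := subentity_le i ET; have m := subentity_meets ET ET'.
have c := clique_pair mesh m.
have [L1 H1] := subentity_sub i ET; have [L2 H2] := subentity_sub i ET'.
have [U Us EU] := cap_lo_ex cell i (isT : [:: T; T'] != [::]).
have [V Vs EV] := cap_hi_ex cell i (isT : [:: T; T'] != [::]).
have Lc : lo (cap cell [:: T; T']) 0 i <= lo E 0 i.
  by rewrite EU; move: Us; rewrite !inE => /orP[]/eqP->.
have Hc : hi E 0 i <= hi (cap cell [:: T; T']) 0 i.
  by rewrite EV; move: Vs; rewrite !inE => /orP[]/eqP->.
rewrite /trace; case: (boolP (lo (cap _ _) 0 i < _)) => //=; rewrite -leNgt => HL.
have eE : lo E 0 i = lo (cap cell [:: T; T']) 0 i.
  by apply/eqP; rewrite eq_le Lc andbT (le_trans Ele)// (le_trans Hc).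
rewrite ifF; first by rewrite eE tay_tay.
by apply/negbTE; rewrite -leNgt (le_trans Hc)// (le_trans HL).
Qed.

Lemma conforming_moment sg v E T T' a p : conforming cell k sg v ->
  subentity E (cell T) -> subentity E (cell T') -> deriv_ok sg E a ->
  moment E (mderivm a (v T)) p = moment E (mderivm a (v T')) p.
Proof.
move=> [_ cv] ET ET' aP; rewrite -(moment_trace _ p aP) -[RHS](moment_trace _ p aP).
have h U : lift3 (trace E sg) (v U) = lift3 (trace E sg) (tr cell [:: T; T'] sg (v U)).
  by rewrite /tr -lift3_comp; apply: eq_lift3 => i d /=; rewrite trace_cap.
by rewrite !h (cv _ _ (subentity_meets ET ET')).
Qed.

(** Tensor unisolvence on the intersection of two cells: along a free axis, jets at both ends and
    interior moments determine the polynomial; along a degenerate one, the derivatives determine the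
    jet. *)
Lemma conforming_of_moments sg v : (forall i, (sg i <= 2)%N) ->
  (forall T, degb (fun=> k) sg (v T)) ->
  (forall E T T' a n, subentity E (cell T) -> subentity E (cell T') -> deriv_ok sg E a ->
     weight_ok sg E n ->
     moment E (mderivm a (v T)) (mpolyX R n) = moment E (mderivm a (v T')) (mpolyX R n)) ->
  conforming cell k sg v.
Proof.
move=> s2 dv mv; split=> // T T' m; apply/eqP; rewrite -subr_eq0 -raddfB /=; apply/eqP.
have [clt al] := mesh; have c := clique_pair mesh m.
have [C CE] : exists C, cap cell [:: T; T'] = C by eexists.
have CLH i : lo C 0 i <= hi C 0 i by rewrite -CE; exact: cap_le.
rewrite /tr CE.
(* Each one-variable functional comes with the subinterval supporting it. *)
pose Lam i (l : op R) := exists ab an, [/\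
  [\/ ab = (lo C 0 i, hi C 0 i), ab = (lo C 0 i, lo C 0 i) | ab = (hi C 0 i, hi C 0 i)],
  if ab.1 < ab.2 then an.1 = 0%N /\ (an.2 + 4 <= k + sg i)%N
    else (an.1 + sg i < 2)%N /\ an.2 = 0%N &
  l = dofop (Box (const_mx ab.1) (const_mx ab.2)) an.1 an.2 i :> ({poly R} -> {poly R})].
have constop i l q : Lam i l -> exists c, l q = c%:P.
  by move=> [ab [an [_ _ ->]]]; rewrite /dofop /= evE; eexists.
apply: (@lift3_separated _ (fun=> k) sg Lam) => [i q dq lq|i q l dq Ll|i q dq||l Ll].
- have hder c0 r : c0 = lo C 0 i \/ c0 = hi C 0 i -> (r + sg i < 2)%N -> (derivs r q).[c0] = 0.
    move=> c0E rs; have : Lam i (dofop (Box (const_mx c0) (const_mx c0)) r 0 i).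
      exists (c0, c0), (r, 0%N); rewrite /= ltxx; split=> //.
      by case: c0E => ->; [constructor 2|constructor 3].
    move=> /lq; rewrite /dofop /intaxis inE /= !mxE ltxx /= evE /mulXn expr0 mulr1 => /polyC_inj.
    by [].
  rewrite /trace; case: ifP => [LH|_] /=.
    apply: (interval_unisolvent LH k3 (s2 i) dq) => [c0 r /orP c0E rs|n nk].
      by apply: hder => //; case: c0E => /eqP->; [left|right].
    have : Lam i (dofop (Box (const_mx (lo C 0 i)) (const_mx (hi C 0 i))) 0 n i).
      by exists (lo C 0 i, hi C 0 i), (0%N, n); rewrite /= LH; split=> //; constructor 1.
    move=> /lq; rewrite /dofop /intaxis inE /= !mxE LH /= evE /mulXn /intop hornerC => /polyC_inj.
    by [].
  rewrite /jet /tay1 /tayX; case E : (sg i) => [|[|u]] /=; rewrite ?scaler0 ?addr0//.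
    rewrite (hder _ 0%N)//; [|by left|by rewrite E].
    by rewrite (hder _ 1%N)// ?scale0r ?addr0//; [left|rewrite E].
  by rewrite (hder _ 0%N) ?scale0r//; [left|rewrite E].
- have [c0 lqE] := constop i l q Ll; rewrite /pdeg lqE.
  have [q0|q0] := eqVneq q 0.
    by move: lqE; rewrite q0 raddf0 => <-; rewrite size_poly0.
  apply: leq_trans (size_polyC_leq1 _) _; apply: leq_trans dq.
  by rewrite size_poly_gt0.
- rewrite /trace; case: ifP => // _; apply: pdeg_tayK; exact: ltn_trans k3.
- by apply: degbB; exact: dv.
have [ab abP] := choice Ll; have [an anP] := choice abP.
(* The supports chosen along the three axes are the sides of one subentity shared by both cells, and
   the product functional is a degree of freedom there. *)
pose E := Box (\row_i (ab i).1) (\row_i (ab i).2).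
pose a : multinom 3 := Multinom (mktuple (fun i => (an i).1)).
pose n : multinom 3 := Multinom (mktuple (fun i => (an i).2)).
have aE i : a i = (an i).1 by exact: mnmE.
have nE i : n i = (an i).2 by exact: mnmE.
have subE U : U \in [:: T; T'] -> subentity E (cell U).
  move=> Us i; rewrite /= !mxE; have [H1 _ _] := anP i.
  have U0 : {subset [:: U] <= [:: T; T']} by move=> x; rewrite inE => /eqP->.
  have := cap_sub mesh i c (isT : [:: U] != [::]) U0; rewrite CE /= !mxE /=.
  case=> [[e1 e2]|[_ e1 e2]].
    by case: H1 => ->; rewrite /= ?e1 ?e2; [constructor 1|constructor 2|constructor 3].
  case: H1 => ->; rewrite /= -?e1; case: e2 => ->;
    by [constructor 2|constructor 3].
rewrite (eq_lift3 (L' := fun i => dofop E (a i) (n i) i)); last first.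
  move=> i d; have [_ _ ->] := anP i.
  by rewrite aE nE /dofop /intaxis !inE /= !mxE.
rewrite -moment_dofop mderivmB momentBl (mv _ T T') ?subrr ?mpolyC0//.
- by apply: subE; rewrite mem_head.
- by apply: subE; rewrite !inE eqxx orbT.
- by move=> i; have [_ + _] := anP i; rewrite aE /= !mxE; case: ifP => _ [].
- by move=> i; have [_ + _] := anP i; rewrite nE /= !mxE; case: ifP => _ [].
Qed.

End Unisolvence.

Lemma distinct_axesP (i j l : axis) : distinct_axes i j l ->
  [/\ (i == j) = false, (i == l) = false & (j == l) = false] /\
  forall P : axis -> Prop, P i -> P j -> P l -> forall x, P x.
Proof.
rewrite /distinct_axes /= !inE !negb_or !andbT => /andP[/andP[ij il] jl].
split; first by rewrite (negbTE ij) (negbTE il) (negbTE jl).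
move=> P; move: i j l ij il jl.
elim/axisP; elim/axisP => //; elim/axisP => // _ _ _ P0 P1 P2; exact: axisP.
Qed.

Lemma distinct_axes_ex (i j : axis) : i != j -> exists l, distinct_axes i j l.
Proof.
move: i j; elim/axisP; elim/axisP => // _;
  by [exists ax2|exists ax1|exists ax0].
Qed.

Lemma distinct_swap (i j l : axis) : distinct_axes i j l -> distinct_axes i l j.
Proof.
by rewrite /distinct_axes /= !inE !negb_or !andbT (eq_sym l j) => /andP[/andP[-> ->] ->].
Qed.

Lemma distinct_rot (i j l : axis) : distinct_axes i j l -> distinct_axes j i l.
Proof.
by rewrite /distinct_axes /= !inE !negb_or !andbT (eq_sym j i) => /andP[/andP[-> ->] ->].
Qed.

Lemma distinct_cyc (i j l : axis) : distinct_axes i j l -> distinct_axes j l i.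
Proof. by move=> /distinct_rot/distinct_swap. Qed.

Lemma distinct_ax : distinct_axes ax0 ax1 ax2.
Proof. by rewrite /distinct_axes. Qed.

Lemma distinct_neq (i j l : axis) : distinct_axes i j l ->
  ((i == j) = false) * ((j == i) = false) * ((i == l) = false) * ((l == i) = false) *
  ((j == l) = false) * ((l == j) = false).
Proof.
by move=> d; have [[ij il jl] _] := distinct_axesP d; rewrite !(eq_sym l) (eq_sym j) ij il jl.
Qed.

Section Entities.
Variables (R : realType) (k : nat).
Implicit Types (sg : axis -> nat) (E : box R) (a n : multinom 3) (i j l x : axis) (p : poly3 R).

Lemma Qspace_degb (s : seq (axis * int)) sg p :
  (forall x, degree_bound s x = k%:Z - (sg x)%:Z) -> Qspace s p <-> degb (fun=> k) sg p.
Proof.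
by move=> sE; split=> H m mp x; have := H m mp x; rewrite sE; lia.
Qed.

Lemma QspaceX (s : seq (axis * int)) n :
  (forall x, (n x)%:Z <= degree_bound s x) -> Qspace s (mpolyX R n).
Proof. by move=> ns m; rewrite msuppX inE => /eqP-> x. Qed.

Local Notation free E x := (lo E 0 x < hi E 0 x).

Lemma freeE E x : (x \in free_axes E) = free E x.
Proof. by rewrite inE. Qed.

Section Axes.
Variables (i j l : axis).
Hypothesis dst : distinct_axes i j l.

Lemma vertexI E : ~~ free E i -> ~~ free E j -> ~~ free E l -> is_vertex E.
Proof.
have [[ij il jl] cas] := distinct_axesP dst => fi fj fl; apply/setP; apply: cas;
  by rewrite freeE inE; apply/negbTE.
Qed.

Lemma edgeI E : free E i -> ~~ free E j -> ~~ free E l -> is_edge i E.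
Proof.
have [[ij il jl] cas] := distinct_axesP dst => fi fj fl; apply/setP; apply: cas;
  by rewrite freeE inE ?eqxx ?(eq_sym j) ?(eq_sym l) ?ij ?il//; apply/negbTE.
Qed.

Lemma faceI E : free E i -> free E j -> ~~ free E l -> is_face i j E.
Proof.
have [[ij il jl] cas] := distinct_axesP dst => fi fj fl; split; first by rewrite ij.
apply/setP; apply: cas; rewrite freeE !inE ?eqxx ?orbT ?fi ?fj //.
by rewrite (eq_sym l i) (eq_sym l j) il jl; apply/negbTE.
Qed.

Lemma cellI E : free E i -> free E j -> free E l -> is_cell E.
Proof.
have [[ij il jl] cas] := distinct_axesP dst => fi fj fl.
by apply/setP; apply: cas; rewrite freeE inE.
Qed.

Lemma mderivm0E a : a i = 0%N -> a j = 0%N -> a l = 0%N -> mderivm a = id :> (poly3 R -> poly3 R).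
Proof.
have [_ cas] := distinct_axesP dst => ai aj al; apply/funext => f.
have -> : a = @mnm0 3 by apply/mnmP; apply: cas; rewrite mnm0E.
exact: mderivm0m.
Qed.

Lemma mderivm1E a : a i = 1%N -> a j = 0%N -> a l = 0%N -> mderivm a = @partial R i.
Proof.
have [[ij il jl] cas] := distinct_axesP dst => ai aj al; apply/funext => f.
have -> : a = mnm1 i by apply/mnmP; apply: cas; rewrite mnm1E ?eqxx ?ij ?il.
exact: mderivmU1m.
Qed.

Lemma mderivm2E a : a i = 1%N -> a j = 1%N -> a l = 0%N -> mderivm a = @partial R i \o partial j.
Proof.
have [[ij il jl] cas] := distinct_axesP dst => ai aj al; apply/funext => f.
have -> : a = mnm_add (mnm1 j) (mnm1 i).
  by apply/mnmP; apply: cas; rewrite mnmDE !mnm1E ?eqxx ?(eq_sym j i) ?ij ?il ?jl.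
by rewrite mderivmDm !mderivmU1m.
Qed.

End Axes.

Lemma entityP i j l E (P : Prop) : distinct_axes i j l ->
  (is_vertex E -> ~~ free E i -> ~~ free E j -> ~~ free E l -> P) ->
  (forall i j l, distinct_axes i j l -> is_edge i E -> free E i -> ~~ free E j -> ~~ free E l -> P) ->
  (forall i j l, distinct_axes i j l -> is_face i j E -> free E i -> free E j -> ~~ free E l -> P) ->
  (is_cell E -> free E i -> free E j -> free E l -> P) -> P.
Proof.
move=> dst HV HE HF HC; have d1 := distinct_cyc dst; have d2 := distinct_cyc d1.
have d' := distinct_rot dst.
case: (boolP (free E i)) => fi; case: (boolP (free E j)) => fj; case: (boolP (free E l)) => fl.
- by apply: HC => //; exact: (cellI dst).
- by apply: (HF i j l) => //; exact: (faceI dst).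
- have d := distinct_swap dst; by apply: (HF i l j) => //; exact: (faceI d).
- by apply: (HE i j l) => //; exact: (edgeI dst).
- by apply: (HF j l i) => //; exact: (faceI d1).
- by apply: (HE j i l) => //; exact: (edgeI d').
- by apply: (HE l i j) => //; exact: (edgeI d2).
- by apply: HV => //; exact: (vertexI dst).
Qed.


Lemma mderivm_le1 i j l a : distinct_axes i j l -> (a i < 2)%N -> a j = 0%N -> a l = 0%N ->
  mderivm a = id :> (poly3 R -> poly3 R) \/ mderivm a = @partial R i.
Proof.
move=> d; case ai : (a i) => [|[|//]] _ aj al; first by left; exact: (mderivm0E d).
by right; apply: (mderivm1E d).
Qed.

Lemma mderivm_le2 i j l a : distinct_axes i j l -> (a i < 2)%N -> (a j < 2)%N -> a l = 0%N ->
  [\/ mderivm a = id :> (poly3 R -> poly3 R), mderivm a = @partial R i, mderivm a = @partial R j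
   | mderivm a = @partial R i \o partial j].
Proof.
move=> d; case aj : (a j) => [|[|//]] ai _ al.
  by case: (mderivm_le1 d ai aj al) => ->; [constructor 1|constructor 2].
case ai' : (a i) ai => [|[|//]] _; last by constructor 4; apply: (mderivm2E d).
by constructor 3; apply: (mderivm1E (distinct_rot d)).
Qed.

Definition deriv_of sg E (D : poly3 R -> poly3 R) := exists2 a, D = mderivm a & deriv_ok sg E a.

Lemma deriv_of_id sg E : (forall x, free E x || (sg x < 2)%N) -> deriv_of sg E id.
Proof.
move=> sE; exists (@mnm0 3); first by apply/funext => f; rewrite mderivm0m.
by move=> x; have := sE x; rewrite mnm0E; case: ifP.
Qed.

Lemma deriv_of_partial sg E j : (forall x, free E x || (sg x < 2)%N) ->
  ~~ free E j -> sg j = 0%N -> deriv_of sg E (@partial R j).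
Proof.
move=> sE fj sj; exists (mnm1 j); first by apply/funext => f; rewrite mderivmU1m.
move=> x; have := sE x; rewrite mnm1E; case: eqP => [<-|_]; first by rewrite (negbTE fj) sj.
by case: ifP.
Qed.

Lemma deriv_of_partial2 sg E j l : (forall x, free E x || (sg x < 2)%N) -> j != l ->
  ~~ free E j -> sg j = 0%N -> ~~ free E l -> sg l = 0%N ->
  deriv_of sg E (@partial R j \o partial l).
Proof.
move=> sE jl fj sj fl sl; exists (mnm_add (mnm1 l) (mnm1 j)).
  by apply/funext => f; rewrite mderivmDm !mderivmU1m.
move=> x; have := sE x; rewrite mnmDE !mnm1E; case: eqP => [<-|_].
  by rewrite (negbTE jl) (negbTE fl) sl.
by case: eqP => [<-|_]; [rewrite (negbTE fj) sj|case: ifP].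
Qed.

Lemma QspaceX_distinct i j l (s : seq (axis * int)) n : distinct_axes i j l ->
  (n i)%:Z <= degree_bound s i -> (n j)%:Z <= degree_bound s j ->
  (n l)%:Z <= degree_bound s l -> Qspace s (mpolyX R n).
Proof.
by move=> d ni nj nl; apply: QspaceX; apply: (distinct_axesP d).2.
Qed.

End Entities.

Ltac bound d := apply: (QspaceX_distinct d); rewrite /= ?eqxx ?(distinct_neq d); lia.

Section Dofs.
Variables (R : realType) (I : finType) (cell : I -> box R) (k : nat).
Hypothesis mesh : aligned_mesh cell.
Hypothesis k3 : (3 <= k)%N.
Implicit Types (sg : axis -> nat) (E : box R) (a n : multinom 3) (i j l x : axis) (p : poly3 R).
Local Notation free E x := (lo E 0 x < hi E 0 x).

Lemma conforming_dof sg v E T T' D p : conforming cell k sg v ->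
  subentity E (cell T) -> subentity E (cell T') -> deriv_of sg E D ->
  moment E (D (v T)) p = moment E (D (v T')) p.
Proof. by move=> cv ET ET' [a -> aP]; exact: (conforming_moment mesh p cv). Qed.

Lemma vertex_moment E f n : is_vertex E -> (forall x, n x = 0%N) ->
  moment E f (mpolyX R n) = vertex_value E f.
Proof.
move=> vE n0; rewrite moment_vertex//; congr moment.
by rewrite -mpolyX0; congr mpolyX; apply/mnmP => x; rewrite n0 mnm0E.
Qed.

Lemma free_ok sg E a n x : deriv_ok sg E a -> weight_ok k sg E n -> free E x ->
  a x = 0%N /\ (n x + 4 <= k + sg x)%N.
Proof. by move=> /(_ x) + /(_ x) => + + f; rewrite f. Qed.

Lemma fixed_ok sg E a n x : deriv_ok sg E a -> weight_ok k sg E n -> ~~ free E x ->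
  (a x + sg x < 2)%N /\ n x = 0%N.
Proof. by move=> /(_ x) + /(_ x) => + + f; rewrite (negbTE f). Qed.

(** * Identification of the finite element spaces *)

Definition sg0 : axis -> nat := fun=> 0%N.

(** As for the other three spaces below, the listed degrees of freedom with monomial weights are
    matched, entity by entity, with the pairs [deriv_ok] and [weight_ok] for one index; here the
    index is 0 along each axis. *)
Lemma U_hP v : U_h k cell v <-> conforming cell k sg0 v.
Proof.
have shapeE p : U_shape k p <-> degb (fun=> k) sg0 p.
  apply: Qspace_degb => x; rewrite /sg0 subr0.
  by elim/axisP: x.
have d012 : distinct_axes ax0 ax1 ax2 by rewrite /distinct_axes.
split=> [[sv dv]|cv].
  apply: conforming_of_moments => // [T|E T T' a n ET ET' aP nP]; first exact/shapeE.
  have dof phi : U_dof k E phi -> phi (v T) = phi (v T') by exact: dv.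
  apply: (dof (fun u => moment E (mderivm a u) (mpolyX R n))).
  apply: (entityP distinct_ax) => [vE f0 f1 f2|i j l d eE fi fj fl|i j l d fE fi fj fl|cE f0 f1 f2].
  - have [a0 n0] := fixed_ok aP nP f0; have [a1 n1] := fixed_ok aP nP f1.
    have [a2 n2] := fixed_ok aP nP f2; move: a0 a1 a2; rewrite /sg0 !addn0 => a0 a1 a2.
    have -> : (fun u => moment E (mderivm a u) (mpolyX R n)) =
        (fun u => vertex_value E (mderivm a u)).
      by apply/funext => u; apply: vertex_moment => //; exact: axisP.
    by apply: U_vertex => //; exact: axisP.
  - have [ai ni] := free_ok aP nP fi; have [aj nj] := fixed_ok aP nP fj.
    have [al nl] := fixed_ok aP nP fl; move: aj al ni; rewrite /sg0 !addn0 => aj al ni.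
    by apply: (U_edge d eE); [exact: (mderivm_le2 _ (distinct_cyc d))|bound d].
  - have [ai ni] := free_ok aP nP fi; have [aj nj] := free_ok aP nP fj.
    have [al nl] := fixed_ok aP nP fl; move: al ni nj; rewrite /sg0 !addn0 => al ni nj.
    apply: (U_face d fE); [exact: (mderivm_le1 _ (distinct_cyc (distinct_cyc d)))|bound d].
  - have [a0 n0] := free_ok aP nP f0; have [a1 n1] := free_ok aP nP f1.
    have [a2 n2] := free_ok aP nP f2; move: n0 n1 n2; rewrite /sg0 !addn0 => n0 n1 n2.
    by rewrite (mderivm0E _ distinct_ax)//; apply: U_cell => //; bound distinct_ax.
split=> [T|E T T' ET ET' phi]; first by apply/shapeE; case: cv.
have ok x : free E x || (sg0 x < 2)%N by rewrite orbT.
case=> {phi}.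
- move=> a vE a1; rewrite !moment_vertex//; apply: (conforming_moment mesh _ cv) => // x.
  by rewrite -freeE vE inE /sg0 addn0 ltnS a1.
- move=> i j l D p d eE DE _; apply: (conforming_dof _ cv) => //.
  have [[ij il jl] _] := distinct_axesP d.
  have fj : ~~ free E j by rewrite -freeE eE inE eq_sym ij.
  have fl : ~~ free E l by rewrite -freeE eE inE eq_sym il.
  case: DE => ->; [exact: deriv_of_id|exact: deriv_of_partial|exact: deriv_of_partial|].
  by apply: deriv_of_partial2; rewrite ?jl.
- move=> i j l D p d [_ fE] DE _; apply: (conforming_dof _ cv) => //.
  have [[ij il jl] _] := distinct_axesP d.
  have fl : ~~ free E l by rewrite -freeE fE !inE !(eq_sym l) il jl.
  by case: DE => ->; [exact: deriv_of_id|exact: deriv_of_partial].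
- by move=> p cE _; apply: (conforming_dof (D := id) _ cv) => //; exact: deriv_of_id.
Qed.

End Dofs.

Section Axes.
Variables (R : realType) (i j l : axis).
Hypothesis d : distinct_axes i j l.
Implicit Types (E : box R).

Lemma up_distinct :
  (up (up sg0 i) i i = 2%N) * (up (up sg0 i) i j = 0%N) * (up (up sg0 i) i l = 0%N) *
  (up (up sg0 i) j i = 1%N) * (up (up sg0 i) j j = 1%N) * (up (up sg0 i) j l = 0%N).
Proof. by rewrite /up /sg0 !eqxx !(distinct_neq d). Qed.

Lemma upn_distinct :
  (upn (up sg0 i) i i = 1%N) * (upn (up sg0 i) i j = 1%N) * (upn (up sg0 i) i l = 1%N) *
  (upn (up sg0 i) j i = 2%N) * (upn (up sg0 i) j j = 0%N) * (upn (up sg0 i) j l = 1%N).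
Proof. by rewrite /upn /up /sg0 !eqxx !(distinct_neq d). Qed.

Local Notation free E x := (lo E 0 x < hi E 0 x).

Lemma vertex_free E x : is_vertex E -> free E x = false.
Proof. by move=> e; rewrite -freeE e inE. Qed.

Lemma cell_free E x : is_cell E -> free E x.
Proof. by move=> e; rewrite -freeE e inE. Qed.

Lemma edge_free E : is_edge i E ->
  (free E i = true) * (free E j = false) * (free E l = false).
Proof. by move=> e; rewrite -!freeE e !inE eqxx !(distinct_neq d). Qed.

Lemma face_free E : is_face i j E ->
  (free E i = true) * (free E j = true) * (free E l = false).
Proof. by move=> [_ e]; rewrite -!freeE e !inE !eqxx !(distinct_neq d). Qed.

End Axes.

Lemma distinct_diag (i : axis) : exists j l, distinct_axes i j l.
Proof.
by move: i; elim/axisP; [exists ax1, ax2|exists ax0, ax2|exists ax0, ax1].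
Qed.

Section Dofs.
Variables (R : realType) (I : finType) (cell : I -> box R) (k : nat).
Hypothesis mesh : aligned_mesh cell.
Hypothesis k3 : (3 <= k)%N.
Implicit Types (sg : axis -> nat) (E : box R) (a n : multinom 3) (i j l x : axis) (p : poly3 R).
Local Notation free E x := (lo E 0 x < hi E 0 x).

Lemma Qspace_distinct i j l (s : seq (axis * int)) sg p : distinct_axes i j l ->
  degree_bound s i = k%:Z - (sg i)%:Z -> degree_bound s j = k%:Z - (sg j)%:Z ->
  degree_bound s l = k%:Z - (sg l)%:Z -> Qspace s p <-> degb (fun=> k) sg p.
Proof.
by move=> d si sj sl; apply: (Qspace_degb); apply: (distinct_axesP d).2.
Qed.

Lemma conforming_dof_id sg v E T T' p : conforming cell k sg v ->
  subentity E (cell T) -> subentity E (cell T') -> (forall x, free E x || (sg x < 2)%N) ->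
  moment E (v T) p = moment E (v T') p.
Proof.
by move=> cv ET ET' ok; apply: (conforming_dof mesh _ cv ET ET' (D := id)); exact: deriv_of_id.
Qed.

Section Sigma.
Variable v : I -> 'M[poly3 R]_3.

Lemma Sigma_diag_shape i j l p : distinct_axes i j l ->
  Qspace [:: (i, k%:Z - 2); (j, k%:Z); (l, k%:Z)] p <-> degb (fun=> k) (up (up sg0 i) i) p.
Proof.
by move=> d; refine (Qspace_distinct p d _ _ _); rewrite /= ?eqxx ?(distinct_neq d) !(up_distinct d); lia.
Qed.

Lemma Sigma_off_shape i j l p : distinct_axes i j l ->
  Qspace [:: (i, k%:Z - 1); (j, k%:Z - 1); (l, k%:Z)] p <-> degb (fun=> k) (up (up sg0 i) j) p.
Proof.
by move=> d; refine (Qspace_distinct p d _ _ _); rewrite /= ?eqxx ?(distinct_neq d) !(up_distinct d); lia.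
Qed.

Lemma Sigma_diag_conforming i : Sigma_h k cell v ->
  conforming cell k (up (up sg0 i) i) (fun T => v T i i).
Proof.
move=> [sv dv]; have [j [l d]] := distinct_diag i.
apply: conforming_of_moments => // [x|T|E T T' a n ET ET' aP nP].
- by rewrite /up /sg0; case: eqP.
- by have [_ /(_ _ _ _ d) + _] := sv T; rewrite (Sigma_diag_shape _ d).
apply: (dv E T T' ET ET' (fun s => moment E (mderivm a (s i i)) (mpolyX R n))).
(* The index along [i] is 2, so no derivative order is admissible across that axis: entities not
   extending along [i] carry no condition. *)
case: (boolP (free E i)) => fi; last first.
  by have [] := fixed_ok aP nP fi; rewrite (up_distinct d) addn2.
have [ai ni] := free_ok aP nP fi.
case: (boolP (free E j)) => fj; case: (boolP (free E l)) => fl.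
- have [aj nj] := free_ok aP nP fj; have [al nl] := free_ok aP nP fl.
  rewrite (mderivm0E _ d)//; apply: (Sigma_diag_cell d (cellI d fi fj fl)).
  move: ni nj nl; rewrite !(up_distinct d) => *; bound d.
- have [aj nj] := free_ok aP nP fj; have [al nl] := fixed_ok aP nP fl.
  move: ni nj al; rewrite !(up_distinct d) !addn0 => ? ? al.
  by apply: (Sigma_diag_face d (faceI d fi fj fl)); [exact: mderivm_le1 _ (distinct_cyc (distinct_cyc d)) al ai aj|bound d].
- have [aj nj] := fixed_ok aP nP fj; have [al nl] := free_ok aP nP fl.
  move: ni nl aj; rewrite !(up_distinct d) !addn0 => ? ? aj; have d' := distinct_swap d.
  by apply: (Sigma_diag_face d' (faceI d' fi fl fj)); [exact: mderivm_le1 _ (distinct_rot d) aj ai al|bound d].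
- have [aj nj] := fixed_ok aP nP fj; have [al nl] := fixed_ok aP nP fl.
  move: ni aj al; rewrite !(up_distinct d) !addn0 => ? aj al.
  by apply: (Sigma_diag_edge d (edgeI d fi fj fl)); [exact: mderivm_le2 _ (distinct_cyc d) aj al ai|bound d].
Qed.

Lemma Sigma_off_conforming i j : (i < j)%N -> Sigma_h k cell v ->
  conforming cell k (up (up sg0 i) j) (fun T => v T i j).
Proof.
move=> ij [sv dv]; have [|l d] := @distinct_axes_ex i j; first by rewrite neq_ltn ij.
apply: conforming_of_moments => // [x|T|E T T' a n ET ET' aP nP].
- by rewrite /up /sg0; case: eqP; case: eqP.
- by have [_ _ /(_ _ _ _ d)] := sv T; rewrite (Sigma_off_shape _ d).
apply: (dv E T T' ET ET' (fun s => moment E (mderivm a (s i j)) (mpolyX R n))).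
have DE : a i = 0%N -> a j = 0%N -> (a l < 2)%N ->
    mderivm a = id :> (poly3 R -> poly3 R) \/ mderivm a = @partial R l.
  by move=> ai aj al; exact: mderivm_le1 _ (distinct_cyc (distinct_cyc d)) al ai aj.
case: (boolP (free E i)) => fi; case: (boolP (free E j)) => fj; case: (boolP (free E l)) => fl.
- have [ai ni] := free_ok aP nP fi; have [aj nj] := free_ok aP nP fj.
  have [al nl] := free_ok aP nP fl; move: ni nj nl; rewrite !(up_distinct d) => *.
  rewrite (mderivm0E _ d)//; apply: (Sigma_off_cell ij d (cellI d fi fj fl)); bound d.
- have [ai ni] := free_ok aP nP fi; have [aj nj] := free_ok aP nP fj.
  have [al nl] := fixed_ok aP nP fl; move: ni nj al; rewrite !(up_distinct d) !addn0 => *.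
  by apply: (Sigma_off_face_ij ij d (faceI d fi fj fl)); [exact: DE|bound d].
- have [ai ni] := free_ok aP nP fi; have [aj nj] := fixed_ok aP nP fj.
  have [al nl] := free_ok aP nP fl; move: ni aj nl; rewrite !(up_distinct d) ?addn1 => *.
  have d' := distinct_swap d.
  by rewrite (mderivm0E _ d)//; [|lia]; apply: (Sigma_off_face_il ij d (faceI d' fi fl fj)); bound d.
- have [ai ni] := free_ok aP nP fi; have [aj nj] := fixed_ok aP nP fj.
  have [al nl] := fixed_ok aP nP fl; move: ni aj al; rewrite !(up_distinct d) ?addn1 addn0 => *.
  by apply: (Sigma_off_edge_i ij d (edgeI d fi fj fl)); [apply: DE => //; lia|bound d].
- have [ai ni] := fixed_ok aP nP fi; have [aj nj] := free_ok aP nP fj.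
  have [al nl] := free_ok aP nP fl; move: ai nj nl; rewrite !(up_distinct d) ?addn1 => *.
  have d' := distinct_cyc d.
  by rewrite (mderivm0E _ d)//; [|lia]; apply: (Sigma_off_face_jl ij d (faceI d' fj fl fi)); bound d.
- have [ai ni] := fixed_ok aP nP fi; have [aj nj] := free_ok aP nP fj.
  have [al nl] := fixed_ok aP nP fl; move: ai nj al; rewrite !(up_distinct d) ?addn1 addn0 => *.
  have d' := distinct_rot d.
  by apply: (Sigma_off_edge_j ij d (edgeI d' fj fi fl)); [apply: DE => //; lia|bound d].
- have [ai ni] := fixed_ok aP nP fi; have [aj nj] := fixed_ok aP nP fj.
  have [al nl] := free_ok aP nP fl; move: ai aj nl; rewrite !(up_distinct d) !addn1 => *.
  have d' := distinct_cyc (distinct_cyc d).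
  by rewrite (mderivm0E _ d)//; [|lia|lia]; apply: (Sigma_off_edge_l ij d (edgeI d' fl fi fj)); bound d.
- have [ai ni] := fixed_ok aP nP fi; have [aj nj] := fixed_ok aP nP fj.
  have [al nl] := fixed_ok aP nP fl; move: ai aj al; rewrite !(up_distinct d) !addn1 !addn0 => *.
  have vE := vertexI d fi fj fl.
  have -> : (fun s : 'M[poly3 R]_3 => moment E (mderivm a (s i j)) (mpolyX R n)) =
      (fun s => vertex_value E (mderivm a (s i j))).
    by apply/funext => s; apply: vertex_moment => //; apply: (distinct_axesP d).2.
  by apply: (Sigma_off_vertex k ij d vE); apply: DE => //; lia.
Qed.

(** The index of entry (i, j) is that of the second derivative of a function in [U_h] along [i] and
    [j]. *)
Lemma Sigma_hP : Sigma_h k cell v <->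
  (forall T, (v T)^T = v T) /\
  forall i j, conforming cell k (up (up sg0 i) j) (fun T => v T i j).
Proof.
split=> [Sv|[sv cv]].
  have sv T : (v T)^T = v T by have [/(_ T)[]] := Sv.
  split=> // i j; have [ij|ij|/val_inj->] := ltngtP i j; last exact: Sigma_diag_conforming.
    exact: Sigma_off_conforming.
  have -> : (fun T => v T i j) = (fun T => v T j i).
    by apply/funext => T; rewrite -[in LHS]sv mxE.
  apply: (@eq_conforming _ _ _ _ (up (up sg0 j) i)); last exact: Sigma_off_conforming.
  by move=> x; rewrite /up addnAC.
split=> [T|E T T' ET ET' phi].
  split=> [|i j l d|i j l d]; first exact: sv.
    by apply/(Sigma_diag_shape _ d); case: (cv i i).
  by apply/(Sigma_off_shape _ d); case: (cv i j).
case=> {phi}.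
- move=> i j l D p d /(edge_free d) e DE _; apply: (conforming_dof mesh _ (cv i i)) => //.
  have ok x : free E x || (up (up sg0 i) i x < 2)%N.
    by move: x; apply: (distinct_axesP d).2; rewrite !e !(up_distinct d).
  by case: DE => ->; [exact: deriv_of_id|apply: deriv_of_partial|apply: deriv_of_partial|
    apply: deriv_of_partial2]; rewrite ?e ?(up_distinct d) ?(distinct_neq d).
- move=> i j l D p d /(face_free d) e DE _; apply: (conforming_dof mesh _ (cv i i)) => //.
  have ok x : free E x || (up (up sg0 i) i x < 2)%N.
    by move: x; apply: (distinct_axesP d).2; rewrite !e !(up_distinct d).
  by case: DE => ->; [exact: deriv_of_id|apply: deriv_of_partial]; rewrite ?e ?(up_distinct d).
- move=> i j l p d cE _; apply: (conforming_dof_id _ (cv i i)) => // x.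
  by rewrite cell_free.
- move=> i j l D _ d vE DE; rewrite !moment_vertex//.
  apply: (conforming_dof mesh _ (cv i j)) => //.
  have ok x : free E x || (up (up sg0 i) j x < 2)%N.
    by move: x; apply: (distinct_axesP d).2; rewrite !(vertex_free _ vE) !(up_distinct d).
  by case: DE => ->; [exact: deriv_of_id|apply: deriv_of_partial];
    rewrite ?(vertex_free _ vE) ?(up_distinct d).
- move=> i j l D p _ d /(edge_free d) e DE _; apply: (conforming_dof mesh _ (cv i j)) => //.
  have ok x : free E x || (up (up sg0 i) j x < 2)%N.
    by move: x; apply: (distinct_axesP d).2; rewrite !e !(up_distinct d).
  by case: DE => ->; [exact: deriv_of_id|apply: deriv_of_partial]; rewrite ?e ?(up_distinct d).
- move=> i j l D p _ d /(edge_free (distinct_rot d)) e DE _.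
  apply: (conforming_dof mesh _ (cv i j)) => //.
  have ok x : free E x || (up (up sg0 i) j x < 2)%N.
    by move: x; apply: (distinct_axesP d).2; rewrite !e !(up_distinct d).
  by case: DE => ->; [exact: deriv_of_id|apply: deriv_of_partial]; rewrite ?e ?(up_distinct d).
- move=> i j l p _ d _ _; apply: (conforming_dof_id _ (cv i j)) => //.
  by apply: (distinct_axesP d).2; rewrite !(up_distinct d) orbT.
- move=> i j l D p _ d /(face_free d) e DE _; apply: (conforming_dof mesh _ (cv i j)) => //.
  have ok x : free E x || (up (up sg0 i) j x < 2)%N.
    by move: x; apply: (distinct_axesP d).2; rewrite !e !(up_distinct d).
  by case: DE => ->; [exact: deriv_of_id|apply: deriv_of_partial]; rewrite ?e ?(up_distinct d).
- move=> i j l p _ d _ _; apply: (conforming_dof_id _ (cv i j)) => //.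
  by apply: (distinct_axesP d).2; rewrite !(up_distinct d) orbT.
- move=> i j l p _ d _ _; apply: (conforming_dof_id _ (cv i j)) => //.
  by apply: (distinct_axesP d).2; rewrite !(up_distinct d) orbT.
- move=> i j l p _ d _ _; apply: (conforming_dof_id _ (cv i j)) => //.
  by apply: (distinct_axesP d).2; rewrite !(up_distinct d) orbT.
Qed.

End Sigma.

End Dofs.

Section Dofs.
Variables (R : realType) (I : finType) (cell : I -> box R) (k : nat).
Hypothesis mesh : aligned_mesh cell.
Hypothesis k3 : (3 <= k)%N.
Implicit Types (sg : axis -> nat) (E : box R) (a n : multinom 3) (i j l x : axis) (p : poly3 R).
Local Notation free E x := (lo E 0 x < hi E 0 x).

Section Xi.
Variable v : I -> 'M[poly3 R]_3.

Lemma Xi_diag_shape i j l p : distinct_axes i j l ->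
  Qspace [:: (i, k%:Z - 1); (j, k%:Z - 1); (l, k%:Z - 1)] p <->
  degb (fun=> k) (upn (up sg0 i) i) p.
Proof.
by move=> d; refine (Qspace_distinct p d _ _ _); rewrite /= ?eqxx ?(distinct_neq d) !(upn_distinct d); lia.
Qed.

Lemma Xi_off_shape i j l p : distinct_axes i j l ->
  Qspace [:: (i, k%:Z - 2); (j, k%:Z); (l, k%:Z - 1)] p <->
  degb (fun=> k) (upn (up sg0 i) j) p.
Proof.
by move=> d; refine (Qspace_distinct p d _ _ _); rewrite /= ?eqxx ?(distinct_neq d) !(upn_distinct d); lia.
Qed.

Lemma upn_diag i x : upn (up sg0 i) i x = 1%N.
Proof. by rewrite /upn /up /sg0; case: eqP. Qed.

Lemma Xi_diag_conforming i : (i < 2)%N -> Xi_h k cell v ->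
  conforming cell k (upn (up sg0 i) i) (fun T => v T i i).
Proof.
move=> i2 [sv dv]; have [j [l d]] := distinct_diag i.
apply: conforming_of_moments => // [x|T|E T T' a n ET ET' aP nP].
- by rewrite upn_diag.
- by have [_ /(_ _ _ _ d) + _] := sv T; rewrite (Xi_diag_shape _ d).
apply: (dv E T T' ET ET' (fun s => moment E (mderivm a (s i i)) (mpolyX R n))).
have a0 x : a x = 0%N by have := aP x; case: ifP => // _; rewrite upn_diag; lia.
have F x : free E x -> (n x + 3 <= k)%N.
  by move=> f; have [_] := free_ok aP nP f; rewrite upn_diag; lia.
rewrite (mderivm0E _ distinct_ax)//.
apply: (@entityP _ _ _ _ E _ distinct_ax) => [vE _ _ _|x y z d' eE fx fy fz|x y z d' fE fx fy fz|cE f0 f1 f2].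
- have -> : (fun s : 'M[poly3 R]_3 => moment E (s i i) (mpolyX R n)) =
      (fun s => vertex_value E (s i i)).
    apply/funext => s; apply: vertex_moment => // x.
    by have [|_ ->] := @fixed_ok _ _ _ _ _ _ x aP nP; rewrite ?(vertex_free _ vE).
  exact: Xi_diag_vertex.
- have nx := F _ fx; have [_ ny] := fixed_ok aP nP fy; have [_ nz] := fixed_ok aP nP fz.
  by apply: (Xi_diag_edge i2 eE); bound d'.
- have nx := F _ fx; have ny := F _ fy; have [_ nz] := fixed_ok aP nP fz.
  by apply: (Xi_diag_face i2 fE); bound d'.
- have n0 := F _ f0; have n1 := F _ f1; have n2 := F _ f2.
  by apply: (Xi_diag_cell i2 cE); bound distinct_ax.
Qed.

Lemma Xi_off_conforming i j l : distinct_axes i j l -> Xi_h k cell v ->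
  conforming cell k (upn (up sg0 i) j) (fun T => v T i j).
Proof.
move=> d [sv dv].
apply: conforming_of_moments => // [x|T|E T T' a n ET ET' aP nP].
- by rewrite /upn /up /sg0; case: eqP; case: eqP.
- by have [_ _ /(_ _ _ _ d)] := sv T; rewrite (Xi_off_shape _ d).
apply: (dv E T T' ET ET' (fun s => moment E (mderivm a (s i j)) (mpolyX R n))).
case: (boolP (free E i)) => fi; last first.
  by have [] := fixed_ok aP nP fi; rewrite (upn_distinct d) addn2.
have [ai ni] := free_ok aP nP fi; rewrite (upn_distinct d) in ni.
have al : a l = 0%N by have := aP l; case: ifP => // _; rewrite (upn_distinct d); lia.
case: (boolP (free E j)) => fj; case: (boolP (free E l)) => fl.
- have [aj nj] := free_ok aP nP fj; have [_ nl] := free_ok aP nP fl.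
  rewrite (upn_distinct d) in nj; rewrite (upn_distinct d) in nl.
  by rewrite (mderivm0E _ d)//; apply: (Xi_off_cell d (cellI d fi fj fl)); bound d.
- have [aj nj] := free_ok aP nP fj; have [_ nl] := fixed_ok aP nP fl.
  rewrite (upn_distinct d) in nj.
  by rewrite (mderivm0E _ d)//; apply: (Xi_off_face_ij d (faceI d fi fj fl)); bound d.
- have [aj nj] := fixed_ok aP nP fj; have [_ nl] := free_ok aP nP fl.
  rewrite (upn_distinct d) addn0 in aj; rewrite (upn_distinct d) in nl.
  have d' := distinct_swap d.
  by apply: (Xi_off_face_il d (faceI d' fi fl fj)); [exact: mderivm_le1 _ (distinct_rot d) aj ai al|bound d].
- have [aj nj] := fixed_ok aP nP fj; have [_ nl] := fixed_ok aP nP fl.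
  rewrite (upn_distinct d) addn0 in aj.
  by apply: (Xi_off_edge d (edgeI d fi fj fl)); [exact: mderivm_le1 _ (distinct_rot d) aj ai al|bound d].
Qed.

Lemma Xi_hP : Xi_h k cell v <->
  (forall T, \tr (v T) = 0) /\
  forall i j, conforming cell k (upn (up sg0 i) j) (fun T => v T i j).
Proof.
split=> [Xv|[tv cv]].
  have tv T : \tr (v T) = 0 by have [/(_ T)[]] := Xv.
  split=> // i j; have [<-|ij] := eqVneq i j; last first.
    by have [l d] := distinct_axes_ex ij; exact: Xi_off_conforming d Xv.
  have [i2|i2] := ltnP i 2; first exact: Xi_diag_conforming.
  (* The last diagonal entry has no degrees of freedom of its own. It is conforming by
     tracelessness, as all diagonal entries have index 1 in every variable. *)
  have -> : i = ax2 by apply/val_inj; have := ltn_ord i; rewrite /=; lia.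
  have -> : (fun T => v T ax2 ax2) = (fun T => - (v T ax0 ax0 + v T ax1 ax1)).
    apply/funext => T; have := tv T; rewrite /mxtrace sum_axis addrA => /eqP.
    by rewrite addrC addr_eq0 => /eqP.
  have e x : upn (up sg0 ax0) ax0 =1 upn (up sg0 x) x by move=> y; rewrite !upn_diag.
  apply: eq_conforming (e ax2) _; apply: conformingN; apply: conformingD.
    exact: Xi_diag_conforming.
  by apply: eq_conforming (fsym (e ax1)) _; exact: Xi_diag_conforming.
split=> [T|E T T' ET ET' phi].
  split=> [|i j l d|i j l d]; first exact: tv.
    by apply/(Xi_diag_shape _ d); case: (cv i i).
  by apply/(Xi_off_shape _ d); case: (cv i j).
have ok1 i x : free E x || (upn (up sg0 i) i x < 2)%N by rewrite upn_diag orbT.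
have ok i j l : distinct_axes i j l -> free E i -> forall x, free E x || (upn (up sg0 i) j x < 2)%N.
  by move=> d fi; apply: (distinct_axesP d).2; rewrite ?fi !(upn_distinct d)// orbT.
case=> {phi}.
- by move=> i _ vE; rewrite !moment_vertex//; apply: (conforming_dof_id mesh _ (cv i i)).
- by move=> i x p _ _ _; apply: (conforming_dof_id mesh _ (cv i i)).
- by move=> i x y p _ _ _; apply: (conforming_dof_id mesh _ (cv i i)).
- by move=> i p _ _ _; apply: (conforming_dof_id mesh _ (cv i i)).
- move=> i j l D p d /(edge_free d) e DE _; apply: (conforming_dof mesh _ (cv i j)) => //.
  have {}ok := ok _ _ _ d (e.1.1).
  by case: DE => ->; [exact: deriv_of_id|apply: deriv_of_partial]; rewrite ?e ?(upn_distinct d).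
- move=> i j l p d /(face_free d) e _; apply: (conforming_dof_id mesh _ (cv i j)) => //.
  exact: ok _ _ _ d (e.1.1).
- move=> i j l D p d /(face_free (distinct_swap d)) e DE _.
  apply: (conforming_dof mesh _ (cv i j)) => //.
  have {}ok := ok _ _ _ d (e.1.1).
  by case: DE => ->; [exact: deriv_of_id|apply: deriv_of_partial]; rewrite ?e ?(upn_distinct d).
- move=> i j l p d cE _; apply: (conforming_dof_id mesh _ (cv i j)) => //.
  exact: ok _ _ _ d (cell_free _ cE).
Qed.

End Xi.

(** The index of the derivative along [j] of entry (i, j) of a field in [Xi_h]; it does not depend
    on [j]. *)
Definition upQ i : axis -> nat := fun x => (up sg0 i x + 1)%N.

Lemma upQ_distinct i j l : distinct_axes i j l -> (upQ i i = 2%N) * (upQ i j = 1%N) * (upQ i l = 1%N).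
Proof. by move=> d; rewrite /upQ /up /sg0 eqxx !(distinct_neq d). Qed.

Lemma Q_shapeE i j l p : distinct_axes i j l ->
  Qspace [:: (i, k%:Z - 2); (j, k%:Z - 1); (l, k%:Z - 1)] p <-> degb (fun=> k) (upQ i) p.
Proof.
by move=> d; refine (Qspace_distinct p d _ _ _); rewrite /= ?eqxx ?(distinct_neq d) !(upQ_distinct d); lia.
Qed.

Lemma Q_hP v : Q_h k cell v <-> forall i, conforming cell k (upQ i) (fun T => v T 0 i).
Proof.
split=> [[sv dv] i|cv].
  have [j [l d]] := distinct_diag i.
  apply: conforming_of_moments => // [x|T|E T T' a n ET ET' aP nP].
  - by rewrite /upQ /up /sg0; case: eqP.
  - by have := sv T i j l d; rewrite (Q_shapeE _ d).
  apply: (dv E T T' ET ET' (fun s => moment E (mderivm a (s 0 i)) (mpolyX R n))).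
  case: (boolP (free E i)) => fi; last first.
    by have [] := fixed_ok aP nP fi; rewrite (upQ_distinct d) addn2.
  have [ai ni] := free_ok aP nP fi; rewrite (upQ_distinct d) in ni.
  have aj : a j = 0%N by have := aP j; case: ifP => // _; rewrite (upQ_distinct d); lia.
  have al : a l = 0%N by have := aP l; case: ifP => // _; rewrite (upQ_distinct d); lia.
  rewrite (mderivm0E _ d)//.
  case: (boolP (free E j)) => fj; case: (boolP (free E l)) => fl.
  - have [_ nj] := free_ok aP nP fj; have [_ nl] := free_ok aP nP fl.
    rewrite (upQ_distinct d) in nj; rewrite (upQ_distinct d) in nl.
    by apply: (Q_cell d (cellI d fi fj fl)); bound d.
  - have [_ nj] := free_ok aP nP fj; have [_ nl] := fixed_ok aP nP fl.
    rewrite (upQ_distinct d) in nj.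
    by apply: (Q_face (faceI d fi fj fl)); bound d.
  - have [_ nj] := fixed_ok aP nP fj; have [_ nl] := free_ok aP nP fl.
    rewrite (upQ_distinct d) in nl; have d' := distinct_swap d.
    by apply: (Q_face (faceI d' fi fl fj)); bound d.
  - have [_ nj] := fixed_ok aP nP fj; have [_ nl] := fixed_ok aP nP fl.
    by apply: (Q_edge (edgeI d fi fj fl)); bound d.
split=> [T i j l d|E T T' ET ET' phi]; first by apply/(Q_shapeE _ d); case: (cv i).
have ok i : i \in free_axes E -> forall x, free E x || (upQ i x < 2)%N.
  rewrite freeE => fi x; rewrite /upQ /up /sg0.
  by case: eqP => [->|_]; rewrite ?fi ?orbT.
case=> {phi}.
- by move=> i p eE _; apply: (conforming_dof_id mesh _ (cv i)) => //; apply: ok; rewrite eE inE.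
- by move=> i j p [_ eE] _; apply: (conforming_dof_id mesh _ (cv i)) => //; apply: ok; rewrite eE !inE eqxx.
- by move=> i j l p _ eE _; apply: (conforming_dof_id mesh _ (cv i)) => //; apply: ok; rewrite eE inE.
Qed.

End Dofs.

(** * The complex *)

Section Operators.
Variable R : realType.
Implicit Types (p : poly3 R) (s : 'M[poly3 R]_3).

Lemma curl_gradgrad p : curl (gradgrad p) = 0.
Proof.
by apply/matrixP => i j; rewrite !mxE !(partialC _ i) (partialC (j - 1)) subrr.
Qed.

Lemma curlD s s' : curl (s + s') = curl s + curl s'.
Proof. by apply/matrixP => i j; rewrite !mxE !raddfD /= addrACA. Qed.

Lemma divD s s' : div (s + s') = div s + div s'.
Proof.
apply/rowP => i; rewrite !mxE -big_split /=.
by apply: eq_bigr => j _; rewrite !mxE raddfD.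
Qed.

Lemma div_curl s : div (curl s) = 0.
Proof.
apply/rowP => i; rewrite !mxE sum_axis !mxE !ax_cyc !raddfB /=.
by rewrite (partialC ax1 ax0) (partialC ax2 ax0) (partialC ax2 ax1); ring.
Qed.

(** The link between the row complexes and the scalar one: the trace of a curl is minus the
    divergence of the vector encoding the skew part. *)
Lemma tr_curl s : \tr (curl s) =
  - \sum_m partial m (s (m + 1) (m - 1) - s (m - 1) (m + 1)).
Proof. by rewrite /mxtrace !sum_axis !mxE !ax_cyc !raddfB /=; ring. Qed.

Lemma tr_curl_sym s : s^T = s -> \tr (curl s) = 0.
Proof.
move=> ss; rewrite tr_curl big1 ?oppr0// => m _.
by rewrite -{1}ss mxE subrr raddf0.
Qed.

End Operators.

Lemma up_up (b : axis -> nat) i j : up (up b i) j =1 up (up b j) i.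
Proof. by move=> x; rewrite /up addnAC. Qed.

Lemma up_up_upn b j : up (up b (j - 1)) (j + 1) =1 upn b j.
Proof. by move=> x; rewrite /up /upn -addnA; congr addn; elim/axisP: j; elim/axisP: x. Qed.

Lemma up_upn b j : up (upn b j) j =1 fun x => (b x + 1)%N.
Proof. by move=> x; rewrite /up /upn -addnA; case: (x == j). Qed.

Section Complex.
Variables (R : realType) (I : finType) (cell : I -> box R) (k : nat).
Hypothesis mesh : aligned_mesh cell.
Hypothesis k3 : (3 <= k)%N.
Hypothesis nerve : forall n (f : seq I -> R),
  (forall s, size s = n.+1 -> clique cell s -> del f s = 0) ->
  exists g, forall s, size s = n -> clique cell s -> f s = del g s.

Local Notation S := (conforming cell k).

Let sg0_le1 i : (sg0 i <= 1)%N. Proof. by []. Qed.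
(** The row complexes start at index [up sg0 j], still at most 1, so exactness applies to them. *)
Let up_le1 j i : (up sg0 j i <= 1)%N. Proof. by rewrite /up; case: eqP. Qed.

Lemma curl_conforming (s : I -> 'M[poly3 R]_3) :
  (forall i j, S (up (up sg0 i) j) (fun T => s T i j)) ->
  forall i j, S (upn (up sg0 i) j) (fun T => curl (s T) i j).
Proof.
move=> Ss i j.
have -> : (fun T => curl (s T) i j) =
    fun T => partial (j + 1) (s T i (j - 1)) - partial (j - 1) (s T i (j + 1)).
  by apply/funext => T; rewrite mxE.
apply: conformingB.
  by apply: eq_conforming (up_up_upn _ _) _; apply: conforming_partial.
apply: eq_conforming (up_up_upn _ _) _; apply: eq_conforming (up_up _ _ _) _.
by apply: conforming_partial.
Qed.

Lemma gradgrad_into (u : I -> poly3 R) : U_h k cell u -> Sigma_h k cell (cellwise (@gradgrad R) u).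
Proof.
move/(U_hP mesh k3) => Su; apply/(Sigma_hP mesh k3); split=> [T|i j].
  by apply/matrixP => i j; rewrite !mxE partialC.
have -> : (fun T => cellwise (@gradgrad R) u T i j) = fun T => partial i (partial j (u T)).
  by apply/funext => T; rewrite mxE.
by apply: eq_conforming (up_up _ _ _) _; do 2!apply: conforming_partial.
Qed.

Lemma curl_into (s : I -> 'M[poly3 R]_3) :
  Sigma_h k cell s -> Xi_h k cell (cellwise (@curl R) s).
Proof.
move/(Sigma_hP mesh k3) => [sym Ss]; apply/(Xi_hP mesh k3); split=> [T|].
  exact: tr_curl_sym.
exact: curl_conforming.
Qed.

Lemma div_into (t : I -> 'M[poly3 R]_3) : Xi_h k cell t -> Q_h k cell (cellwise (@div R) t).
Proof.
move/(Xi_hP mesh k3) => [_ St]; apply/(Q_hP mesh k3) => i.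
have -> : (fun T => cellwise (@div R) t T 0 i) = fun T => \sum_j partial j (t T i j).
  by apply/funext => T; rewrite mxE.
have Sp j : S (upQ i) (fun T => partial j (t T i j)).
  by apply: eq_conforming (up_upn _ _) _; apply: conforming_partial.
have -> : (fun T => \sum_j partial j (t T i j)) = fun T => partial ax0 (t T i ax0) +
    (partial ax1 (t T i ax1) + partial ax2 (t T i ax2)).
  by apply/funext => T; rewrite sum_axis.
by do 2?apply: conformingD.
Qed.

Lemma P1_conforming (p : poly3 R) : (mmeasure mdeg p <= 2)%N -> S sg0 (fun=> p).
Proof.
move=> p2; split=> // T m mp x; rewrite /sg0 addn0.
have : (mdeg m < mmeasure mdeg p)%N by exact: mmeasure_mnm_lt.
by rewrite mdegE (bigD1 x) //=; lia.
Qed.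

Lemma gradgrad_P1 (p : poly3 R) : (mmeasure mdeg p <= 2)%N -> gradgrad p = 0.
Proof.
move=> p2; apply/matrixP => i j; rewrite !mxE; apply/mpolyP => m.
rewrite !mcoeff_deriv mcoeff0 memN_msupp_eq0 ?mul0rn//.
apply: (mmeasure_mnm_ge (mf := mdeg)); apply: (leq_trans p2).
by rewrite -[X in (_ <= X)%N]/(mdeg _) !mdegD !mdeg1; lia.
Qed.

Lemma gradgrad_ker (u : I -> poly3 R) : S sg0 u -> (forall T, gradgrad (u T) = 0) -> P1 u.
Proof.
move=> Su u0.
have /choice[c cE] j : exists c, forall T, partial j (u T) = mpolyC 3 c.
  apply: (grad_const mesh k3 nerve (up_le1 j)) => [|i T]; first exact: conforming_partial.
  by have /matrixP/(_ i j) := u0 T; rewrite !mxE.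
pose p : poly3 R := \sum_j c j *: mpolyX R (mnm1 j).
have p2 : (mmeasure mdeg p <= 2)%N.
  apply: leq_trans (mmeasure_sum _ _ _ _) _; apply/bigmax_leqP => j _.
  by apply: leq_trans (mmeasureZ_le _ _ _) _; rewrite mmeasureX -[X in (X.+1 <= _)%N]/(mdeg _) mdeg1.
have dp i : partial i p = mpolyC 3 (c i).
  rewrite raddf_sum (bigD1 i)//= big1 => [|j ji]; rewrite /partial mderivZ mderivX mnm1E.
    have -> : mnm_sub (mnm1 i) (mnm1 i) = @mnm0 3 by apply/mnmP => x; rewrite mnmBE mnm0E subnn.
    by rewrite eqxx scale1r addr0 mpolyX0 alg_mpolyC.
  by rewrite (negbTE ji) scale0r scaler0.
have [||c0 c0E] := grad_const mesh k3 nerve sg0_le1 (v := fun T => u T - p).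
- by apply: conformingB => //; exact: P1_conforming.
- by move=> i T; rewrite raddfB /= dp cE subrr.
exists (p + mpolyC 3 c0); last by move=> T; rewrite -(c0E T) addrC subrK.
by apply: leq_trans (mmeasureD_le _ _ _) _; rewrite geq_max p2 mmeasureC; case: eqP.
Qed.

(** The rows of [s] are gradients of the components of a field [w]; symmetry of [s] then says that
    [w] itself is curl-free, hence a gradient. *)
Lemma curl_ker (s : I -> 'M[poly3 R]_3) : Sigma_h k cell s -> (forall T, curl (s T) = 0) ->
  exists2 u, U_h k cell u & cellwise (@gradgrad R) u = s.
Proof.
move/(Sigma_hP mesh k3) => [sym Ss] s0.
have /choice[w wP] i : exists w, S (up sg0 i) w /\ forall j T, s T i j = partial j (w T).
  have [|a b T|w Sw wE] := grad_exact mesh k3 nerve (up_le1 i) (v := fun j T => s T i j).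
  - exact: Ss.
  - have e j : partial (j + 1) (s T i (j - 1)) = partial (j - 1) (s T i (j + 1)).
      by have /matrixP/(_ i j) := s0 T; rewrite !mxE => /eqP; rewrite subr_eq0 => /eqP.
    have := e ax0; have := e ax1; have := e ax2; rewrite !ax_cyc => e2 e1 e0.
    by elim/axisP: a; elim/axisP: b.
  by exists w.
have [|i j T|u Su uE] := grad_exact mesh k3 nerve sg0_le1 (v := w).
- by move=> i; have [] := wP i.
- have [_ wi] := wP i; have [_ wj] := wP j; rewrite -wi -wj.
  by rewrite -[in LHS]sym mxE.
exists u; first exact/(U_hP mesh k3).
apply/funext => T; apply/matrixP => i j; rewrite mxE -uE.
by have [_ wj] := wP j; rewrite -wj -[in RHS]sym mxE.
Qed.

(** The rows give [t = curl (rho T)] with no symmetry. Since [t] is traceless, the skew part of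
    [rho] is divergence-free, hence a curl of some [w]; adding the row-wise gradient of [w]
    symmetrises [rho] without changing its curl. *)
Lemma div_ker (t : I -> 'M[poly3 R]_3) : Xi_h k cell t -> (forall T, div (t T) = 0) ->
  exists2 s, Sigma_h k cell s & cellwise (@curl R) s = t.
Proof.
move/(Xi_hP mesh k3) => [tr0 St] t0.
have /choice[r rP] i : exists r : axis -> I -> poly3 R, (forall j, S (up (up sg0 i) j) (r j)) /\
    forall j T, t T i j = partial (j + 1) (r (j - 1) T) - partial (j - 1) (r (j + 1) T).
  have [||r Sr rE] := curl_exact mesh k3 nerve (up_le1 i) (c := fun j T => t T i j).
  - exact: St.
  - by move=> T; have /rowP/(_ i) := t0 T; rewrite !mxE.
  by exists r.
pose rho T : 'M[poly3 R]_3 := \matrix_(i, j) r i j T.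
have tE T : t T = curl (rho T).
  by apply/matrixP => i j; rewrite !mxE; have [_ ->] := rP i.
(* The two entries being subtracted share the index 1 along [m + 1] and [m - 1] and 0 along [m],
   which is that of a 2-form coefficient over [sg0]. *)
have [||w Sw wE] := curl_exact mesh k3 nerve sg0_le1
    (c := fun m T => r (m + 1) (m - 1) T - r (m - 1) (m + 1) T).
- move=> m; have [Sp _] := rP (m + 1); have [Sm _] := rP (m - 1).
  apply: conformingB; last by apply: eq_conforming (up_up_upn _ _) _.
  by apply: eq_conforming (up_up_upn _ _) _; apply: eq_conforming (up_up _ _ _) _.
- move=> T; have := tr0 T; rewrite tE tr_curl => /eqP; rewrite oppr_eq0 => /eqP e; rewrite -[RHS]e.
  by apply: eq_bigr => m _; rewrite !mxE.
pose sig T : 'M[poly3 R]_3 := rho T + \matrix_(i, j) partial j (w i T).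
exists sig; last first.
  apply/funext => T; rewrite /cellwise curlD tE -[RHS]addr0; congr (_ + _).
  by apply/matrixP => i j; rewrite !mxE partialC subrr.
apply/(Sigma_hP mesh k3); split=> [T|i j].
  have e m : sig T (m + 1) (m - 1) = sig T (m - 1) (m + 1).
    have := wE m T; rewrite !mxE => /eqP; rewrite subr_eq => /eqP ->; ring.
  have := e ax0; have := e ax1; have := e ax2; rewrite !ax_cyc => e2 e1 e0.
  by apply/matrixP => i j; rewrite mxE; elim/axisP: i; elim/axisP: j.
have -> : (fun T => sig T i j) = fun T => r i j T + partial j (w i T).
  by apply/funext => T; rewrite !mxE.
by apply: conformingD; [have [] := rP i|exact: conforming_partial].
Qed.

Lemma div_onto (q : I -> 'rV[poly3 R]_3) : Q_h k cell q ->
  exists2 t, Xi_h k cell t & cellwise (@div R) t = q.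
Proof.
move/(Q_hP mesh k3) => Sq.
have /choice[r rP] i : exists r : axis -> I -> poly3 R, (forall j, S (upn (up sg0 i) j) (r j)) /\
    forall T, q T 0 i = \sum_j partial j (r j T).
  by have [r Sr rE] := div_exact mesh k3 nerve (up_le1 i) (Sq i); exists r.
have [|e Se eE] := div_exact mesh k3 nerve sg0_le1 (q := fun T => r ax0 ax0 T + (r ax1 ax1 T + r ax2 ax2 T)).
  have D i : S (fun j => (sg0 j + 1)%N) (r i i).
    have [Sr _] := rP i; apply: eq_conforming (Sr i) => x; exact: upn_diag.
  by do 2?apply: conformingD.
(* The entry (m + 1, m - 1) is [e m] and all others vanish. By [tr_curl] the trace of the curl is
   minus the divergence of [e], which cancels the trace of [t0]; the divergence is unaffected. *)
pose rho T : 'M[poly3 R]_3 := \matrix_(i, j) if j == i + 1 then e (i - 1) T else 0.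
pose t0 T : 'M[poly3 R]_3 := \matrix_(i, j) r i j T.
exists (fun T => t0 T + curl (rho T)); last first.
  apply/funext => T; rewrite /cellwise divD div_curl addr0.
  apply/rowP => i; rewrite mxE; have [_ ->] := rP i.
  by apply: eq_bigr => j _; rewrite mxE.
have Srho i j : S (up (up sg0 i) j) (fun T => rho T i j).
  have -> : (fun T => rho T i j) = if j == i + 1 then e (i - 1) else fun=> 0.
    by apply/funext => T; rewrite mxE; case: ifP.
  case: eqP => [->|_]; last exact: conforming0.
  apply: eq_conforming (Se (i - 1)) => x; rewrite -up_up_upn up_up.
  by elim/axisP: i; rewrite !ax_cyc.
apply/(Xi_hP mesh k3); split=> [T|i j].
  rewrite raddfD /= tr_curl; apply/eqP; rewrite subr_eq0; apply/eqP.
  transitivity (\sum_m partial m (e m T)).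
    by rewrite -eE /mxtrace sum_axis !mxE.
  by apply: eq_bigr => m _; elim/axisP: m; rewrite !mxE !ax_cyc /= subr0.
have -> : (fun T => (t0 T + curl (rho T)) i j) = fun T => r i j T + curl (rho T) i j.
  by apply/funext => T; rewrite !mxE.
by apply: conformingD; [have [] := rP i|exact: curl_conforming].
Qed.

End Complex.

Theorem theorem3p1 (R : realType) (k : nat) (hk : (3 <= k)%N)
    (Omega : set 'rV[R]_3) (hOmega : lipschitz_domain Omega)
    (hcontr : contractible R Omega)
    (I : finType) (cell : I -> box R) (hmesh : cuboid_mesh Omega cell) :
  [/\ @P1 R I `<=` U_h k cell,
      cellwise (@gradgrad R) @` U_h k cell `<=` Sigma_h k cell,
      cellwise (@curl R) @` Sigma_h k cell `<=` Xi_h k cell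
    & cellwise (@div R) @` Xi_h k cell `<=` Q_h k cell] /\
  [/\ kernel_on (@gradgrad R) (U_h k cell) = @P1 R I,
      kernel_on (@curl R) (Sigma_h k cell) = cellwise (@gradgrad R) @` U_h k cell,
      kernel_on (@div R) (Xi_h k cell) = cellwise (@curl R) @` Sigma_h k cell
    & cellwise (@div R) @` Xi_h k cell = Q_h k cell].
Proof.
have mesh := cuboid_mesh_aligned hmesh.
have nerve := mesh_nerve_exact hOmega hcontr hmesh.
have P1U (u : I -> poly3 R) : P1 u -> U_h k cell u /\ forall T, gradgrad (u T) = 0.
  move=> [p p2 uE]; have -> : u = fun=> p by apply/funext.
  split=> [|T]; last exact: gradgrad_P1.
  by apply/(U_hP mesh hk); exact: P1_conforming.
split; split.
- by move=> u /P1U[].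
- by move=> _ [u Uu <-]; exact: gradgrad_into.
- by move=> _ [s Ss <-]; exact: curl_into.
- by move=> _ [t Xt <-]; exact: div_into.
- apply/seteqP; split=> u; last exact: P1U.
  by case=> /(U_hP mesh hk); exact: gradgrad_ker.
- apply/seteqP; split=> [s [Ss s0]|_ [u Uu <-]].
    by have [u Uu uE] := curl_ker mesh hk nerve Ss s0; exists u.
  by split=> [|T]; [exact: gradgrad_into|exact: curl_gradgrad].
- apply/seteqP; split=> [t [Xt t0]|_ [s Ss <-]].
    by have [s Ss sE] := div_ker mesh hk nerve Xt t0; exists s.
  by split=> [|T]; [exact: curl_into|exact: div_curl].
- apply/seteqP; split=> [_ [t Xt <-]|q Qq]; first exact: div_into.
  by have [t Xt tE] := div_onto mesh hk nerve Qq; exists t.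
Qed.
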